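(* Let $M$ be a Riemann surface and let $f:M\to\mathbb{H}=\mathbb{R}^4$ be a conformal immersion. Then $f$ is super-conformal if and only if $\begin{bmatrix} f\\1\end{bmatrix}:M\to\mathbb{H}P^1$ or $\begin{bmatrix}\bar f\\1\end{bmatrix}:M\to\mathbb{H}P^1$ is the twistor projection of a holomorphic curve in $\mathbb{C}P^3$.
   Context: $\mathbb{H}$ denotes the quaternions; quaternionic vector spaces are right vector spaces. $M$ has complex structure $J:TM\to TM$, and for a 1-form $\omega$ we put $*\omega(X)=\omega(JX)$. Conformal immersion: an immersion $f:M\to\mathbb{H}$ is conformal (with respect to the given complex structure on $M$) if there are $N,R:M\to\mathbb{H}$ with $N^2=R^2=-1$ and $*df=N\,df=-df\,R$; $N$ and $R$ (the left and right normal vectors) are unique. Note that $\bar f$ is then also conformal, with left normal $R$ and right normal $N$. Super-conformal: let $II$ be the second fundamental form of $f$, with values in the normal space. At each $p\in M$, the image of the unit tangent circle (for the induced metric) under $v\mapsto II(v,v)$ is a (possibly degenerate) ellipse in the normal space, the curvature ellipse. The surface is super-conformal if at every point this ellipse is a circle (radius $0$, i.e. a single point, allowed). Line bundles: a map $M\to\mathbb{H}P^1$ is identified with the quaternionic line subbundle $L\subset H:=M\times\mathbb{H}^2$ whose fibre at $p$ is the line given by the value at $p$; $\begin{bmatrix} f\\1\end{bmatrix}$ denotes the line bundle spanned by $\begin{pmatrix} f\\1\end{pmatrix}$. If $f$ is conformal with right normal $R$, this $L$ carries the complex structure $J_L\in\Gamma(\mathrm{End}(L))$, $J_L\begin{pmatrix}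 f\\1\end{pmatrix}=-\begin{pmatrix} f\\1\end{pmatrix}R$. Twistor projection: regard $H=M\times\mathbb{H}^2=M\times\mathbb{C}^4$ as a complex bundle via right multiplication by $i$. Let $E\subset H$ be a complex line subbundle, $\pi_E:H\to H/E$ the projection, $\delta_E\phi:=\pi_E d\phi$ for $\phi\in\Gamma(E)$, and $J_E$ right multiplication by $i$ on $E$. $E$ is called a holomorphic curve in $\mathbb{C}P^3$ if $*\delta_E=\delta_E J_E$. The twistor projection of $E$ is the pair $(L,J_L)$ with $L=E\mathbb{H}=E\oplus Ej$ and $J_L$ the quaternionic linear endomorphism of $L$ equal to right multiplication by $i$ on $E$ and by $-i$ on $Ej$. *)

(* Defs.v *)
From HB Require Import structures.
From mathcomp Require Import all_boot all_order all_algebra complex ring.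
From mathcomp Require Import all_classical all_reals all_analysis.

Set Implicit Arguments.
Unset Strict Implicit.
Unset Printing Implicit Defensive.

Import Order.TTheory GRing.Theory Num.Theory.
Import numFieldNormedType.Exports.

Local Open Scope classical_set_scope.
Local Open Scope complex_scope.
Local Open Scope ring_scope.

(* (a, b, c, d) stands for a + b i + c j + d k. The normed-module structure
   copied from 'rV[R]_4 carries the sup norm; it is used only for the topology
   and for derivatives. The Euclidean structure is qdot below. *)
Definition quat (R : realType) : Type := 'rV[R]_4.

HB.instance Definition _ (R : realType) :=
  NormedModule.copy (quat R) 'rV[R]_4.

Section Quaternions.
Variable R : realType.
Implicit Types p q : quat R.

Definition Quat (a b c d : R) : quat R :=
  \row_(i < 4) [:: a; b; c; d]`_i.

Definition qcoord (n : nat) (q : quat R) : R := (q : 'rV[R]_4) 0 (inord n).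

Definition qmul p q : quat R :=
  let a := qcoord 0 p in let b := qcoord 1 p in
  let c := qcoord 2 p in let d := qcoord 3 p in
  let a' := qcoord 0 q in let b' := qcoord 1 q in
  let c' := qcoord 2 q in let d' := qcoord 3 q in
  Quat (a * a' - b * b' - c * c' - d * d')
       (a * b' + b * a' + c * d' - d * c')
       (a * c' - b * d' + c * a' + d * b')
       (a * d' + b * c' - c * b' + d * a').

Lemma quatP p q :
  qcoord 0 p = qcoord 0 q -> qcoord 1 p = qcoord 1 q ->
  qcoord 2 p = qcoord 2 q -> qcoord 3 p = qcoord 3 q -> p = q.
Proof.
move=> h0 h1 h2 h3; apply/rowP => -[[|[|[|[|//]]]] lt_i4].
- by move: h0; rewrite /qcoord; congr (p 0 _ = q 0 _); apply/val_inj; rewrite /= inordK.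
- by move: h1; rewrite /qcoord; congr (p 0 _ = q 0 _); apply/val_inj; rewrite /= inordK.
- by move: h2; rewrite /qcoord; congr (p 0 _ = q 0 _); apply/val_inj; rewrite /= inordK.
- by move: h3; rewrite /qcoord; congr (p 0 _ = q 0 _); apply/val_inj; rewrite /= inordK.
Qed.

Lemma qcoordE a b c d :
  (qcoord 0 (Quat a b c d) = a) * (qcoord 1 (Quat a b c d) = b) *
  (qcoord 2 (Quat a b c d) = c) * (qcoord 3 (Quat a b c d) = d).
Proof. by rewrite /qcoord /Quat !mxE !inordK. Qed.

Lemma qcoordD n p q : qcoord n (p + q) = qcoord n p + qcoord n q.
Proof. by rewrite /qcoord mxE. Qed.

Fact qmulA : associative qmul.
Proof. by move=> p q r; apply: quatP; rewrite /qmul !qcoordE; ring. Qed.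

Fact qmul1l : left_id (Quat 1 0 0 0) qmul.
Proof. by move=> p; apply: quatP; rewrite /qmul !qcoordE; ring. Qed.

Fact qmul1r : right_id (Quat 1 0 0 0) qmul.
Proof. by move=> p; apply: quatP; rewrite /qmul !qcoordE; ring. Qed.

Fact qmulDl : left_distributive qmul +%R.
Proof.
by move=> p q r; apply: quatP; rewrite /qmul !(qcoordE, qcoordD); ring.
Qed.

Fact qmulDr : right_distributive qmul +%R.
Proof.
by move=> p q r; apply: quatP; rewrite /qmul !(qcoordE, qcoordD); ring.
Qed.

Fact qone_neq0 : Quat 1 0 0 0 != 0.
Proof.
apply/eqP => /(congr1 (qcoord 0)); rewrite qcoordE /qcoord mxE.
exact/eqP/oner_neq0.
Qed.

End Quaternions.

HB.instance Definition _ (R : realType) :=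
  GRing.Zmodule_isNzRing.Build (quat R) (@qmulA R) (@qmul1l R) (@qmul1r R)
    (@qmulDl R) (@qmulDr R) (@qone_neq0 R).

Section QuaternionNotions.
Variable R : realType.
Implicit Types p q : quat R.

Definition qi : quat R := Quat 0 1 0 0.
Definition qj : quat R := Quat 0 0 1 0.

Definition qconj q : quat R :=
  Quat (qcoord 0 q) (- qcoord 1 q) (- qcoord 2 q) (- qcoord 3 q).

Definition qdot p q : R :=
  qcoord 0 p * qcoord 0 q + qcoord 1 p * qcoord 1 q +
  qcoord 2 p * qcoord 2 q + qcoord 3 p * qcoord 3 q.

Definition qnorm q : R := Num.sqrt (qdot q q).

Definition quat_of_complex (z : R[i]) : quat R := Quat (complex.Re z) (complex.Im z) 0 0.

Definition rscale (v : quat R * quat R) (h : quat R) : quat R * quat R :=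
  (v.1 * h, v.2 * h).

End QuaternionNotions.

Arguments qi {R}.
Arguments qj {R}.

(* The right quaternionic vector space H^2. *)
Notation quat2 R := (quat R * quat R)%type.

Record chart (R : realType) (M : topologicalType) := Chart {
  chart_dom : set M;
  chart_map : M -> R[i]^o;
  chart_inv : R[i]^o -> M;
  chart_dom_open : open chart_dom;
  chart_img_open : open (chart_map @` chart_dom);
  chart_map_cont : forall p, chart_dom p -> {for p, continuous chart_map};
  chart_inv_cont : forall z, (chart_map @` chart_dom) z ->
    {for z, continuous chart_inv};
  chart_mapK : forall p, chart_dom p -> chart_inv (chart_map p) = p }.

(* z |-> e (chart_inv c z) is the transition map; derivability over the field
   R[i] is complex differentiability. *)
Definition holomorphic_transition (R : realType) (M : topologicalType)
    (c e : chart R M) : Prop :=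
  forall z, (chart_map c @` (chart_dom c `&` chart_dom e)) z ->
    derivable (fun w : R[i]^o => chart_map e (chart_inv c w)) z 1.

Record riemann_surface (R : realType) := RiemannSurface {
  surface :> topologicalType;
  atlas : set (chart R surface);
  atlas_cover : forall p : surface, exists2 c, atlas c & chart_dom c p;
  atlas_holomorphic : forall c e, atlas c -> atlas e ->
    holomorphic_transition c e;
  surface_hausdorff : hausdorff_space surface;
  surface_nonempty : [set: surface] !=set0;
  surface_connected : connected [set: surface] }.

Section Calculus.
Variable R : realType.

(* C^k on an open subset of the plane, by iterated partial derivatives. *)
Fixpoint Ck_on (W : normedModType R) (k : nat) (V : set (R * R))
    (F : R * R -> W) : Prop :=
  (forall x, V x -> {for x, continuous F}) /\
  if k is k'.+1 then
    (forall x, V x -> derivable F x (1, 0) /\ derivable F x (0, 1)) /\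
    Ck_on k' V ('D_((1, 0) : R * R) F) /\ Ck_on k' V ('D_((0, 1) : R * R) F)
  else True.

Definition smooth_plane_on (W : normedModType R) (V : set (R * R))
    (F : R * R -> W) : Prop := forall k, Ck_on k V F.

Variable M : riemann_surface R.

Definition coord (c : chart R M) (p : M) : R * R :=
  (complex.Re (chart_map c p), complex.Im (chart_map c p)).

Definition in_chart (T : Type) (c : chart R M) (F : M -> T) : R * R -> T :=
  fun x => F (chart_inv c (x.1 +i* x.2)).

Definition smooth_on (W : normedModType R) (U : set M) (F : M -> W) : Prop :=
  forall c, atlas c ->
    smooth_plane_on (coord c @` (chart_dom c `&` U)) (in_chart c F).

(* A tangent vector at p in chart_dom c is given by its components
   v : R * R in the chart c; dd c F p v is dF_p(v). *)
Definition dd (W : normedModType R) (c : chart R M) (F : M -> W) (p : M)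
    (v : R * R) : W := 'D_v (in_chart c F) (coord c p).

(* The complex structure J on tangent vectors: multiplication by i in the
   chart. *)
Definition Jtan (v : R * R) : R * R := (- v.2, v.1).

Definition star_d (W : normedModType R) (c : chart R M) (F : M -> W) (p : M)
    (v : R * R) : W := dd c F p (Jtan v).

End Calculus.

Section Surfaces.
Variables (R : realType) (M : riemann_surface R).
Implicit Types f N Rn : M -> quat R.

Definition immersion f : Prop :=
  smooth_on setT f /\
  forall c p v, atlas c -> chart_dom c p -> dd c f p v = 0 -> v = 0.

Definition normal_vectors f N Rn : Prop :=
  (forall p, N p * N p = -1 /\ Rn p * Rn p = -1) /\
  forall c p v, atlas c -> chart_dom c p ->
    star_d c f p v = N p * dd c f p v /\
    star_d c f p v = - (dd c f p v * Rn p).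

Definition conformal_immersion f : Prop :=
  immersion f /\ exists N Rn, normal_vectors f N Rn.

Definition normal_space (c : chart R M) f (p : M) : set (quat R) :=
  [set n | forall v, qdot (dd c f p v) n = 0].

(* The orthogonal projection of u to the normal space at p. *)
Definition normal_component (c : chart R M) f (p : M) (u : quat R) : quat R :=
  xget 0 [set n | normal_space c f p n /\ exists v, u - n = dd c f p v].

(* II(v, w), for v and w extended to vector fields with constant components
   in the chart c. *)
Definition second_fundamental_form (c : chart R M) f (p : M)
    (v w : R * R) : quat R :=
  normal_component c f p ('D_v ('D_w (in_chart c f)) (coord c p)).

Definition curvature_ellipse (c : chart R M) f (p : M) : set (quat R) :=
  [set second_fundamental_form c f p v v | v in
    [set v : R * R | qnorm (dd c f p v) = 1]].

Definition superconformal f : Prop :=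
  forall c p, atlas c -> chart_dom c p ->
    exists m r, [/\ normal_space c f p m, 0 <= r &
      curvature_ellipse c f p =
        [set n | normal_space c f p n /\ qnorm (n - m) = r]].

(* The line bundle [f; 1], and its complex structure
   J_L (f, 1) = - (f, 1) R: a vector (f, 1) h of the fibre has second
   component h, and is sent to (f, 1) (- R h). *)
Definition line_bundle f (p : M) : set (quat2 R) :=
  [set rscale (f p, 1) h | h in [set: quat R]].

Definition line_complex_structure f Rn (p : M) (v : quat2 R) : quat2 R :=
  rscale (f p, 1) (- Rn p * v.2).

(* Complex line subbundles of M x H^2 = M x C^4, with C acting on the right:
   locally spanned by a smooth nowhere vanishing section. *)
Definition complex_line_subbundle (E : M -> set (quat2 R)) : Prop :=
  forall p, exists U (psi : M -> quat2 R),
    [/\ open U, U p, smooth_on U psi &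
      forall q, U q -> psi q != 0 /\
        E q = [set rscale (psi q) (quat_of_complex z) | z in [set: R[i]]]].

(* * delta_E = delta_E J_E, evaluated on the (local) smooth sections phi of E.
   Equality in the quotient H/E means that the difference lies in E. *)
Definition holomorphic_curve (E : M -> set (quat2 R)) : Prop :=
  complex_line_subbundle E /\
  forall (U : set M) (phi : M -> quat2 R), open U -> smooth_on U phi ->
    (forall q, U q -> E q (phi q)) ->
    forall c p v, atlas c -> chart_dom c p -> U p ->
      E p (star_d c phi p v - dd c (fun q => rscale (phi q) qi) p v).

(* (L, J) is the twistor projection of E: L = E + E j, where the sum is direct
   because the fibres of E are complex lines. *)
Definition twistor_projection (E L : M -> set (quat2 R))
    (J : M -> quat2 R -> quat2 R) : Prop :=
  forall p,
    [/\ L p = [set e1 + rscale e2 qj | e1 in E p & e2 in E p],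
      (forall v, L p v -> L p (J p v)),
      (forall v w g h, L p v -> L p w ->
        J p (rscale v g + rscale w h) =
          rscale (J p v) g + rscale (J p w) h),
      (forall e, E p e -> J p e = rscale e qi) &
      (forall e, E p e -> J p (rscale e qj) = rscale (rscale e qj) (- qi))].

Definition is_twistor_projection_of_holomorphic_curve f : Prop :=
  exists N Rn, normal_vectors f N Rn /\
  exists E, holomorphic_curve E /\
    twistor_projection E (line_bundle f) (line_complex_structure f Rn).

End Surfaces.

(* Main.v *)
From HB Require Import structures.
Require Import Defs.
From mathcomp Require Import all_boot all_order all_algebra complex ring lra.
From mathcomp Require Import all_classical all_reals all_analysis.
From Stdlib Require Ncring Ncring_tac.

(** Let N and R be the left and right normals of f, so that f_y = N f_x = - f_x R
    in a complex chart x + i y. For a field F with F^2 = -1 put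
    dbar F = F_y - F F_x; it vanishes exactly where F is holomorphic to first
    order as a map to the sphere of square roots of -1. Both sides of the theorem
    are conditions on dbar N and dbar R.

    Superconformality is pointwise. A normal vector n satisfies N n = n R, so left
    multiplication by N is the rotation by a right angle in the normal plane. Let
    m = (II_11 + II_22) / 2, h = (II_11 - II_22) / 2 and k = II_12. Up to scale the
    curvature ellipse is the curve m + cos h + sin k, which is a circle if and only
    if k = N h or k = - N h. Differentiating f_y = N f_x = - f_x R shows that the
    normal vectors dbar N f_x and f_x dbar R are - 2 (h + N k) and 2 (h - N k). So
    f is superconformal if and only if dbar N or dbar R vanishes at each point
    ([circular_ellipse_iff]).

    The twistor condition is global. If (f, 1) is the twistor projection of E, then
    E is forced to consist of the vectors (f, 1) h with R h = - h i, and this line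
    bundle is a holomorphic curve if and only if dbar R vanishes identically
    ([twistor_projection_iff]). Conjugating f exchanges N and R, so the other half
    of the statement concerns dbar N.

    What remains is to pass from one of the two vanishing at each point to one of
    them vanishing everywhere ([hol_dichotomy]). As f is only smooth, this needs an
    argument. The surface being connected, it is enough that the interior of the
    zero set of dbar N is closed, which is a local question. Let U be the open set
    where dbar N does not vanish. On U the normal R is holomorphic, and the
    eigenline bundle of R, spanned by (f h, h), is a holomorphic curve in CP^3. The
    2x2 minors of its first two derivatives are holomorphic on U. If all of them
    vanish at a point, dbar N vanishes there, so they have no common zero in U
    ([active_minors]); but they vanish on the frontier between U and the interior
    of the complement ([frontier_minors]). Extended by zero outside the closure of
    U, they are continuous, and holomorphic wherever they are not zero. As in
    Rado's theorem, the maximum principle holds for such functions, as does the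
    Schwarz lemma, by division by powers of the coordinate; hence they vanish near
    a point as soon as they vanish on some open set sufficiently close to it
    ([unique_continuation_square]). Therefore U cannot accumulate at a limit point
    of the interior of its complement ([dbar_propagates]). *)

Set Implicit Arguments.
Unset Strict Implicit.
Unset Printing Implicit Defensive.

Import Order.TTheory GRing.Theory Num.Theory.
Import numFieldNormedType.Exports.

Local Open Scope classical_set_scope.
Local Open Scope complex_scope.
Local Open Scope ring_scope.

Local Notation coord := Defs.coord.
Local Notation normal_space := Defs.normal_space.

(** * Quaternions as a division algebra over the reals *)

Section QuaternionAlgebra.
Variable R : realType.
Implicit Types (p q : quat R) (a : R).

Lemma qcoordN n q : qcoord n (- q) = - qcoord n q.
Proof. by rewrite /qcoord mxE. Qed.

Lemma qcoord_zero n : qcoord n (0 : quat R) = 0.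
Proof. by rewrite /qcoord mxE. Qed.

Lemma qcoordZ n a q : qcoord n (a *: q) = a * qcoord n q.
Proof. by rewrite /qcoord mxE. Qed.

Lemma qcoord_one : (qcoord 0 (1 : quat R) = 1) * (qcoord 1 (1 : quat R) = 0) *
  (qcoord 2 (1 : quat R) = 0) * (qcoord 3 (1 : quat R) = 0).
Proof. by do !split; rewrite qcoordE. Qed.

Lemma qcoordM p q :
  (qcoord 0 (p * q) = qcoord 0 p * qcoord 0 q - qcoord 1 p * qcoord 1 q
     - qcoord 2 p * qcoord 2 q - qcoord 3 p * qcoord 3 q) *
  (qcoord 1 (p * q) = qcoord 0 p * qcoord 1 q + qcoord 1 p * qcoord 0 q
     + qcoord 2 p * qcoord 3 q - qcoord 3 p * qcoord 2 q) *
  (qcoord 2 (p * q) = qcoord 0 p * qcoord 2 q - qcoord 1 p * qcoord 3 q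
     + qcoord 2 p * qcoord 0 q + qcoord 3 p * qcoord 1 q) *
  (qcoord 3 (p * q) = qcoord 0 p * qcoord 3 q + qcoord 1 p * qcoord 2 q
     - qcoord 2 p * qcoord 1 q + qcoord 3 p * qcoord 0 q).
Proof. by do !split; rewrite qcoordE. Qed.

Definition qsimp := (qcoordD, qcoordN, qcoordZ, qcoord_zero, qcoord_one,
  qcoordM, @qcoordE R).

Fact qscaleAl a p q : a *: (p * q) = (a *: p) * q.
Proof. by apply: quatP; rewrite !qsimp; ring. Qed.

Fact qscaleAr a p q : a *: (p * q) = p * (a *: q).
Proof. by apply: quatP; rewrite !qsimp; ring. Qed.

End QuaternionAlgebra.

HB.instance Definition _ (R : realType) :=
  GRing.Lmodule_isLalgebra.Build R (quat R) (@qscaleAl R).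
HB.instance Definition _ (R : realType) :=
  GRing.Lalgebra_isAlgebra.Build R (quat R) (@qscaleAr R).

Section QuaternionDivision.
Variable R : realType.
Implicit Types (p q : quat R) (a : R).

Lemma qdot_ge0 q : 0 <= qdot q q.
Proof. by rewrite /qdot -!expr2 !addr_ge0 ?sqr_ge0. Qed.

Lemma qdot_eq0 q : (qdot q q == 0) = (q == 0).
Proof.
apply/idP/eqP => [|->]; last by rewrite /qdot !qsimp; apply/eqP; ring.
rewrite /qdot -!expr2 !paddr_eq0 ?addr_ge0 ?sqr_ge0 // !sqrf_eq0.
move=> /andP[/andP[/andP[/eqP h0 /eqP h1] /eqP h2] /eqP h3].
by apply: quatP; rewrite ?h0 ?h1 ?h2 ?h3 qcoord_zero.
Qed.

Definition qinv q : quat R := (qdot q q)^-1 *: qconj q.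

Fact qmulVq : {in predC1 (0 : quat R), left_inverse 1 qinv *%R}.
Proof.
move=> q; rewrite inE => q0; have := q0; rewrite -qdot_eq0 => d0.
by apply: quatP; rewrite /qinv !qsimp; move: d0; rewrite /qdot => d0; field.
Qed.

Fact qmulqV : {in predC1 (0 : quat R), right_inverse 1 qinv *%R}.
Proof.
move=> q; rewrite inE => q0; have := q0; rewrite -qdot_eq0 => d0.
by apply: quatP; rewrite /qinv !qsimp; move: d0; rewrite /qdot => d0; field.
Qed.

Fact qunitP p q : q * p = 1 /\ p * q = 1 -> predC1 (0 : quat R) p.
Proof.
case=> qp1 _; apply/eqP => p0; move: qp1; rewrite p0 mulr0 => /eqP.
by rewrite eq_sym oner_eq0.
Qed.

Fact qinv0id : {in [predC predC1 (0 : quat R)], qinv =1 id}.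
Proof.
move=> q; rewrite !inE negbK => /eqP ->; apply: quatP;
by rewrite /qinv /qdot /qconj !qsimp; ring.
Qed.

End QuaternionDivision.

HB.instance Definition _ (R : realType) :=
  GRing.NzRing_hasMulInverse.Build (quat R) (@qmulVq R) (@qmulqV R)
    (@qunitP R) (@qinv0id R).

(** * Limits and derivatives of quaternion-valued maps *)

Section QuaternionLimits.
Variable R : realType.
Implicit Types (p q : quat R) (a : R).

(** Reduces limits of quaternion-valued maps to limits of real coordinates, without
    reference to the norm. *)
Lemma quat_decomp q : q = qcoord 0 q *: 1 + qcoord 1 q *: qi +
  qcoord 2 q *: qj + qcoord 3 q *: (qi * qj).
Proof. by apply: quatP; rewrite !qsimp; ring. Qed.

Lemma continuous_qcoord n : continuous (qcoord n : quat R -> R).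
Proof. by move=> q; apply: (@coord_continuous R 1 4 0 (inord n)). Qed.

Lemma cvg_quat (T : Type) (F : set_system T) {FF : Filter F}
    (f : T -> quat R) q :
  (forall n, (n < 4)%N -> qcoord n (f x) @[x --> F] --> qcoord n q) ->
  f x @[x --> F] --> q.
Proof.
move=> fq; rewrite [q in _ --> q]quat_decomp.
under eq_fun do rewrite [f _]quat_decomp.
have c n (v : quat R) : (n < 4)%N ->
    qcoord n (f x) *: v @[x --> F] --> qcoord n q *: v.
  by move=> n4; exact (cvgZ (fq n n4) (cvg_cst v)).
exact (cvgD (cvgD (cvgD (c 0%N 1 isT) (c 1%N qi isT)) (c 2%N qj isT))
  (c 3%N (qi * qj) isT)).
Qed.

Lemma cvg_qmul (T : Type) (F : set_system T) {FF : Filter F}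
    (f g : T -> quat R) p q :
  f x @[x --> F] --> p -> g x @[x --> F] --> q ->
  f x * g x @[x --> F] --> p * q.
Proof.
move=> fp gq.
have cf m : qcoord m (f x) @[x --> F] --> qcoord m p.
  exact: (cvg_comp f (qcoord m) fp (@continuous_qcoord m p)).
have cg m : qcoord m (g x) @[x --> F] --> qcoord m q.
  exact: (cvg_comp g (qcoord m) gq (@continuous_qcoord m q)).
have M m n : qcoord m (f x) * qcoord n (g x) @[x --> F] --> qcoord m p * qcoord n q.
  exact (cvgM (cf m) (cg n)).
apply: cvg_quat => -[|[|[|[|//]]]] _; rewrite !qsimp; under eq_fun do rewrite !qsimp.
- exact (cvgB (cvgB (cvgB (M 0 0) (M 1 1)) (M 2 2)) (M 3 3))%N.
- exact (cvgB (cvgD (cvgD (M 0 1) (M 1 0)) (M 2 3)) (M 3 2))%N.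
- exact (cvgD (cvgD (cvgB (M 0 2) (M 1 3)) (M 2 0)) (M 3 1))%N.
- exact (cvgD (cvgB (cvgD (M 0 3) (M 1 2)) (M 2 1)) (M 3 0))%N.
Qed.

Lemma cvg_qdot (T : Type) (F : set_system T) {FF : Filter F}
    (f g : T -> quat R) p q :
  f x @[x --> F] --> p -> g x @[x --> F] --> q ->
  qdot (f x) (g x) @[x --> F] --> qdot p q.
Proof.
move=> fp gq.
have cf m : qcoord m (f x) @[x --> F] --> qcoord m p.
  exact: (cvg_comp f (qcoord m) fp (@continuous_qcoord m p)).
have cg m : qcoord m (g x) @[x --> F] --> qcoord m q.
  exact: (cvg_comp g (qcoord m) gq (@continuous_qcoord m q)).
have M m : qcoord m (f x) * qcoord m (g x) @[x --> F] --> qcoord m p * qcoord m q.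
  exact (cvgM (cf m) (cg m)).
exact (cvgD (cvgD (cvgD (M 0) (M 1)) (M 2)) (M 3))%N.
Qed.

Lemma qunitE q : (q \is a GRing.unit) = (q != 0).
Proof. by []. Qed.

Lemma cvg_qinv (T : Type) (F : set_system T) {FF : Filter F}
    (f : T -> quat R) q :
  q != 0 -> f x @[x --> F] --> q -> (f x)^-1 @[x --> F] --> q^-1.
Proof.
move=> q0 fq.
have cf m : qcoord m (f x) @[x --> F] --> qcoord m q.
  exact: (cvg_comp f (qcoord m) fq (@continuous_qcoord m q)).
have : (qdot (f x) (f x))^-1 *: qconj (f x) @[x --> F] -->
       (qdot q q)^-1 *: qconj q; last exact.
apply: cvgZ; first by apply: cvgV; [rewrite qdot_eq0 | exact: cvg_qdot].
have cN m : - qcoord m (f x) @[x --> F] --> - qcoord m q by exact (cvgN (cf m)).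
apply: cvg_quat => -[|[|[|[|//]]]] _; rewrite !qsimp; under eq_fun do rewrite !qsimp.
- exact (cf 0%N).
- exact (cN 1%N).
- exact (cN 2%N).
- exact (cN 3%N).
Qed.

Lemma continuous_qconj : continuous (@qconj R).
Proof.
move=> q; have c m := @continuous_qcoord m q.
have cN m : - qcoord m p @[p --> q] --> - qcoord m q by exact (cvgN (c m)).
apply: (@cvg_quat _ (nbhs q) (nbhs_filter q)) => -[|[|[|[|//]]]] _;
  rewrite !qsimp; under eq_fun do rewrite !qsimp.
- exact (c 0%N).
- exact (cN 1%N).
- exact (cN 2%N).
- exact (cN 3%N).
Qed.

Lemma qcoord_is_linear n : linear (qcoord n : quat R -> R).
Proof. by move=> a p q; rewrite qcoordD qcoordZ. Qed.

Lemma qconj_is_linear : linear (@qconj R).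
Proof. by move=> a p q; apply: quatP; rewrite !qsimp; ring. Qed.

HB.instance Definition _ n :=
  GRing.isLinear.Build R (quat R) R *:%R (qcoord n) (qcoord_is_linear n).
HB.instance Definition _ :=
  GRing.isLinear.Build R (quat R) (quat R) *:%R (@qconj R) qconj_is_linear.

End QuaternionLimits.

Section DirectionalDerivative.
Variables (R : realType) (V : normedModType R).
Implicit Types (x v : V).

Lemma derivable_along (W : normedModType R) (H : V -> W) x v :
  derivable H x v -> H (h *: v + x) @[h --> (0 : R)^'] --> H x.
Proof.
move=> /cvg_ex[/= l dH].
have h0 : id @ (0 : R)^' --> (0 : R) by exact: nbhs_dnbhs.
have C := cvgD (cvgZ h0 dH) (cvg_cst (H x)) ; rewrite scale0r add0r in C.
eapply cvg_trans; last exact: C.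
apply: near_eq_cvg; near=> h.
have h0' : h != 0 by near: h; exact: nbhs_dnbhs_neq.
by rewrite /= fctE scalerA divff // scale1r subrK.
Unshelve. all: by end_near. Qed.

Lemma is_derive_qmul (F G : V -> quat R) x v dF dG :
  is_derive x v F dF -> is_derive x v G dG ->
  is_derive x v (fun y => F y * G y) (dF * G x + F x * dG).
Proof.
move=> [dvF <-] [dvG <-].
suff D : h^-1 *: (F (h *: v + x) * G (h *: v + x) - F x * G x) @[h --> 0^']
    --> 'D_v F x * G x + F x * 'D_v G x.
  by split; [apply/cvg_ex; eexists; exact: D | exact: cvg_lim D].
have C := cvgD (cvg_qmul dvF (derivable_along dvG))
  (cvg_qmul (cvg_cst (F x)) dvG).
eapply cvg_trans; last exact: C.
apply: near_eq_cvg; near=> h.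
rewrite /= fctE -scalerAl -scalerAr -scalerDr mulrBl mulrBr addrA subrK.
by [].
Unshelve. all: by end_near. Qed.

Lemma is_derive_qinv (F : V -> quat R) x v dF : F x != 0 ->
  is_derive x v F dF ->
  is_derive x v (fun y => (F y)^-1) (- ((F x)^-1 * dF * (F x)^-1)).
Proof.
move=> Fx0 [dvF <-].
suff D : h^-1 *: ((F (h *: v + x))^-1 - (F x)^-1) @[h --> 0^']
    --> - ((F x)^-1 * 'D_v F x * (F x)^-1).
  by split; [apply/cvg_ex; eexists; exact: D | exact: cvg_lim D].
have cF := derivable_along dvF.
have C := cvgN (cvg_qmul (cvg_qmul (cvg_qinv Fx0 cF) dvF) (cvg_cst (F x)^-1)).
eapply cvg_trans; last exact: C.
apply: near_eq_cvg; near=> h.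
have Fh0 : F (h *: v + x) != 0.
  near: h; exact: (cvgr_neq0 _ cF Fx0).
have -> : (F (h *: v + x))^-1 - (F x)^-1 =
    - ((F (h *: v + x))^-1 * (F (h *: v + x) - F x) * (F x)^-1).
  rewrite mulrBr mulVr ?qunitE // mulrBl mul1r -mulrA mulrV ?qunitE // mulr1.
  by rewrite opprB.
by rewrite scalerN scalerAl scalerAr.
Unshelve. all: by end_near. Qed.

End DirectionalDerivative.

(** * Algebraic operations on maps of class C^k *)

Section SmoothCalculus.
Variable R : realType.
Local Notation plane := (R * R)%type.
Implicit Types (V : set plane) (x : plane).

Lemma Ck_sub (W : normedModType R) k V V' (F : plane -> W) :
  V' `<=` V -> Ck_on k V F -> Ck_on k V' F.
Proof.
move=> sV; elim: k F => [|k IH] F [cF dF].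
  by split=> // x /sV; exact: cF.
split; first by move=> x /sV; exact: cF.
case: dF => dF [dF1 dF2]; split; first by move=> x /sV; exact: dF.
by split; [exact: IH dF1 | exact: IH dF2].
Qed.

Lemma Ck_ext (W : normedModType R) k V (F G : plane -> W) :
  open V -> (forall x, V x -> F x = G x) -> Ck_on k V F -> Ck_on k V G.
Proof.
move=> oV; elim: k F G => [|k IH] F G FG [cF dF].
all: have near_FG x : V x -> \near x, F x = G x
  by move=> Vx; near=> y; apply: FG; near: y; exact: open_nbhs_nbhs.
all: split=> //.
- move=> x Vx; change (G y @[y --> x] --> G x); rewrite -(FG x Vx).
  by exact: (cvg_trans (near_eq_cvg (near_FG x Vx)) (cF x Vx)).
- move=> x Vx; change (G y @[y --> x] --> G x); rewrite -(FG x Vx).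
  by exact: (cvg_trans (near_eq_cvg (near_FG x Vx)) (cF x Vx)).
- case: dF => dF [dF1 dF2]; split.
    move=> x Vx; have [d1 d2] := dF x Vx.
    by split; [exact: (near_eq_derivable (near_FG x Vx) d1)
              |exact: (near_eq_derivable (near_FG x Vx) d2)].
  by split; [apply: IH dF1|apply: IH dF2] => x Vx;
     apply: near_eq_derive; exact: near_FG.
Unshelve. all: by end_near. Qed.

Lemma Ck_pred (W : normedModType R) k V (F : plane -> W) :
  Ck_on k.+1 V F -> Ck_on k V F.
Proof.
elim: k F => [|k IH] F [cF [dF [d1 d2]]]; first by split.
split; first exact: cF.
by split; [exact: dF | split; [exact: IH d1 | exact: IH d2]].
Qed.

Lemma is_derive_linear (E W W' : normedModType R) (L : {linear W -> W'})
    (F : E -> W) (x v : E) dF : continuous L ->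
  is_derive x v F dF -> is_derive x v (L \o F) (L dF).
Proof.
move=> cL [dvF <-].
suff D : h^-1 *: ((L \o F) (h *: v + x) - (L \o F) x) @[h --> 0^']
    --> L ('D_v F x).
  by split; [apply/cvg_ex; eexists; exact: D | exact: cvg_lim D].
have := cvg_comp _ L dvF (cL _).
apply: cvg_trans; apply: near_eq_cvg; near=> h.
by rewrite /= linearZ linearB.
Unshelve. all: by end_near. Qed.

Lemma Ck_linear (W W' : normedModType R) (L : {linear W -> W'}) k V
    (F : plane -> W) : open V -> continuous L ->
  Ck_on k V F -> Ck_on k V (L \o F).
Proof.
move=> oV cL; elim: k F => [|k IH] F [cF dF].
all: have cLF x : V x -> {for x, continuous (L \o F)}
  by move=> Vx; apply: continuous_comp; [exact: cF | exact: cL].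
all: split=> //.
case: dF => dF [d1 d2].
have D v x : derivable F x v -> is_derive x v (L \o F) (L ('D_v F x)).
  by move=> /derivableP; exact: is_derive_linear.
split; first by move=> x Vx; have [/D [? _] /D [? _]] := dF x Vx.
split; [apply: (Ck_ext oV _ (IH _ d1)) | apply: (Ck_ext oV _ (IH _ d2))] => x Vx;
  by have [/D [_ E1] /D [_ E2]] := dF x Vx; apply: esym.
Qed.

Lemma Ck_add (W : normedModType R) k V (F G : plane -> W) : open V ->
  Ck_on k V F -> Ck_on k V G -> Ck_on k V (fun x => F x + G x).
Proof.
move=> oV; elim: k F G => [|k IH] F G [cF dF] [cG dG].
all: have cFG x : V x -> {for x, continuous (fun x => F x + G x)}
  by move=> Vx; apply: cvgD; [exact: cF | exact: cG].
all: split=> //.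
case: dF => dF [d1 d2]; case: dG => dG [d3 d4].
split; first by move=> x Vx; have [? ?] := dF x Vx; have [? ?] := dG x Vx;
  split; apply: derivableD.
split; [apply: (Ck_ext oV _ (IH _ _ d1 d3))|apply: (Ck_ext oV _ (IH _ _ d2 d4))];
  by move=> x Vx; have [? ?] := dF x Vx; have [? ?] := dG x Vx;
     apply: esym; apply: deriveD.
Qed.

Lemma Ck_cst (W : normedModType R) k V (a : W) : Ck_on k V (fun=> a).
Proof.
have D v : 'D_v (fun=> a : W) = (fun=> 0) :> (plane -> W).
  by apply: funext => x; exact: derive_cst.
elim: k a D => [|k IH] a D; split=> //; do ?[by move=> *; exact: cvg_cst].
split; first by move=> x Vx; split; exact: derivable_cst.
by rewrite !D; split; apply: IH => v; apply: funext => x; exact: derive_cst.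
Qed.

(** The Leibniz rule only needs the product of C^k maps for the derivative of one
    factor and the other factor itself, hence [Ck_pred]. *)
Lemma Ck_mul k V (F G : plane -> quat R) : open V ->
  Ck_on k V F -> Ck_on k V G -> Ck_on k V (fun x => F x * G x).
Proof.
move=> oV; elim: k F G => [|k IH] F G.
all: move=> kF kG; move: (kF) (kG); move=> [cF dF] [cG dG].
all: have cFG x : V x -> {for x, continuous (fun x => F x * G x)}
  by move=> Vx; apply: cvg_qmul; [exact: cF | exact: cG].
all: split=> //.
case: dF => dF [d1 d2]; case: dG => dG [d3 d4].
have D v x : derivable F x v -> derivable G x v ->
    is_derive x v (fun x => F x * G x) ('D_v F x * G x + F x * 'D_v G x).
  by move=> /derivableP ? /derivableP ?; exact: is_derive_qmul.
have kF' := Ck_pred kF; have kG' := Ck_pred kG.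
split.
  by move=> x Vx; have [/D d /D d'] := dF x Vx; have [/d [? _] /d' [? _]] := dG x Vx.
split.
  have K := Ck_add oV (IH _ _ d1 kG') (IH _ _ kF' d3).
  apply: (Ck_ext oV _ K) => x Vx.
  have [d _] := dF x Vx; have [d' _] := dG x Vx.
  by have [_ E] := D _ _ d d'; exact: esym E.
have K := Ck_add oV (IH _ _ d2 kG') (IH _ _ kF' d4).
apply: (Ck_ext oV _ K) => x Vx.
have [_ d] := dF x Vx; have [_ d'] := dG x Vx.
by have [_ E] := D _ _ d d'; exact: esym E.
Qed.

(** The factor -1 is kept as a product with a constant, so that closure under
    products suffices. *)
Lemma Ck_inv k V (F : plane -> quat R) : open V ->
  (forall x, V x -> F x != 0) ->
  Ck_on k V F -> Ck_on k V (fun x => (F x)^-1).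
Proof.
move=> oV F0; elim: k => [|k IH] kF; move: (kF); move=> [cF dF].
all: have cFV x : V x -> {for x, continuous (fun x => (F x)^-1)}
  by move=> Vx; apply: cvg_qinv; [exact: F0 | exact: cF].
all: split=> //.
case: dF => dF [d1 d2].
have D v x : V x -> derivable F x v -> is_derive x v (fun x => (F x)^-1)
    ((-1) * ((F x)^-1 * 'D_v F x * (F x)^-1)).
  by move=> /F0 Fx0 /derivableP ?; rewrite mulN1r; exact: is_derive_qinv.
have kV := IH (Ck_pred kF).
split; first by move=> x Vx; have [/(D _ _ Vx) [? _] /(D _ _ Vx) [? _]] := dF x Vx.
have kN := @Ck_cst _ k V (-1 : quat R).
split.
  have K := Ck_mul oV kN (Ck_mul oV (Ck_mul oV kV d1) kV).
  apply: (Ck_ext oV _ K) => x Vx.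
  by have [/(D _ _ Vx) [_ E] _] := dF x Vx; exact: esym E.
have K := Ck_mul oV kN (Ck_mul oV (Ck_mul oV kV d2) kV).
apply: (Ck_ext oV _ K) => x Vx.
by have [_ /(D _ _ Vx) [_ E]] := dF x Vx; exact: esym E.
Qed.

End SmoothCalculus.

(** * Mean values, differentiability and mixed differences *)

Section MeanValue.
Variable R : realType.

(** Increments of either sign are treated together, as the two-dimensional
    estimates below move in both directions. *)
Lemma mean_value_signed (phi dphi : R -> R) (s : R) :
  (forall t, `|t| <= `|s| -> is_derive (t : R) (1 : R) phi (dphi t)) ->
  exists2 c, `|c| <= `|s| & phi s - phi 0 = dphi c * s.
Proof.
move=> D.
have ct t : `|t| <= `|s| -> {for t, continuous phi}.
  by move=> /D [dt _]; apply: differentiable_continuous; exact/derivable1_diffP.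
have [s0|s0] := leP 0 s.
  have ts t : t \in `[0, s] -> `|t| <= `|s|.
    by rewrite in_itv /= => /andP[t0 ts]; rewrite !ger0_norm.
  have [||c /ts cs] := @MVT_segment R phi dphi 0 s s0.
  - by move=> t /subset_itv_oo_cc /ts; exact: D.
  - by apply: continuous_in_subspaceT => t /set_mem /ts; exact: ct.
  by rewrite subr0; exists c.
have ts t : t \in `[s, 0] -> `|t| <= `|s|.
  by rewrite in_itv /= => /andP[t0 ts]; rewrite !ler0_norm ?lerN2 // ltW.
have [||c /ts cs] := @MVT_segment R phi dphi s 0 (ltW s0).
- by move=> t /subset_itv_oo_cc /ts; exact: D.
- by apply: continuous_in_subspaceT => t /set_mem /ts; exact: ct.
by rewrite sub0r mulrN => E; exists c => //; rewrite -[RHS]opprK -E opprB.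
Qed.

Lemma is_derive_line (V W : normedModType R) (g : V -> W) (y v : V) (t : R) d :
  is_derive (y + t *: v) v g d -> is_derive t (1 : R) (fun s => g (y + s *: v)) d.
Proof.
have E : (fun h => h^-1 *: (((fun s => g (y + s *: v)) \o shift t) (h *: 1)
     - g (y + t *: v))) = (fun h => h^-1 *: ((g \o shift (y + t *: v)) (h *: v)
     - g (y + t *: v))).
  apply: funext => h /=; congr (_ *: (g _ - _)).
  by rewrite [h *: 1]mulr1 scalerDl addrCA.
by case=> dg <-; split; rewrite /derivable /derive E.
Qed.

Lemma mean_value_line (V : normedModType R) (g : V -> R) (y v : V) (s : R) :
  (forall t, `|t| <= `|s| -> derivable g (y + t *: v) v) ->
  exists2 c, `|c| <= `|s| &
    g (y + s *: v) - g y = 'D_v g (y + c *: v) * s.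
Proof.
move=> D.
have [|c cs] := @mean_value_signed (fun t => g (y + t *: v))
   (fun t => 'D_v g (y + t *: v)) s.
  by move=> t /D /derivableP; exact: is_derive_line.
by rewrite scale0r addr0; exists c.
Qed.

End MeanValue.

Section PartialDerivatives.
Variable R : realType.
Local Notation plane := (R * R)%type.
Implicit Types (V : set plane) (x y : plane).

Lemma normr_plane (h : plane) : `|h| = Num.max `|h.1| `|h.2|.
Proof. by []. Qed.

Lemma continuous_modulus (g : plane -> R) x (e : R) : 0 < e ->
  {for x, continuous g} ->
  exists2 d : R, 0 < d & forall y, `|y - x| < d -> `|g x - g y| <= e.
Proof.
move=> e0 cg; have : \forall y \near x, `|g x - g y| <= e.
  exact: (cvgrPdist_le _ _).1 cg _ e0.
move=> /nbhs_ballP[d d0 Hd]; exists d => // y yx.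
by apply: Hd; rewrite -ball_normE /= distrC.
Qed.

Lemma shift_fst (y : plane) t : y + t *: ((1, 0) : plane) = (y.1 + t, y.2).
Proof.
case: y => a b; rewrite /=.
have E1 : t *: (1 : R) = t by rewrite -[RHS]mulr1.
have E0 : t *: (0 : R) = 0 by rewrite scaler0.
by rewrite [LHS]surjective_pairing /= E1 E0 ?addr0.
Qed.

Lemma shift_snd (y : plane) t : y + t *: ((0, 1) : plane) = (y.1, y.2 + t).
Proof.
case: y => a b; rewrite /=.
have E1 : t *: (1 : R) = t by rewrite -[RHS]mulr1.
have E0 : t *: (0 : R) = 0 by rewrite scaler0.
by rewrite [LHS]surjective_pairing /= E1 E0 ?addr0.
Qed.

(** The segment from x to x + h is replaced by a vertical and a horizontal
    segment, and the mean value theorem is applied to each. *)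
Lemma plane_increment (g : plane -> R) x (d : R) :
  (forall y, `|y - x| < d -> derivable g y (1, 0) /\ derivable g y (0, 1)) ->
  forall h, `|h| < d -> exists y1 y2, [/\ `|y1 - x| <= `|h|, `|y2 - x| <= `|h| &
    g (h + x) - g x = 'D_(1, 0) g y1 * h.1 + 'D_(0, 1) g y2 * h.2].
Proof.
move=> D h hd.
have near_x1 t : `|t| <= `|h.1| -> `|(x.1 + t, x.2 + h.2) - x| <= `|h|.
  move=> th; rewrite !normr_plane /= ![_ + _ - _]addrAC !subrr !add0r.
  by rewrite ge_max !le_max th lexx orbT.
have near_x2 t : `|t| <= `|h.2| -> `|(x.1, x.2 + t) - x| <= `|h|.
  move=> th; rewrite !normr_plane /= [_ + _ - _]addrAC !subrr !add0r normr0.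
  by rewrite ge_max !le_max th normr_ge0 orbT.
have [t th|c1 ch1 E1] := @mean_value_line R _ g (x.1, x.2 + h.2) (1, 0) h.1.
  have [|d1 _] := D ((x.1, x.2 + h.2) + t *: (1, 0)); last exact: d1.
  by rewrite shift_fst; exact: le_lt_trans (near_x1 t th) hd.
have [t th|c2 ch2 E2] := @mean_value_line R _ g x (0, 1) h.2.
  have [|_ d2] := D (x + t *: (0, 1)); last exact: d2.
  by rewrite shift_snd; exact: le_lt_trans (near_x2 t th) hd.
exists (x.1 + c1, x.2 + h.2), (x.1, x.2 + c2).
split; [exact: near_x1 | exact: near_x2 |].
move: E1 E2; rewrite !shift_fst !shift_snd => <- <-.
have -> : h + x = (x.1 + h.1, x.2 + h.2).
  by rewrite [LHS]surjective_pairing /= addrC [x.2 + _]addrC.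
by rewrite /= addrA subrK.
Qed.

Lemma differentiable_increment (g gx gy : plane -> R) x (d : R) : 0 < d ->
  {for x, continuous gx} -> {for x, continuous gy} ->
  (forall h, `|h| < d -> exists y1 y2,
    [/\ `|y1 - x| <= `|h|, `|y2 - x| <= `|h| &
    g (h + x) - g x = gx y1 * h.1 + gy y2 * h.2]) ->
  differentiable g x.
Proof.
move=> d0 cx cy D; set a := gx x; set b := gy x.
pose L (h : plane) : R := h.1 * a + h.2 * b.
have linL : linear L.
  by move=> k u v; rewrite /L /= !mulrDl scalerDr -!scalerAl addrACA.
pose L' : {linear plane -> R} := HB.pack L (GRing.isLinear.Build _ _ _ _ _ linL).
have cL : continuous L'.
  move=> h; apply: cvgD; apply: cvgM; try exact: cvg_cst.
    exact: cvg_fst.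
  exact: cvg_snd.
have E : g \o shift x = cst (g x) + L' +o_ (0 : plane) id.
  apply/eqaddoP => e e0.
  have e20 : 0 < e / 2 by rewrite divr_gt0.
  have [dx dx0 nx] := continuous_modulus e20 cx.
  have [dy dy0 ny] := continuous_modulus e20 cy.
  pose m := Num.min d (Num.min dx dy).
  have m0 : 0 < m by rewrite !lt_min d0 dx0 dy0.
  have nd : \forall h \near (0 : plane), `|h| < m by exact: nbhs0_lt.
  apply: filterS nd => h; rewrite !lt_min => /and3P[hd hx hy].
  have [y1 [y2 [h1 h2 Eh]]] := D h hd.
  have A1 : `|a - gx y1| <= e / 2.
    by apply: nx; exact: le_lt_trans h1 hx.
  have A2 : `|b - gy y2| <= e / 2.
    by apply: ny; exact: le_lt_trans h2 hy.
  have -> : (g \o shift x - (cst (g x) + L')) h =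
     - ((a - gx y1) * h.1) - (b - gy y2) * h.2.
    have -> : (g \o shift x - (cst (g x) + L')) h = g (h + x) - g x - L h.
      by rewrite !fctE /= opprD addrA.
    by rewrite Eh /L; ring.
  rewrite -opprD normrN; apply: le_trans (ler_normD _ _) _; rewrite !normrM.
  rewrite [in leRHS](splitr e) mulrDl; apply: lerD; apply: ler_pM => //.
    by rewrite normr_plane le_max lexx.
  by rewrite normr_plane le_max lexx orbT.
apply/diff_locallyP; have U := @diff_unique R _ _ g L' x cL E.
by rewrite U.
Qed.

(** The increment is a combination of the two partial derivatives at intermediate
    points, which tend to x. *)
Lemma differentiable_partials (g : plane -> R) x (d : R) : 0 < d ->
  (forall y, `|y - x| < d -> derivable g y (1, 0) /\ derivable g y (0, 1)) ->
  {for x, continuous ('D_(1, 0) g)} -> {for x, continuous ('D_(0, 1) g)} ->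
  differentiable g x.
Proof.
move=> d0 D cx cy; apply: (differentiable_increment d0 cx cy).
exact: plane_increment D.
Qed.

(** The mean value theorem twice: along u for the difference in the direction of v,
    then along v for D_u g. *)
Lemma mixed_difference (V : normedModType R) (g : V -> R) (x u v : V) (s : R) :
  (forall a b, `|a| <= `|s| -> `|b| <= `|s| ->
    derivable g (x + a *: u + b *: v) u /\
    derivable ('D_u g) (x + a *: u + b *: v) v) ->
  exists a b, [/\ `|a| <= `|s|, `|b| <= `|s| &
    g (x + s *: u + s *: v) - g (x + s *: u) - (g (x + s *: v) - g x) =
    'D_v ('D_u g) (x + a *: u + b *: v) * s * s].
Proof.
move=> D; pose psi (y : V) := g (y + s *: v) - g y.
have dpsi a : `|a| <= `|s| -> is_derive (x + a *: u) u psi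
    ('D_u g (x + a *: u + s *: v) - 'D_u g (x + a *: u)).
  move=> ha; apply: is_deriveB; last first.
    have h0 : `|0 : R| <= `|s| by rewrite normr0.
    by have [d _] := D a 0 ha h0; rewrite scale0r addr0 in d; exact: derivableP.
  have [/derivableP [d dE] _] := D a s ha (lexx _).
  have E : (fun h : R => h^-1 *: (((fun y : V => g (y + s *: v)) \o shift (x + a *: u)) (h *: u)
      - g (x + a *: u + s *: v))) =
    (fun h : R => h^-1 *: ((g \o shift (x + a *: u + s *: v)) (h *: u)
      - g (x + a *: u + s *: v))).
    by apply: funext => h /=; congr (_ *: (g _ - _)); rewrite [RHS]addrA.
  by split; rewrite /derivable /derive E.
have [a ha E1] := @mean_value_line R _ psi x u s (fun t ht => @ex_derive _ _ _ _ _ _ _ (dpsi t ht)).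
have [b hb E2] := @mean_value_line R _ ('D_u g) (x + a *: u) v s
  (fun t ht => (D a t ha ht).2).
exists a, b; split=> //.
by rewrite -[LHS]/(psi (x + s *: u) - psi x) E1 (derive_val (is_derive := dpsi a ha)) E2.
Qed.

End PartialDerivatives.

(** * Partial derivatives of smooth maps of the plane *)

Lemma dist_via_common_value (R : realType) (e p q p' q' : R) :
  `|p - p'| <= e / 2 -> `|q - q'| <= e / 2 -> p' = q' -> `|q - p| <= e.
Proof.
move=> pp qq pq; rewrite distrC (splitr e).
by apply: le_trans (ler_distD p' _ _) _; rewrite lerD // pq distrC.
Qed.

Lemma equal_mixed_differences (R : realType) (s p q a1 a2 a3 a4 : R) :
  0 < s -> a1 - a2 - (a3 - a4) = p * s * s ->
  a1 - a3 - (a2 - a4) = q * s * s -> p = q.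
Proof.
move=> s0 ep eq; have sn0 : s != 0 by rewrite gt_eqF.
by apply: (mulIf sn0); apply: (mulIf sn0); rewrite -ep -eq; ring.
Qed.

(** Locked, so that unification treats second derivatives as atoms. *)
HB.lock Definition dx (R : realType) (F : R * R -> quat R) : R * R -> quat R :=
  'D_((1, 0) : R * R) F.
HB.lock Definition dy (R : realType) (F : R * R -> quat R) : R * R -> quat R :=
  'D_((0, 1) : R * R) F.

Section SmoothMaps.
Variable R : realType.
Local Notation plane := (R * R)%type.
Implicit Types (V : set plane) (x : plane) (F G : plane -> quat R).

Lemma dxE F : dx F = 'D_((1, 0) : plane) F. Proof. by rewrite dx.unlock. Qed.
Lemma dyE F : dy F = 'D_((0, 1) : plane) F. Proof. by rewrite dy.unlock. Qed.

Definition smoothq V F := smooth_plane_on V F.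

Lemma smoothq_sub V V' F : V' `<=` V -> smoothq V F -> smoothq V' F.
Proof. by move=> sV sF k; exact: Ck_sub sV (sF k). Qed.

Lemma smoothq_continuous V F x : smoothq V F -> V x -> {for x, continuous F}.
Proof. by move=> sF Vx; have [cF _] := sF 0%N; exact: cF. Qed.

Lemma smoothq_dx V F : smoothq V F -> smoothq V (dx F).
Proof. by rewrite dxE => sF k; have [_ [_ [d _]]] := sF k.+1. Qed.

Lemma smoothq_dy V F : smoothq V F -> smoothq V (dy F).
Proof. by rewrite dyE => sF k; have [_ [_ [_ d]]] := sF k.+1. Qed.

Lemma is_derive_dx V F x : smoothq V F -> V x -> is_derive x (1, 0) F (dx F x).
Proof.
rewrite dxE => sF Vx; have [_ [dF _]] := sF 1%N.
by have [d _] := dF x Vx; exact: derivableP.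
Qed.

Lemma is_derive_dy V F x : smoothq V F -> V x -> is_derive x (0, 1) F (dy F x).
Proof.
rewrite dyE => sF Vx; have [_ [dF _]] := sF 1%N.
by have [_ d] := dF x Vx; exact: derivableP.
Qed.

Lemma smoothq_cst V (a : quat R) : smoothq V (fun=> a).
Proof. by move=> k; exact: Ck_cst. Qed.

Lemma dx_cst (a : quat R) x : dx (fun=> a) x = 0.
Proof. rewrite dxE; exact: derive_cst. Qed.

Lemma dy_cst (a : quat R) x : dy (fun=> a) x = 0.
Proof. rewrite dyE; exact: derive_cst. Qed.

Section OpenDomain.
Variables (V : set plane).
Hypothesis oV : open V.

Lemma smoothq_ext F G : (forall x, V x -> F x = G x) ->
  smoothq V F -> smoothq V G.
Proof. by move=> FG sF k; exact: (Ck_ext oV FG (sF k)). Qed.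

Lemma smoothqD F G : smoothq V F -> smoothq V G ->
  smoothq V (fun x => F x + G x).
Proof. by move=> sF sG k; exact: (Ck_add oV (sF k) (sG k)). Qed.

Lemma smoothqM F G : smoothq V F -> smoothq V G ->
  smoothq V (fun x => F x * G x).
Proof. by move=> sF sG k; exact: (Ck_mul oV (sF k) (sG k)). Qed.

Lemma smoothqN F : smoothq V F -> smoothq V (fun x => - F x).
Proof.
move=> sF; apply: smoothq_ext (smoothqM (smoothq_cst V (-1)) sF) => x _.
by rewrite mulN1r.
Qed.

Lemma smoothqB F G : smoothq V F -> smoothq V G ->
  smoothq V (fun x => F x - G x).
Proof. by move=> sF sG; exact: smoothqD sF (smoothqN sG). Qed.

Lemma smoothqV F : (forall x, V x -> F x != 0) -> smoothq V F ->
  smoothq V (fun x => (F x)^-1).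
Proof. by move=> F0 sF k; exact: (Ck_inv oV F0 (sF k)). Qed.

Lemma near_open (P : plane -> Prop) x : (forall y, V y -> P y) -> V x ->
  \near x, P x.
Proof.
by move=> H Vx; apply: filterS H _; exact: open_nbhs_nbhs.
Qed.

Lemma dx_ext F G x : (forall y, V y -> F y = G y) -> V x -> dx F x = dx G x.
Proof. by rewrite !dxE => FG Vx; apply: near_eq_derive; exact: near_open Vx. Qed.

Lemma dy_ext F G x : (forall y, V y -> F y = G y) -> V x -> dy F x = dy G x.
Proof. by rewrite !dyE => FG Vx; apply: near_eq_derive; exact: near_open Vx. Qed.

Section Rules.
Variables (F G : plane -> quat R) (x : plane).
Hypotheses (sF : smoothq V F) (sG : smoothq V G) (Vx : V x).

Lemma dxD : dx (fun y => F y + G y) x = dx F x + dx G x.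
Proof.
by rewrite !dxE; apply: deriveD; [case: (is_derive_dx sF Vx) | case: (is_derive_dx sG Vx)].
Qed.

Lemma dyD : dy (fun y => F y + G y) x = dy F x + dy G x.
Proof.
by rewrite !dyE; apply: deriveD; [case: (is_derive_dy sF Vx) | case: (is_derive_dy sG Vx)].
Qed.

Lemma dxM : dx (fun y => F y * G y) x = dx F x * G x + F x * dx G x.
Proof.
have [_ E] := is_derive_qmul (is_derive_dx sF Vx) (is_derive_dx sG Vx).
by rewrite -E dxE.
Qed.

Lemma dyM : dy (fun y => F y * G y) x = dy F x * G x + F x * dy G x.
Proof.
have [_ E] := is_derive_qmul (is_derive_dy sF Vx) (is_derive_dy sG Vx).
by rewrite -E dyE.
Qed.

Lemma dxN : dx (fun y => - F y) x = - dx F x.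
Proof. by rewrite !dxE; apply: deriveN; case: (is_derive_dx sF Vx). Qed.

Lemma dyN : dy (fun y => - F y) x = - dy F x.
Proof. by rewrite !dyE; apply: deriveN; case: (is_derive_dy sF Vx). Qed.

Lemma dxB : dx (fun y => F y - G y) x = dx F x - dx G x.
Proof.
by rewrite !dxE; apply: deriveB; [case: (is_derive_dx sF Vx) | case: (is_derive_dx sG Vx)].
Qed.

Lemma dyB : dy (fun y => F y - G y) x = dy F x - dy G x.
Proof.
by rewrite !dyE; apply: deriveB; [case: (is_derive_dy sF Vx) | case: (is_derive_dy sG Vx)].
Qed.

Lemma smoothq_coord n k : Ck_on k V (qcoord n \o F).
Proof. exact: (Ck_linear oV (@continuous_qcoord R n) (sF k)). Qed.

Lemma derive_coord n (v : plane) : derivable F x v ->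
  'D_v (qcoord n \o F) x = qcoord n ('D_v F x).
Proof.
move=> /derivableP d.
by have [_ E] := @is_derive_linear R _ _ _ (qcoord n : {linear quat R -> R}) F x v _
  (@continuous_qcoord R n) d.
Qed.

Lemma open_ball_sub : exists2 d : R, 0 < d & forall y, `|y - x| < d -> V y.
Proof.
have /nbhs_ballP[d d0 Hd] : nbhs x V by exact: open_nbhs_nbhs.
by exists d => // y yx; apply: Hd; rewrite -ball_normE /= distrC.
Qed.

Lemma smoothq_differentiable : differentiable F x.
Proof.
have D n : differentiable (qcoord n \o F) x.
  have [c [d [[c1 _] [c2 _]]]] := smoothq_coord n 1.
  have [r r0 Hr] := open_ball_sub.
  apply: (differentiable_partials r0); last 2 first.
  - exact: c1.
  - exact: c2.
  - by move=> y /Hr; exact: d.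
have -> : F = (fun y => (qcoord 0 \o F) y *: (1 : quat R)) +
    (fun y => (qcoord 1 \o F) y *: qi) + (fun y => (qcoord 2 \o F) y *: qj) +
    (fun y => (qcoord 3 \o F) y *: (qi * qj)).
  by apply: funext => y; rewrite [LHS]quat_decomp.
by do !apply: differentiableD; apply: differentiableZl; exact: D.
Qed.

Lemma derive_partials (v : plane) :
  is_derive x v F (v.1 *: dx F x + v.2 *: dy F x).
Proof.
have D := smoothq_differentiable.
split; first exact: diff_derivable.
rewrite dxE dyE !deriveE //.
have {1}-> : v = v.1 *: ((1, 0) : plane) + v.2 *: ((0, 1) : plane).
  by rewrite shift_snd [LHS]surjective_pairing /= ![_ *: _]mulrC mul1r mul0r add0r.
by rewrite linearD !linearZ.
Qed.

End Rules.

(** Schwarz: the two iterated differences over a square coincide, and each is a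
    mean value of one of the mixed derivatives; let the square shrink. *)
Lemma dxdyC F x : smoothq V F -> V x -> dx (dy F) x = dy (dx F) x.
Proof.
move=> sF Vx.
have sFx := smoothq_dx sF; have sFy := smoothq_dy sF.
suff C n : qcoord n (dx (dy F) x) = qcoord n (dy (dx F) x).
  by apply: quatP; exact: C.
pose g := qcoord n \o F.
have ex y : V y -> 'D_(1, 0) g y = (qcoord n \o dx F) y.
  by move=> Vy; rewrite /= dxE; apply: derive_coord; case: (is_derive_dx sF Vy).
have ey y : V y -> 'D_(0, 1) g y = (qcoord n \o dy F) y.
  by move=> Vy; rewrite /= dyE; apply: derive_coord; case: (is_derive_dy sF Vy).
have exy y : V y -> 'D_(0, 1) ('D_(1, 0) g) y = qcoord n (dy (dx F) y).
  move=> Vy; rewrite dyE -derive_coord; last by case: (is_derive_dy sFx Vy).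
  exact: (near_eq_derive _ (near_open ex Vy)).
have eyx y : V y -> 'D_(1, 0) ('D_(0, 1) g) y = qcoord n (dx (dy F) y).
  move=> Vy; rewrite dxE -derive_coord; last by case: (is_derive_dx sFy Vy).
  exact: (near_eq_derive _ (near_open ey Vy)).
have [_ [d1 [[_ [d2 _]] [_ [d3 _]]]]] := smoothq_coord sF n 2.
have cxy : {for x, continuous (qcoord n \o dy (dx F))}.
  have [c _] := smoothq_coord (smoothq_dy sFx) n 0; exact: c.
have cyx : {for x, continuous (qcoord n \o dx (dy F))}.
  have [c _] := smoothq_coord (smoothq_dx sFy) n 0; exact: c.
have [r r0 Hr] := open_ball_sub Vx.
apply/eqP; rewrite -subr_eq0 -normr_le0; apply/ler_addgt0Pl => e e0.
rewrite addr0; have e20 : 0 < e / 2 by rewrite divr_gt0.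
have [rx rx0 nx] := continuous_modulus e20 cxy.
have [ry ry0 ny] := continuous_modulus e20 cyx.
pose m := Num.min r (Num.min rx ry).
have m0 : 0 < m by rewrite !lt_min r0 rx0 ry0.
pose s := m / 2.
have s0 : 0 < s by rewrite divr_gt0.
have sm : s < m by rewrite /s ltr_pdivrMr // ltr_pMr // ltr1n.
have nearx a b : `|a| <= `|s| -> `|b| <= `|s| ->
    `|x + a *: (1, 0) + b *: (0, 1) - x| < m.
  rewrite (gtr0_norm s0) => ha hb; rewrite shift_fst shift_snd normr_plane /=.
  rewrite ![_ + _ - _]addrAC !subrr !add0r gt_max.
  by rewrite (le_lt_trans ha) ?(le_lt_trans hb).
have swap a b : x + b *: ((0, 1) : plane) + a *: ((1, 0) : plane) =
    x + a *: (1, 0) + b *: (0, 1) by rewrite addrAC.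
have [a b ha hb|a [b [ha hb E1]]] := @mixed_difference R _ g x (1, 0) (0, 1) s.
  have := nearx _ _ ha hb; rewrite !lt_min => /andP[/Hr Vy _].
  by have [h1 _] := d1 _ Vy; have [_ h2] := d2 _ Vy; exact: (conj h1 h2).
have [c d hc hd|c [d [hc hd E2]]] := @mixed_difference R _ g x (0, 1) (1, 0) s.
  have := nearx _ _ hd hc; rewrite -swap !lt_min => /andP[/Hr Vy _].
  by have [_ h1] := d1 _ Vy; have [h2 _] := d3 _ Vy; exact: (conj h1 h2).
have := nearx _ _ ha hb; set y1 := (x + _ + _).
rewrite !lt_min => /and3P[/Hr V1 hx _].
have := nearx _ _ hd hc; rewrite -swap; set y2 := (x + _ + _).
rewrite !lt_min => /and3P[/Hr V2 _ hy].
have E : qcoord n (dy (dx F) y1) = qcoord n (dx (dy F) y2).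
  rewrite /y1 in V1 *; rewrite /y2 swap in V2 *; rewrite !swap in E2.
  rewrite (exy _ V1) in E1; rewrite (eyx _ V2) in E2.
  exact: equal_mixed_differences s0 E1 E2.
have A1 : `|qcoord n (dy (dx F) x) - qcoord n (dy (dx F) y1)| <= e / 2 := nx y1 hx.
have A2 : `|qcoord n (dx (dy F) x) - qcoord n (dx (dy F) y2)| <= e / 2 := ny y2 hy.
exact: dist_via_common_value A1 A2 E.
Qed.

End OpenDomain.
End SmoothMaps.

(** * Complex numbers and square roots of -1 in the quaternions *)

#[global] Instance quat_ncring_ops (R : realType) :
  @Ncring.Ring_ops (quat R) 0 1 +%R *%R (fun x y => x - y) -%R eq := {}.
#[global] Instance quat_ncring (R : realType) :
  @Ncring.Ring _ _ _ _ _ _ _ _ (quat_ncring_ops R).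
Proof.
split; try typeclasses eauto;
  cbv [Algebra_syntax.equality Ncring.eq_notation Algebra_syntax.addition
       Ncring.add_notation Algebra_syntax.multiplication Ncring.mul_notation
       Algebra_syntax.opposite Ncring.opp_notation Algebra_syntax.subtraction
       Ncring.sub_notation Algebra_syntax.zero Ncring.zero_notation
       Algebra_syntax.one Ncring.one_notation].
- exact: add0r.
- exact: addrC.
- exact: addrA.
- exact: mul1r.
- exact: mulr1.
- exact: mulrA.
- exact: mulrDl.
- by move=> x y z; exact: mulrDr.
- by [].
- exact: subrr.
Qed.

Ltac ncring := Ncring_tac.non_commutative_ring.

Section ComplexParts.
Variable R : realType.
Implicit Types (p q z w h N : quat R) (a : R).

Lemma addrr_inj q p : q + q = p + p -> q = p.
Proof.
move=> E; have two : (2 : R) != 0 by rewrite pnatr_eq0.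
apply: (scalerI two); rewrite ![2%:R *: _]scaler_nat.
by rewrite !mulr2n.
Qed.

Lemma qmul_eq0 p q : p * q = 0 -> p = 0 \/ q = 0.
Proof.
move=> pq; have [->|p0] := eqVneq p 0; [by left | right].
by rewrite -[q]mul1r -(mulVr (x := p)) ?qunitE // -mulrA pq mulr0.
Qed.

Lemma qmulI p q q' : p != 0 -> p * q = p * q' -> q = q'.
Proof. by move=> p0; apply: mulrI; rewrite qunitE. Qed.

Lemma qmul_neq0 p q : p != 0 -> q != 0 -> p * q != 0.
Proof.
by move=> p0 q0; apply/eqP => /qmul_eq0[] /eqP; [exact/negP | exact/negP].
Qed.

Lemma qi_sq : qi * qi = -1 :> quat R.
Proof. by apply: quatP; rewrite !qsimp; ring. Qed.

Lemma qj_sq : qj * qj = -1 :> quat R.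
Proof. by apply: quatP; rewrite !qsimp; ring. Qed.

Lemma qj_qi : qj * qi = - (qi * qj) :> quat R.
Proof. by apply: quatP; rewrite !qsimp; ring. Qed.

(** The complex numbers inside the quaternions: the centraliser of i. *)
Definition is_cx z : Prop := z * qi = qi * z.

(** Conjugation by i fixes C and negates j C, so this averages away the second
    summand of H = C + j C. *)
Definition cpart q : quat R := 2^-1 *: (q - qi * q * qi).

Lemma cpartE q : cpart q = Quat (qcoord 0 q) (qcoord 1 q) 0 0.
Proof. by apply: quatP; rewrite !qsimp; field. Qed.

Lemma cpart_double q : cpart q + cpart q = q - qi * q * qi.
Proof.
by rewrite -mulr2n -scaler_nat scalerA mulfV ?scale1r.
Qed.

Lemma cpartD p q : cpart (p + q) = cpart p + cpart q.
Proof. by apply: addrr_inj; rewrite addrACA !cpart_double; ncring. Qed.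

Lemma cpartN p : cpart (- p) = - cpart p.
Proof. by apply: addrr_inj; rewrite -opprD !cpart_double; ncring. Qed.

Lemma cpartB p q : cpart (p - q) = cpart p - cpart q.
Proof. by rewrite cpartD cpartN. Qed.

Lemma cpart0 : cpart 0 = 0.
Proof. by apply: quatP; rewrite cpartE !qsimp. Qed.

Lemma cpart_cx q : is_cx (cpart q).
Proof. by apply: quatP; rewrite cpartE !qsimp; ring. Qed.

Lemma cx_cpart z : is_cx z -> cpart z = z.
Proof.
move=> cz; apply: addrr_inj; rewrite cpart_double -cz -mulrA qi_sq; ncring.
Qed.

Lemma cpart_mulr q z : is_cx z -> cpart (q * z) = cpart q * z.
Proof.
move=> cz; apply: addrr_inj; rewrite -mulrDl !cpart_double mulrBl.
by rewrite -!mulrA cz.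
Qed.

Lemma cxC z w : is_cx z -> is_cx w -> z * w = w * z.
Proof.
move=> /cx_cpart <- /cx_cpart <-; rewrite !cpartE.
by apply: quatP; rewrite !qsimp; ring.
Qed.

Lemma cxM z w : is_cx z -> is_cx w -> is_cx (z * w).
Proof. by move=> cz cw; rewrite /is_cx -mulrA cw mulrA cz mulrA. Qed.

Lemma cxV z : is_cx z -> is_cx z^-1.
Proof.
move=> cz; have [->|z0] := eqVneq z 0; first by rewrite invr0 /is_cx mulr0 mul0r.
apply: (qmulI z0); rewrite !mulrA mulrV ?qunitE // mul1r cz -mulrA.
by rewrite mulrV ?qunitE // mulr1.
Qed.

Lemma cx_qi : is_cx qi. Proof. by []. Qed.

Lemma cx_quat_of_complex (c : R[i]) : is_cx (quat_of_complex c).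
Proof. by apply: quatP; rewrite !qsimp; ring. Qed.

Lemma is_cxE z : is_cx z -> z = quat_of_complex (qcoord 0 z +i* qcoord 1 z).
Proof. by move=> /cx_cpart {1}<-; rewrite cpartE. Qed.

Lemma cpart_decomp q : q = cpart q + qj * cpart (- qj * q).
Proof. by rewrite !cpartE; apply: quatP; rewrite !qsimp; ring. Qed.

(** Two intertwiners of R with - i differ by right multiplication with something
    that commutes with i. *)
Lemma eigenline Rn h w : h != 0 -> Rn * h = - (h * qi) -> Rn * w = - (w * qi) ->
  is_cx (h^-1 * w).
Proof.
move=> h0 Rh Rw; apply: (qmulI h0).
rewrite !mulrA mulrV ?qunitE // mul1r -[LHS]opprK -Rw.
rewrite -[h * qi]opprK -Rh !mulNr; congr (- _).
by rewrite -!mulrA mulVKr ?qunitE.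
Qed.

Lemma eigenline_cpart Rn h w : cpart h = 1 -> Rn * h = - (h * qi) ->
  Rn * w = - (w * qi) -> w = h * cpart w.
Proof.
move=> h1 Rh Rw.
have h0 : h != 0.
  by apply/eqP => h0; move/eqP: h1; rewrite h0 cpart0 eq_sym oner_eq0.
have cz := eigenline h0 Rh Rw.
have E : w = h * (h^-1 * w) by rewrite mulVKr ?qunitE.
by rewrite {2}E cpart_mulr // h1 mul1r.
Qed.

Lemma sqN1_neq0 N : N * N = -1 -> N != 0.
Proof.
move=> NN; apply/eqP => N0; move/eqP: NN.
by rewrite N0 mulr0 eq_sym oppr_eq0 oner_eq0.
Qed.

Lemma qdotMl p q q' : qdot (p * q) (p * q') = qdot p p * qdot q q'.
Proof. by rewrite /qdot !qsimp; ring. Qed.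

Lemma qdotMr p q q' : qdot (q * p) (q' * p) = qdot p p * qdot q q'.
Proof. by rewrite /qdot !qsimp; ring. Qed.

Lemma qdotC p q : qdot p q = qdot q p.
Proof. by rewrite /qdot; ring. Qed.

Lemma qdotDl p p' q : qdot (p + p') q = qdot p q + qdot p' q.
Proof. by rewrite /qdot !qsimp; ring. Qed.

Lemma qdotDr p q q' : qdot p (q + q') = qdot p q + qdot p q'.
Proof. by rewrite /qdot !qsimp; ring. Qed.

Lemma qdotZl a p q : qdot (a *: p) q = a * qdot p q.
Proof. by rewrite /qdot !qsimp; ring. Qed.

Lemma qdotZr a p q : qdot p (a *: q) = a * qdot p q.
Proof. by rewrite /qdot !qsimp; ring. Qed.

Lemma qdotNl p q : qdot (- p) q = - qdot p q.
Proof. by rewrite /qdot !qsimp; ring. Qed.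

Lemma qdotNr p q : qdot p (- q) = - qdot p q.
Proof. by rewrite /qdot !qsimp; ring. Qed.

(** With real part a, the imaginary part of the square is 2 a times that of N; so
    a nonzero a would give a real square root of -1. *)
Lemma sqN1_imaginary N : N * N = -1 -> qcoord 0 N = 0.
Proof.
move=> NN.
have E n := congr1 (qcoord n) NN.
have := E 3%N; have := E 2%N; have := E 1%N; have := E 0%N; rewrite !qsimp.
set a := qcoord 0 N; set b := qcoord 1 N; set c := qcoord 2 N; set d := qcoord 3 N.
move=> e0 e1 e2 e3; have [//|a0] := eqVneq a 0.
have two0 x : a * x + x * a = 0 -> x = 0.
  rewrite [x * a]mulrC -mulr2n => /eqP; rewrite mulrn_eq0 /= mulf_eq0 (negbTE a0).
  by move/eqP.
have b0 : b = 0 by apply: two0; lra.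
have c0 : c = 0 by apply: two0; lra.
have d0 : d = 0 by apply: two0; lra.
have : a * a = -1 by move: e0; rewrite b0 c0 d0; lra.
by move=> aa; have := sqr_ge0 a; rewrite expr2 aa; lra.
Qed.

Lemma sqN1_conj N : N * N = -1 -> qconj N = - N.
Proof.
by move=> /sqN1_imaginary N0; apply: quatP; rewrite !qsimp // N0 oppr0.
Qed.

Lemma sqN1_unit N : N * N = -1 -> qdot N N = 1.
Proof.
move=> NN; have N0 := sqN1_imaginary NN.
by have := congr1 (qcoord 0) NN; rewrite /qdot !qsimp N0; lra.
Qed.

(** Commuting with R makes the cross product of the imaginary parts vanish, so
    the imaginary part is a multiple of R. *)
Lemma centraliser_span Rn q : Rn * Rn = -1 -> q * Rn = Rn * q ->
  exists a b, q = a *: 1 + b *: Rn.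
Proof.
move=> RR qR; have R0 := sqN1_imaginary RR; have R1 := sqN1_unit RR.
exists (qcoord 0 q), (qdot q Rn).
have E n := congr1 (qcoord n) qR.
have := E 3%N; have := E 2%N; have := E 1%N; move: R1.
rewrite /qdot !qsimp R0.
set a := qcoord 0 q; set b := qcoord 1 q; set c := qcoord 2 q; set d := qcoord 3 q.
set r := qcoord 1 Rn; set s := qcoord 2 Rn; set t := qcoord 3 Rn.
move=> R1 e1 e2 e3.
have f1 : c * t = d * s by lra.
have f2 : d * r = b * t by lra.
have f3 : b * s = c * r by lra.
have n1 : r * r + s * s + t * t = 1 by lra.
apply: quatP; rewrite !qsimp -/a -/b -/c -/d ?R0 -/r -/s -/t.
- by ring.
- transitivity (b * (r * r + s * s + t * t)); first by rewrite n1; ring.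
  transitivity (b * r * r + (b * s) * s + (b * t) * t); first by ring.
  by rewrite f3 -f2; ring.
- transitivity (c * (r * r + s * s + t * t)); first by rewrite n1; ring.
  transitivity ((c * r) * r + c * s * s + (c * t) * t); first by ring.
  by rewrite -f3 f1; ring.
- transitivity (d * (r * r + s * s + t * t)); first by rewrite n1; ring.
  transitivity ((d * r) * r + (d * s) * s + d * t * t); first by ring.
  by rewrite f2 -f1; ring.
Qed.

End ComplexParts.

(** * The second derivative test *)

Section SecondDerivativeTest.
Variable R : realType.

Lemma second_derivative_test (phi phi1 : R -> R) (d2 r : R) : 0 < r ->
  (forall t, `|t| < r -> is_derive (t : R) (1 : R) phi (phi1 t)) ->
  is_derive (0 : R) (1 : R) phi1 d2 ->
  (forall t, `|t| < r -> phi t <= phi 0) -> d2 <= 0.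
Proof.
move=> r0 D [D1 D2] M; rewrite leNgt; apply/negP => d20.
have tr t : t \in `]- r, r[ -> `|t| < r by rewrite in_itv /= ltr_norml.
have phi10 : phi1 0 = 0.
  have mrr : - r <= r by lra.
  have c0 : (0 : R) \in `]- r, r[ by rewrite in_itv /= oppr_lt0 r0.
  have der t : t \in `]- r, r[ -> derivable phi t 1 by move=> /tr /D [].
  have mx t : t \in `]- r, r[ -> phi t <= phi 0 by move=> /tr; exact: M.
  have [_ E] := derive1_at_max mrr der c0 mx.
  have zr : `|0 : R| < r by rewrite normr0.
  by have [_ <-] := D 0 zr.
have C : h^-1 *: (phi1 (h *: 1 + 0) - phi1 0) @[h --> (0 : R)^'] --> d2.
  by rewrite -D2; exact: D1.
have /nbhs_ballP[e /= e0 He] : \forall h \near (0 : R)^',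
    0 < h^-1 *: (phi1 (h *: 1 + 0) - phi1 0) by exact: (cvgr_gt _ C).
pose s := Num.min r e / 2.
have m0 : 0 < Num.min r e by rewrite lt_min r0 e0.
have s0 : 0 < s by rewrite divr_gt0.
have : s < Num.min r e by rewrite /s ltr_pdivrMr // ltr_pMr // ltr1n.
rewrite lt_min => /andP[sr se].
have cs t : `|t| <= `|s| -> is_derive (t : R) (1 : R) phi (phi1 t).
  by rewrite (gtr0_norm s0) => ts; apply: D; exact: le_lt_trans ts sr.
have [||c] := @MVT R phi phi1 0 s s0.
- move=> t; rewrite in_itv /= => /andP[t0 ts]; apply: cs.
  by rewrite !gtr0_norm // ltW.
- apply: continuous_in_subspaceT => t /set_mem /=; rewrite in_itv /= => /andP[t0 ts].
  have [|dt _] := cs t; first by rewrite ger0_norm // gtr0_norm.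
  by apply: differentiable_continuous; exact/derivable1_diffP.
rewrite in_itv /= => /andP[c0 lcs]; rewrite subr0 => E.
have : 0 < c^-1 *: (phi1 (c *: 1 + 0) - phi1 0).
  have bc : ball (0 : R) e c.
    by rewrite -ball_normE /= sub0r normrN gtr0_norm //; exact: lt_trans lcs se.
  by apply: (He c bc); rewrite gt_eqF.
rewrite phi10 subr0 addr0 [c *: 1]mulr1 => pc.
have pc0 : 0 < phi1 c.
  by move: pc; rewrite [_ *: _]mulrC pmulr_lgt0 // invr_gt0.
have : 0 < phi s - phi 0 by rewrite E mulr_gt0.
by rewrite subr_gt0 ltNge M // gtr0_norm.
Qed.

Lemma second_derivative_test_line (V : normedModType R) (G G1 : V -> R)
    (c v : V) (d2 r : R) : 0 < r ->
  (forall t : R, `|t| < r -> is_derive (c + t *: v) v G (G1 (c + t *: v))) ->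
  is_derive c v G1 d2 ->
  (forall t : R, `|t| < r -> G (c + t *: v) <= G c) -> d2 <= 0.
Proof.
move=> r0 D D2 M.
apply: (@second_derivative_test (fun t => G (c + t *: v))
  (fun t => G1 (c + t *: v)) d2 r r0).
- by move=> t /D; exact: is_derive_line.
- by apply: is_derive_line; rewrite scale0r addr0.
- by move=> t /M; rewrite scale0r addr0.
Qed.

Lemma is_derive_qdot (V : normedModType R) (F G : V -> quat R) x v dF dG :
  is_derive x v F dF -> is_derive x v G dG ->
  is_derive x v (fun y => qdot (F y) (G y)) (qdot dF (G x) + qdot (F x) dG).
Proof.
move=> iF iG.
have cF n : is_derive x v (fun y => qcoord n (F y)) (qcoord n dF).
  exact: (@is_derive_linear R V _ _ (qcoord n : {linear quat R -> R}) F _ _ _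
    (@continuous_qcoord R n) iF).
have cG n : is_derive x v (fun y => qcoord n (G y)) (qcoord n dG).
  exact: (@is_derive_linear R V _ _ (qcoord n : {linear quat R -> R}) G _ _ _
    (@continuous_qcoord R n) iG).
rewrite /qdot; apply: is_derive_eq.
rewrite ![_ *: _]mulrC; ring.
Qed.

End SecondDerivativeTest.

(** * The maximum principle *)

Section MaximumPrinciple.
Variable R : realType.
Local Notation plane := (R * R)%type.
Implicit Types (V : set plane) (x y c : plane) (F G : plane -> quat R).

Definition i_holomorphic_on V F :=
  smoothq V F /\ forall x, V x -> dy F x = dx F x * qi.

(** The class of functions in Rado's theorem: holomorphy is for the complex
    structure given by right multiplication by i. It contains the extensions by
    zero below, which need not be differentiable at their zeros, and it is all
    that the maximum principle requires. *)
Definition i_holomorphic_off_zeros V F :=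
  (forall x, V x -> {for x, continuous F}) /\
  forall x, V x -> F x != 0 ->
    exists O, [/\ open O, O x & i_holomorphic_on O F].

(** The squared Euclidean distance; it is smooth, unlike the sup norm of the
    product plane. *)
Definition sqdist y x : R := (x.1 - y.1) * (x.1 - y.1) + (x.2 - y.2) * (x.2 - y.2).

Lemma is_derive_fst x v : is_derive x v (fun y : plane => y.1) v.1.
Proof.
apply: (@is_derive_linear R _ _ _ (fst : {linear plane -> R}) id x v v).
by move=> z; exact: cvg_fst.
Qed.

Lemma is_derive_snd x v : is_derive x v (fun y : plane => y.2) v.2.
Proof.
apply: (@is_derive_linear R _ _ _ (snd : {linear plane -> R}) id x v v).
by move=> z; exact: cvg_snd.
Qed.

Lemma is_derive_sqdist y x v : is_derive x v (sqdist y)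
  ((x.1 - y.1) * v.1 *+ 2 + (x.2 - y.2) * v.2 *+ 2).
Proof.
have d1 := is_derive_fst x v; have d2 := is_derive_snd x v.
rewrite /sqdist; apply: is_derive_eq.
by rewrite /= ![_ *: _]mulrC; ring.
Qed.

Lemma i_holomorphic_laplacian V F x : open V -> i_holomorphic_on V F -> V x ->
  dy (dy F) x = - dx (dx F) x.
Proof.
move=> oV [sF hF] Vx; have sFx := smoothq_dx sF.
rewrite (dy_ext oV hF Vx) (dyM sFx (smoothq_cst V qi) Vx) dy_cst mulr0 addr0.
rewrite -(dxdyC oV sF Vx) (dx_ext oV hF Vx) (dxM sFx (smoothq_cst V qi) Vx).
by rewrite dx_cst mulr0 addr0 -mulrA qi_sq mulrN1.
Qed.

(** The Laplacian of |F|^2 is 2 (|F_x|^2 + |F_y|^2) because F is harmonic, and the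
    quadratic term makes the total positive, against the second derivative test. *)
Lemma no_interior_maximum O F y c (e : R) : open O -> i_holomorphic_on O F ->
  O c -> 0 < e ->
  ~ (\forall x \near c, qdot (F x) (F x) + e * sqdist y x <=
       qdot (F c) (F c) + e * sqdist y c).
Proof.
move=> oO hF Oc e0 M; have [sF _] := hF.
have /nbhs_ballP[r r0 Hr] : \forall x \near c, O x /\
    (qdot (F x) (F x) + e * sqdist y x <= qdot (F c) (F c) + e * sqdist y c).
  by near=> x; split; near: x; [exact: open_nbhs_nbhs | exact: M].
pose g x := qdot (F x) (F x) + e * sqdist y x.
have D v (dF : plane -> quat R) x : is_derive x v F (dF x) ->
    is_derive x v g (qdot (dF x) (F x) + qdot (F x) (dF x) +
      e * ((x.1 - y.1) * v.1 *+ 2 + (x.2 - y.2) * v.2 *+ 2)).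
  move=> d; have d1 := is_derive_qdot d d; have d2 := is_derive_sqdist y x v.
  exact: is_deriveD d1 (is_deriveZ e d2).
have inr v (t : R) : `|v| <= 1 -> `|t| < r -> ball c r (c + t *: v).
  move=> v1 tr; rewrite -ball_normE /= opprD addrA subrr add0r normrN normrZ.
  by apply: le_lt_trans tr; rewrite ler_piMr.
have D2 v (dF : plane -> quat R) d2F : is_derive c v F (dF c) -> is_derive c v dF d2F ->
    is_derive c v (fun x => qdot (dF x) (F x) + qdot (F x) (dF x) +
      e * ((x.1 - y.1) * v.1 *+ 2 + (x.2 - y.2) * v.2 *+ 2))
    ((qdot d2F (F c) + qdot (dF c) (dF c)) *+ 2 +
      e * (v.1 * v.1 + v.2 * v.2) *+ 2).
  move=> d d2; have d1 := is_derive_qdot d2 d; have d3 := is_derive_qdot d d2.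
  have d4 := is_derive_fst c v; have d5 := is_derive_snd c v.
  apply: is_derive_eq.
  by rewrite /= ![_ *: _]mulrC (qdotC (F c)); ring.
have le0 v (dF : plane -> quat R) d2F : `|v| <= 1 ->
    (forall x, O x -> is_derive x v F (dF x)) -> is_derive c v dF d2F ->
    (qdot d2F (F c) + qdot (dF c) (dF c)) *+ 2 +
      e * (v.1 * v.1 + v.2 * v.2) *+ 2 <= 0.
  move=> v1 d d2.
  apply: (@second_derivative_test_line R _ g _ c v _ r r0 _ (D2 v dF d2F (d c Oc) d2)).
    by move=> t tr; apply: D; apply: d; have [] := Hr _ (inr v t v1 tr).
  by move=> t tr; have [] := Hr _ (inr v t v1 tr).
have n1 : `|(1, 0) : plane| <= 1 by rewrite normr_plane normr1 normr0 ge_max lexx ler01.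
have n2 : `|(0, 1) : plane| <= 1 by rewrite normr_plane normr1 normr0 ge_max lexx ler01.
have sFx := smoothq_dx sF; have sFy := smoothq_dy sF.
have A1 := le0 (1, 0) (dx F) (dx (dx F) c) n1 (fun x Ox => is_derive_dx sF Ox)
  (is_derive_dx sFx Oc).
have A2 := le0 (0, 1) (dy F) (dy (dy F) c) n2 (fun x Ox => is_derive_dy sF Ox)
  (is_derive_dy sFy Oc).
move: A1 A2; rewrite (i_holomorphic_laplacian oO hF Oc) qdotNl /=.
have := qdot_ge0 (dx F c); have := qdot_ge0 (dy F c).
rewrite !mulr0 !mulr1 addr0 add0r.
move: (qdot _ _) (qdot _ _) (qdot _ _) => p q s q0 s0.
by clear -e0 q0 s0; lra.
Unshelve. all: by end_near. Qed.

Lemma compact_square y (r : R) : compact [set x : plane | `|x - y| <= r].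
Proof.
have -> : [set x : plane | `|x - y| <= r] =
    `[y.1 - r, y.1 + r]%classic `*` `[y.2 - r, y.2 + r]%classic.
  apply/seteqP; split=> x /=; rewrite normr_plane ge_max !in_itv /= !ler_distl.
    by move=> /andP[].
  by move=> [-> ->].
by apply: compact_setX; exact: segment_compact.
Qed.

Lemma sqdist_lt y x (r : R) : `|x - y| < r -> sqdist y x < r * r *+ 2.
Proof.
move=> xr; have r0 : 0 < r by exact: le_lt_trans xr.
move: xr; rewrite normr_plane gt_max => /andP[h1 h2].
have sq (t : R) : `|t| < r -> t * t < r * r.
  by move=> tr; rewrite -!expr2 -(real_normK (num_real t)) ltr_pXn2r ?nnegrE // ltW.
by rewrite /sqdist mulr2n; apply: ltrD; exact: sq.
Qed.

Lemma sqdist_le y x (r : R) : `|x - y| <= r -> sqdist y x <= r * r *+ 2.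
Proof.
move=> xr; have r0 : 0 <= r by exact: le_trans xr.
move: xr; rewrite normr_plane ge_max => /andP[h1 h2].
have sq (t : R) : `|t| <= r -> t * t <= r * r.
  by move=> tr; rewrite -!expr2 -(real_normK (num_real t)) ler_pXn2r ?nnegrE.
by rewrite /sqdist mulr2n; apply: lerD; exact: sq.
Qed.

Lemma sqdist_ge y x (r : R) : 0 <= r -> `|x - y| = r -> r * r <= sqdist y x.
Proof.
move=> r0 xr; have sq (t : R) : `|t| = r -> t * t = r * r.
  by move=> <-; rewrite -!expr2 real_normK ?num_real.
move: xr; rewrite normr_plane /sqdist /Num.max; case: ifP => _ /sq /= ->.
  by rewrite lerDr -expr2 sqr_ge0.
by rewrite lerDl -expr2 sqr_ge0.
Qed.

Lemma sqdist_ge0 y x : 0 <= sqdist y x.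
Proof. by rewrite /sqdist -!expr2 addr_ge0 ?sqr_ge0. Qed.

(** A maximum of |F|^2 + e |x - y|^2 over the square is at a zero of F, at a point
    near which F is holomorphic, or on the boundary. The corners exclude the
    first, positivity of the Laplacian the second. *)
Lemma maximum_principle V F y (r B : R) : 0 < r ->
  i_holomorphic_off_zeros V F -> (forall x, `|x - y| <= r -> V x) ->
  (forall x, `|x - y| = r -> qdot (F x) (F x) <= B) ->
  forall x, `|x - y| <= r -> qdot (F x) (F x) <= B.
Proof.
move=> r0 [cF hF] QV bd x1 x1Q; rewrite leNgt; apply/negP => lt_B.
(* e is small enough for the quadratic term, at most 2 r^2 e, not to make up for the
   excess of |F x1|^2 over B. *)
pose e := (qdot (F x1) (F x1) - B) / (r * r * 4).
have rr0 : 0 < r * r by rewrite mulr_gt0.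
have e0 : 0 < e by rewrite divr_gt0 ?subr_gt0 // mulr_gt0.
have eE : e * (r * r *+ 2) < qdot (F x1) (F x1) - B.
  have : 0 < qdot (F x1) (F x1) - B by rewrite subr_gt0.
  set w := _ - B; have -> : e * (r * r *+ 2) = w / 2.
    by rewrite /e -/w; field; rewrite gt_eqF.
  by move=> w0; rewrite ltr_pdivrMr // ltr_pMr // ltr1n.
pose g x := qdot (F x) (F x) + e * sqdist y x.
have cg : {within [set x : plane | `|x - y| <= r], continuous g}.
  apply: continuous_in_subspaceT => x /set_mem /QV Vx.
  apply: cvgD; first by apply: cvg_qdot; exact: cF.
  have c1 : z.1 - y.1 @[z --> x] --> x.1 - y.1 by exact (cvgB cvg_fst (cvg_cst y.1)).
  have c2 : z.2 - y.2 @[z --> x] --> x.2 - y.2 by exact (cvgB cvg_snd (cvg_cst y.2)).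
  exact (cvgM (cvg_cst e) (cvgD (cvgM c1 c1) (cvgM c2 c2))).
have Q0 : [set x : plane | `|x - y| <= r] !=set0 by exists x1.
have [c /set_mem cQ cmax] := compact_EVT_max Q0 (@compact_square y r) cg.
have {}cmax x : `|x - y| <= r -> g x <= g c by move=> xQ; apply: cmax; exact/mem_set.
have g1 : B + e * (r * r *+ 2) < g c.
  apply: lt_le_trans (cmax _ x1Q).
  have := sqdist_ge0 y x1; rewrite /g => s0.
  have : 0 <= e * sqdist y x1 by rewrite mulr_ge0 // ltW.
  by move: eE; lra.
have [cr|cr] := eqVneq `|c - y| r.
  move: g1; rewrite ltNge => /negP; apply.
  by rewrite lerD ?bd // ler_pM2l // sqdist_le.
have {}cr : `|c - y| < r by rewrite lt_neqAle cr.
have [Fc|Fc] := eqVneq (F c) 0.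
  (* At a zero of F the quadratic term alone would be maximal, but it is larger at a
     corner of the square. *)
  pose k : plane := (y.1 + r, y.2 + r).
  have kQ : `|k - y| <= r.
    by rewrite normr_plane /= ![_ + r - _]addrAC !subrr !add0r ge_max gtr0_norm // lexx.
  have := cmax _ kQ; rewrite leNgt => /negP; apply.
  rewrite /g Fc [qdot 0 0](_ : _ = 0) ?add0r; last by rewrite /qdot !qsimp; ring.
  apply: (@lt_le_trans _ _ (e * sqdist y k)); last by rewrite lerDr qdot_ge0.
  rewrite ltr_pM2l //; have -> : sqdist y k = r * r *+ 2 by rewrite /sqdist /k /=; ring.
  exact: sqdist_lt.
have [D [oD Dc hD]] := hF c (QV _ cQ) Fc.
apply: (no_interior_maximum oD hD Dc e0 (y := y)).
have bc : nbhs c (ball y r).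
  by apply: open_nbhs_nbhs; split; [exact: ball_open | rewrite -ball_normE /= distrC].
by apply: filterS bc => x; rewrite -ball_normE /= distrC => /ltW /cmax.
Qed.

End MaximumPrinciple.

(** * Unique continuation *)

Section UniqueContinuation.
Variable R : realType.
Local Notation plane := (R * R)%type.
Implicit Types (V : set plane) (x y c : plane) (F G : plane -> quat R).

(** The complex coordinate centred at y, valued in C inside H. *)
Definition zcoord y x : quat R := (x.1 - y.1) *: 1 + (x.2 - y.2) *: qi.

Lemma zcoord_cx y x : is_cx (zcoord y x).
Proof. by apply: quatP; rewrite !qsimp; ring. Qed.

Lemma qdot_zcoord y x : qdot (zcoord y x) (zcoord y x) = sqdist y x.
Proof. by rewrite /qdot /sqdist !qsimp; ring. Qed.

Lemma sqdist_eq0 y x : sqdist y x = 0 -> x = y.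
Proof.
rewrite /sqdist -!expr2 => /eqP; rewrite paddr_eq0 ?sqr_ge0 // !sqrf_eq0 !subr_eq0.
by case: x y => [a b] [c d] /= /andP[/eqP -> /eqP ->].
Qed.

Lemma zcoord_neq0 y x : x != y -> zcoord y x != 0.
Proof.
by move=> xy; rewrite -qdot_eq0 qdot_zcoord; apply: contraNneq xy => /sqdist_eq0 ->.
Qed.

Lemma is_derive_zcoord y x v :
  is_derive x v (zcoord y) (v.1 *: 1 + v.2 *: qi).
Proof.
pose L (u : plane) : quat R := u.1 *: 1 + u.2 *: qi.
have linL : linear L.
  by move=> a p q; apply: quatP; rewrite !qsimp /=; rewrite ![_ *: _]mulrC; ring.
pose L' : {linear plane -> quat R} :=
  HB.pack L (GRing.isLinear.Build _ _ _ _ _ linL).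
have cL : continuous L'.
  move=> u; apply: cvgD; apply: cvgZ; do ?[exact: cvg_cst].
    exact: cvg_fst.
  exact: cvg_snd.
have D := @is_derive_linear R _ _ _ L' id x v v cL (is_derive_id x v).
have DD := is_deriveB D (is_derive_cst (L y) x v).
have -> : zcoord y = (L' \o id) - cst (L y).
  apply: funext => u; apply: quatP; rewrite /zcoord !fctE /= /L !qsimp; ring.
by rewrite subr0 in DD.
Qed.

Lemma dx_zcoord y : dx (zcoord y) = fun=> 1.
Proof.
apply: funext => x; have [_ E] := is_derive_zcoord y x (1, 0).
by rewrite dxE E /= scale1r scale0r addr0.
Qed.

Lemma dy_zcoord y : dy (zcoord y) = fun=> qi.
Proof.
apply: funext => x; have [_ E] := is_derive_zcoord y x (0, 1).
by rewrite dyE E /= scale1r scale0r add0r.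
Qed.

Lemma zcoord_continuous y : continuous (zcoord y).
Proof.
move=> x; apply: cvgD; apply: cvgZ; do ?[exact: cvg_cst].
  by apply: cvgB; [exact: cvg_fst | exact: cvg_cst].
by apply: cvgB; [exact: cvg_snd | exact: cvg_cst].
Qed.

Lemma smoothq_zcoord V y : smoothq V (zcoord y).
Proof.
have c x : V x -> {for x, continuous (zcoord y)} by move=> _; exact: zcoord_continuous.
case=> [|k]; split => //; split.
  by move=> x _; have [d1 _] := is_derive_zcoord y x (1, 0);
     have [d2 _] := is_derive_zcoord y x (0, 1).
by split; [rewrite -dxE dx_zcoord | rewrite -dyE dy_zcoord]; exact: Ck_cst.
Qed.

Lemma open_neq y : open [set x : plane | x != y].
Proof.
have -> : [set x : plane | x != y] = ~` [set y].
  by apply/seteqP; split=> x /= /eqP.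
apply: closed_openC; apply: accessible_closed_set1; apply: hausdorff_accessible.
exact: norm_hausdorff.
Qed.

Lemma dx_inv V F x : smoothq V F -> V x -> F x != 0 ->
  dx (fun y => (F y)^-1) x = - ((F x)^-1 * dx F x * (F x)^-1).
Proof.
by move=> sF Vx Fx; have [_ <-] := is_derive_qinv Fx (is_derive_dx sF Vx); rewrite dxE.
Qed.

Lemma dy_inv V F x : smoothq V F -> V x -> F x != 0 ->
  dy (fun y => (F y)^-1) x = - ((F x)^-1 * dy F x * (F x)^-1).
Proof.
by move=> sF Vx Fx; have [_ <-] := is_derive_qinv Fx (is_derive_dy sF Vx); rewrite dyE.
Qed.

(** Dividing by the coordinate preserves the class, because F vanishes near
    the pole. *)
Lemma i_holomorphic_divide V F y : i_holomorphic_off_zeros V F ->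
  (\forall x \near y, F x = 0) ->
  i_holomorphic_off_zeros V (fun x => F x * (zcoord y x)^-1).
Proof.
move=> [cF hF] F0; split=> [x Vx|x Vx FZ].
  have [->|xy] := eqVneq x y.
    have E : \forall z \near y,
        (fun=> 0 : quat R) z = F z * (zcoord y z)^-1.
      by apply: filterS F0 => z ->; rewrite mul0r.
    have E0 := nbhs_singleton E.
    change (F z * (zcoord y z)^-1 @[z --> y] --> F y * (zcoord y y)^-1).
    rewrite -E0; exact: (cvg_trans (near_eq_cvg E) (cvg_cst 0)).
  apply: cvg_qmul; first exact: cF.
  by apply: cvg_qinv; [exact: zcoord_neq0 | exact: zcoord_continuous].
have Fx : F x != 0 by apply: contraNneq FZ => ->; rewrite mul0r.
have xy : x != y.
  by apply: contraNneq Fx => ->; rewrite (nbhs_singleton F0).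
have [D [oD Dx [sF eF]]] := hF x Vx Fx.
pose D' := D `&` [set x : plane | x != y].
have oD' : open D' by apply: openI => //; exact: open_neq.
have sF' : smoothq D' F by apply: smoothq_sub sF => z [].
have sZ := @smoothq_zcoord D' y.
have Z0 z : D' z -> zcoord y z != 0 by move=> [_ zy]; exact: zcoord_neq0.
have sZV := smoothqV oD' Z0 sZ.
exists D'; split; [exact: oD' | exact: conj Dx xy | split; first exact (smoothqM oD' sF' sZV)].
move=> z D'z; have Dz : D z by case: D'z.
rewrite (dxM sF' sZV D'z) (dyM sF' sZV D'z) (dx_inv sZ D'z (Z0 z D'z)).
rewrite (dy_inv sZ D'z (Z0 z D'z)) dx_zcoord dy_zcoord (eF z Dz).
have cz : is_cx (zcoord y z)^-1 by apply: cxV; exact: zcoord_cx.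
move: (dx F z) (F z) (zcoord y z)^-1 cz => p q w cz; apply: subr0_eq.
transitivity ((p - q * w) * (qi * w - w * qi)); first by ncring.
by rewrite cz subrr mulr0.
Qed.

(** The Schwarz lemma for a zero of order n: F / z^n is still in the class, and the
    maximum principle bounds it by its values at distance r from y. *)
Lemma vanishing_order_bound V y (r : R) n : 0 < r ->
  (forall x, `|x - y| <= r -> V x) ->
  forall F B, i_holomorphic_off_zeros V F -> (\forall x \near y, F x = 0) ->
  (forall x, `|x - y| = r -> qdot (F x) (F x) <= B) ->
  forall x, `|x - y| <= r ->
    qdot (F x) (F x) * (r * r) ^+ n <= B * sqdist y x ^+ n.
Proof.
move=> r0 QV; have rr0 : 0 < r * r by rewrite mulr_gt0.
elim: n => [|n IH] F B hF F0 FB x xQ.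
  by rewrite !expr0 !mulr1; exact: (maximum_principle r0 hF QV FB).
have qdotV (p q : quat R) : p != 0 -> qdot (q * p^-1) (q * p^-1) = qdot q q / qdot p p.
  move=> p0; rewrite qdotMr mulrC; congr (_ * _).
  have d0 : qdot p p != 0 by rewrite qdot_eq0.
  apply: (mulfI d0); rewrite divff // -qdotMl mulrV ?qunitE //.
  by rewrite /qdot !qsimp; ring.
have [->|xy] := eqVneq x y.
  rewrite (nbhs_singleton F0) [qdot 0 0](_ : _ = 0); last by rewrite /qdot !qsimp; ring.
  have -> : sqdist y y = 0 by rewrite /sqdist !subrr; ring.
  by rewrite mul0r exprS mul0r mulr0.
have dpos : 0 < sqdist y x.
  rewrite lt_neqAle sqdist_ge0 andbT eq_sym.
  by apply: contraNneq xy => /sqdist_eq0 ->.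
have G0 : \forall z \near y, F z * (zcoord y z)^-1 = 0.
  by apply: filterS F0 => z ->; rewrite mul0r.
have GB z : `|z - y| = r ->
    qdot (F z * (zcoord y z)^-1) (F z * (zcoord y z)^-1) <= B / (r * r).
  move=> zr; have zy : z != y.
    by apply: contra_eqN zr => /eqP ->; rewrite subrr normr0 lt_eqF.
  rewrite qdotV ?zcoord_neq0 // qdot_zcoord.
  have := sqdist_ge (ltW r0) zr => le_d.
  apply: ler_pM (FB z zr) _; rewrite ?qdot_ge0 ?invr_ge0 ?sqdist_ge0 //.
  by rewrite lef_pV2 ?posrE // (lt_le_trans rr0).
have := IH _ _ (i_holomorphic_divide hF F0) G0 GB x xQ.
rewrite qdotV ?zcoord_neq0 // qdot_zcoord => H.
have := ler_wpM2r (ltW (mulr_gt0 dpos rr0)) H.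
have -> : qdot (F x) (F x) / sqdist y x * (r * r) ^+ n * (sqdist y x * (r * r)) =
   qdot (F x) (F x) * (r * r) ^+ n.+1.
  by rewrite exprS; field; rewrite gt_eqF.
suff -> : B / (r * r) * sqdist y x ^+ n * (sqdist y x * (r * r)) =
   B * sqdist y x ^+ n.+1 by [].
by rewrite exprS; field; rewrite gt_eqF.
Qed.

(** In the Schwarz bound |F|^2 <= B (|z|^2 / r^2)^n the order n is arbitrary. *)
Lemma unique_continuation_square V F y (r : R) : 0 < r ->
  (forall x, `|x - y| <= r -> V x) ->
  i_holomorphic_off_zeros V F -> (\forall x \near y, F x = 0) ->
  forall x, `|x - y| <= r -> sqdist y x < r * r -> F x = 0.
Proof.
move=> r0 QV hF F0 x xQ dx_lt; have rr0 : 0 < r * r by rewrite mulr_gt0.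
have Q0 : [set x : plane | `|x - y| <= r] !=set0 by exists x.
have cg : {within [set x : plane | `|x - y| <= r],
    continuous (fun x => qdot (F x) (F x))}.
  apply: continuous_in_subspaceT => z /set_mem /QV Vz.
  by have [cF _] := hF; apply: cvg_qdot; exact: cF.
have [c _ cmax] := compact_EVT_max Q0 (@compact_square R y r) cg.
pose B := qdot (F c) (F c).
have FB z : `|z - y| = r -> qdot (F z) (F z) <= B.
  by move=> zr; apply: cmax; apply/mem_set; rewrite /= zr.
pose q := sqdist y x / (r * r).
have q0 : 0 <= q by rewrite divr_ge0 ?sqdist_ge0 // ltW.
have q1 : `|q| < 1 by rewrite ger0_norm // ltr_pdivrMr // mul1r.
have bound n : qdot (F x) (F x) <= B * q ^+ n.
  have H := vanishing_order_bound n r0 QV hF F0 FB xQ.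
  by rewrite /q expr_div_n mulrA ler_pdivlMr // exprn_gt0.
have lim0 : B * q ^+ n @[n --> \oo] --> (0 : R).
  by rewrite -(mulr0 B); apply: cvgM; [exact: cvg_cst | exact: cvg_expr].
have le0 : qdot (F x) (F x) <= 0.
  by apply: (cvgr_to_ge lim0); near=> n; exact: bound.
by apply/eqP; rewrite -qdot_eq0 eq_le le0 qdot_ge0.
Unshelve. all: by end_near. Qed.

End UniqueContinuation.

(** * Second-order identities at a point *)

Section PointwiseAlgebra.
Variable R : realType.
Implicit Types (p q : quat R).

(** The form in which identities modulo hypotheses are proved below: p - q is
    written as a combination d of hypotheses of the form e = 0, by normalisation
    in a noncommutative ring. *)
Lemma eq_from_diff d p q : p - q = d -> d = 0 -> p = q.
Proof. by move=> E d0; apply: subr0_eq; rewrite E. Qed.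

Definition zeros := (mulr0, mul0r, addr0, add0r, oppr0, subr0).

Lemma move_left p q : p = q -> p - q = 0.
Proof. by move->; rewrite subrr. Qed.

Lemma move_left_opp p q : p = - q -> p + q = 0.
Proof. by move->; rewrite addNr. Qed.

Variables (f1 f11 f12 f22 N N1 N2 Rn R1 R2 : quat R).
Hypotheses (NN : N * N = -1) (RR : Rn * Rn = -1).
Hypothesis NR : N * f1 = - (f1 * Rn).
Hypotheses (dN1 : N1 * N + N * N1 = 0) (dR1 : R1 * Rn + Rn * R1 = 0).
Hypotheses (f12N : f12 = N1 * f1 + N * f11) (f12R : f12 = - (f11 * Rn + f1 * R1)).
Hypotheses (f22N : f22 = N2 * f1 + N * f12) (f22R : f22 = - (f12 * Rn + f1 * R2)).

(** The left-hand side is dbar N f_x: differentiating f_y = N f_x shows that it is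
    determined by the second derivatives of f. *)
Lemma left_dbar_second_order :
  (N2 - N * N1) * f1 = f22 - f11 - (N * f12 + N * f12).
Proof.
have e1 := move_left f22N; have e2 := move_left f12N; have e3 := move_left_opp NN.
apply: (eq_from_diff (d := - (f22 - (N2 * f1 + N * f12))
  + N * (f12 - (N1 * f1 + N * f11)) + (N * N + 1) * f11)); first by ncring.
by rewrite e1 e2 e3 !zeros.
Qed.

(** The mirror image of the preceding identity, from f_y = - f_x R. *)
Lemma right_dbar_second_order :
  f1 * (R2 - Rn * R1) = f11 - f22 - (f12 * Rn + f12 * Rn).
Proof.
have e1 := move_left_opp f22R; have e2 := move_left_opp f12R.
have e3 := move_left_opp RR.
apply: (eq_from_diff (d := (f22 + (f12 * Rn + f1 * R2))
   + (f12 + (f11 * Rn + f1 * R1)) * Rn - f11 * (Rn * Rn + 1)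
   - f1 * (R1 * Rn + Rn * R1))); first by ncring.
by rewrite e1 e2 e3 dR1 !zeros.
Qed.

(** T is the second derivative of f h without the term f h''. If R is holomorphic,
    only dbar N prevents T from satisfying N T = T i, as f_x h does. *)
Lemma twistor_dbar_identity (h h1 : quat R) : R2 - Rn * R1 = 0 ->
  Rn * h = - (h * qi) -> R1 * h + Rn * h1 = - (h1 * qi) ->
  let T := f11 * h + (f1 * h1 + f1 * h1) in
  (T + N * T * qi) + (T + N * T * qi) = - ((N2 - N * N1) * (f1 * h)).
Proof.
move=> B0 Rh Rh1 T; rewrite mulrA left_dbar_second_order f22R f12R.
have {B0} -> : R2 = Rn * R1 by exact: subr0_eq.
have e1 := move_left_opp Rh; have e2 := move_left_opp Rh1.
have e3 := move_left_opp NR; have e4 := move_left_opp RR.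
pose d0 := N * f11 * (Rn * h + h * qi).
pose d1 := f1 * Rn * (R1 * h + Rn * h1 + h1 * qi).
pose d2 := (N * f1 + f1 * Rn) * (h1 * qi).
pose d3 := (N * f1 + f1 * Rn) * (R1 * h).
pose d4 := f1 * (Rn * Rn + 1) * h1.
apply: (eq_from_diff (d := d0 + d0 + f11 * (Rn * Rn + 1) * h
  + (d2 + d2 + d2 + d2) + (d3 + d3) + f1 * (R1 * Rn + Rn * R1) * h
  - (d1 + d1 + d1 + d1) + (d4 + d4 + d4 + d4))).
  by rewrite /d0 /d1 /d2 /d3 /d4 /T; ncring.
by rewrite /d0 /d1 /d2 /d3 /d4 e1 e2 e3 e4 dR1 !zeros.
Qed.

End PointwiseAlgebra.

Section EigenlineDerivative.
Variable R : realType.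

(** Subtracting the derivative of R h = - h i along x, multiplied by i, from the
    one along y. *)
Lemma eigenline_dbar (h Rn R1 R2 h1 h2 : quat R) :
  R1 * Rn + Rn * R1 = 0 -> Rn * h = - (h * qi) ->
  R1 * h + Rn * h1 = - (h1 * qi) -> R2 * h + Rn * h2 = - (h2 * qi) ->
  Rn * (h2 - h1 * qi) + (h2 - h1 * qi) * qi = - ((R2 - Rn * R1) * h).
Proof.
move=> dR1 Rh Rh1 Rh2; have e1 := move_left_opp Rh; have e2 := move_left_opp Rh1.
have e3 := move_left_opp Rh2.
apply: (eq_from_diff (d := (R2 * h + Rn * h2 + h2 * qi)
  - (R1 * h + Rn * h1 + h1 * qi) * qi + R1 * (Rn * h + h * qi)
  - (R1 * Rn + Rn * R1) * h)); first by ncring.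
by rewrite e1 e2 e3 dR1 !zeros.
Qed.

End EigenlineDerivative.

Section OsculatingAlgebra.
Variable R : realType.
Implicit Types (Y L f : quat R).

Lemma twistor_minor Y L :
  cpart Y * cpart (- qj * (Y * L)) - cpart (- qj * Y) * cpart (Y * L) =
  qdot Y Y *: cpart (- qj * L).
Proof. by rewrite !cpartE /qdot; apply: quatP; rewrite !qsimp; ring. Qed.

(** Let b1, b2 be the last components of the two derivatives. The first minor gives
    b2 = L b1; so L is a quotient of complex numbers if b1 is nonzero. Otherwise the
    second minor is |Y|^2 times the component of L in j C. *)
Lemma minors_vanish Y L f (h1 h11 : quat R) : Y != 0 -> cpart h1 = 0 -> cpart h11 = 0 ->
  (Y + f * h1) * cpart (- qj * h11) - (Y * L + f * h11) * cpart (- qj * h1) = 0 ->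
  cpart (Y + f * h1) * cpart (- qj * (Y * L + f * h11)) -
    cpart (- qj * (Y + f * h1)) * cpart (Y * L + f * h11) = 0 ->
  cpart L = L.
Proof.
move=> Y0 ch1 ch11; have := cpart_decomp h1; have := cpart_decomp h11.
rewrite ch1 ch11 !add0r.
have := cpart_cx (- qj * h1); have := cpart_cx (- qj * h11).
move: (cpart (- qj * h1)) (cpart (- qj * h11)) => b1 b2 cb2 cb1 E2 E1.
rewrite E1 E2 => W m.
have bb := cxC cb1 cb2.
have {W} Eb : b2 = L * b1.
  apply: (qmulI Y0); apply: (eq_from_diff (d := (Y + f * (qj * b1)) * b2
     - (Y * L + f * (qj * b2)) * b1 - f * qj * (b1 * b2 - b2 * b1))).
    by ncring.
  by rewrite W bb subrr mulr0 subr0.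
have [b10|b10] := eqVneq b1 0.
  move: m; rewrite Eb b10 !mulr0 !addr0 twistor_minor => /eqP.
  rewrite scaler_eq0 qdot_eq0 (negbTE Y0) /= => /eqP cL.
  by rewrite [RHS]cpart_decomp cL mulr0 addr0.
apply: cx_cpart; have -> : L = b2 * b1^-1 by rewrite Eb mulrK // qunitE.
by apply: cxM => //; exact: cxV.
Qed.

Lemma minors_of_complex_ratio (X1 h1 L : quat R) : is_cx L ->
  X1 * cpart (- qj * (h1 * L)) - X1 * L * cpart (- qj * h1) = 0 /\
  cpart X1 * cpart (- qj * (X1 * L)) - cpart (- qj * X1) * cpart (X1 * L) = 0.
Proof.
move=> cL; rewrite !mulrA !(cpart_mulr _ cL); split.
  by rewrite -(mulrA X1 L) (cxC cL (cpart_cx (- qj * h1))) !mulrA subrr.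
by rewrite !mulrA (cxC (cpart_cx X1) (cpart_cx (- qj * X1))) subrr.
Qed.

End OsculatingAlgebra.

(** * Holomorphic maps and their extension by zero *)

Section ExtensionByZero.
Variable R : realType.
Local Notation plane := (R * R)%type.
Implicit Types (U V : set plane) (x y : plane) (F G : plane -> quat R).

Lemma eq_on_closure U V F G x : smoothq V F -> smoothq V G ->
  (forall z, U z -> F z = G z) -> V x -> closure U x -> F x = G x.
Proof.
move=> sF sG FG Vx clU; apply: subr0_eq; apply/eqP; apply: contrapT => /negP n0.
have c : {for x, continuous (fun z => F z - G z)}.
  by apply: cvgB; [exact: smoothq_continuous sF Vx | exact: smoothq_continuous sG Vx].
have nz : \forall z \near x, F z - G z != 0 by exact: cvgr_neq0 c n0.
by have [z [Uz]] := clU _ nz; rewrite FG // subrr eqxx.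
Qed.

(** At a zero of F the extension is continuous; at a nonzero value the point is
    interior to the closure of U, where F is holomorphic by continuity. *)
Lemma extension_by_zero U V F : open V -> smoothq V F ->
  (forall x, U x -> dy F x = dx F x * qi) ->
  (forall x, V x -> closure U x -> closure (V `\` closure U) x -> F x = 0) ->
  i_holomorphic_off_zeros V (fun x => if pselect (closure U x) then F x else 0).
Proof.
move=> oV sF hF F0; set G := (fun x => _).
have GU x : closure U x -> G x = F x by rewrite /G; case: pselect.
have G0 x : ~ closure U x -> G x = 0 by rewrite /G; case: pselect.
have near_cl x : V x -> ~ closure (V `\` closure U) x ->
    \forall z \near x, V z /\ ~ closure (V `\` closure U) z /\ closure U z.
  move=> Vx nx; have oc : open (V `&` ~` closure (V `\` closure U)).
    by apply: openI => //; apply: closed_openC; exact: closed_closure.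
  have n : nbhs x (V `&` ~` closure (V `\` closure U)).
    by apply: open_nbhs_nbhs; split.
  apply: filterS n => z [Vz nz]; split=> //; split=> //.
  apply: contrapT => ncl; apply: nz; apply: subset_closure; split; [exact: Vz | exact: ncl].
split=> [x Vx | x Vx Gx].
  have [clU|ncl] := pselect (closure U x); last first.
    have n : \forall z \near x, (fun=> 0 : quat R) z = G z.
      have oc : open (~` closure U) by apply: closed_openC; exact: closed_closure.
      have n : nbhs x (~` closure U) by exact: open_nbhs_nbhs.
      by apply: filterS n => z nz; rewrite G0.
    change (G z @[z --> x] --> G x); rewrite G0 //.
    exact: (cvg_trans (near_eq_cvg n) (cvg_cst 0)).
  have cF := smoothq_continuous sF Vx.
  change (G z @[z --> x] --> G x); rewrite GU //.
  have [clZ|nclZ] := pselect (closure (V `\` closure U) x).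
    have Fx0 := F0 x Vx clU clZ.
    rewrite Fx0; apply/cvgrPdist_lt => e e0.
    have n : \forall z \near x, `|F x - F z| < e.
      exact: (cvgrPdist_lt _ _).1 cF e e0.
    apply: filterS n => z; rewrite Fx0 => Fz.
    by have [/GU ->|/G0 ->] := pselect (closure U z); rewrite ?subrr ?normr0.
  have n : \forall z \near x, F z = G z.
    by apply: filterS (near_cl x Vx nclZ) => z [_ [_ /GU]].
  exact: (cvg_trans (near_eq_cvg n) cF).
have clU : closure U x by apply: contrapT => /G0 G0x; move: Gx; rewrite G0x eqxx.
have nclZ : ~ closure (V `\` closure U) x.
  by move=> clZ; move: Gx; rewrite GU // F0 // eqxx.
pose D := V `&` ~` closure (V `\` closure U).
have oD : open D.
  by apply: openI => //; apply: closed_openC; exact: closed_closure.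
have DU z : D z -> closure U z.
  move=> [Vz nz]; apply: contrapT => ncl; apply: nz; apply: subset_closure.
  by split; [exact: Vz | exact: ncl].
exists D; split; [exact: oD | exact: (conj Vx nclZ) |].
have sFD : smoothq D F by apply: smoothq_sub sF => z [].
have FG z : D z -> F z = G z by move=> /DU /GU.
split; first exact (smoothq_ext oD FG sFD).
move=> z Dz; rewrite -(dx_ext oD FG Dz) -(dy_ext oD FG Dz).
have sFi := smoothqM oV (smoothq_dx sF) (smoothq_cst V qi).
have Vz : V z by case: Dz.
exact: (eq_on_closure (smoothq_dy sF) sFi hF Vz (DU z Dz)).
Qed.

End ExtensionByZero.

(** As a product of constants and q, the complex part falls under the product rules. *)
Lemma cpart_mulE (R : realType) (q : quat R) :
  cpart q = (2^-1 *: 1) * (q - qi * q * qi).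
Proof. by rewrite -scalerAl mul1r. Qed.

Section HolomorphicCalculus.
Variable R : realType.
Local Notation plane := (R * R)%type.
Variables (U V : set plane).
Hypotheses (oU : open U) (oV : open V) (UV : U `<=` V).
Implicit Types (F G : plane -> quat R).

(** Smooth on V and holomorphic on the smaller set U: the extension by zero needs
    smoothness up to the frontier of U. *)
Definition hol_within F := smoothq V F /\ forall x, U x -> dy F x = dx F x * qi.

Lemma smoothq_cpart F : smoothq V F -> smoothq V (fun x => cpart (F x)).
Proof.
move=> sF; have c := @smoothq_cst R V.
have := smoothqM oV (c (2^-1 *: 1)) (smoothqB oV sF
  (smoothqM oV (smoothqM oV (c qi) sF) (c qi))).
by apply: (smoothq_ext oV) => x _; rewrite cpart_mulE.
Qed.

Lemma d_cpart F x : smoothq V F -> V x ->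
  dx (fun x => cpart (F x)) x = cpart (dx F x) /\
  dy (fun x => cpart (F x)) x = cpart (dy F x).
Proof.
move=> sF Vx; have c := @smoothq_cst R V.
have s1 := smoothqM oV (c qi) sF.
have s2 := smoothqM oV s1 (c qi).
have s3 := smoothqB oV sF s2.
have E z : V z -> cpart (F z) = (2^-1 *: 1) * (F z - qi * F z * qi).
  by move=> _; exact: cpart_mulE.
rewrite (dx_ext oV E Vx) (dy_ext oV E Vx).
rewrite (dxM (c _) s3 Vx) (dyM (c _) s3 Vx) (dxB sF s2 Vx) (dyB sF s2 Vx).
rewrite (dxM s1 (c _) Vx) (dyM s1 (c _) Vx) (dxM (c _) sF Vx) (dyM (c _) sF Vx).
rewrite !dx_cst !dy_cst !cpart_mulE.
by move: (dx F x) (dy F x) (F x) (2^-1 *: 1) => p q r s; split; ncring.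
Qed.

Lemma hol_dx F : hol_within F -> hol_within (dx F).
Proof.
move=> [sF hF]; split=> [|x Ux]; first exact: smoothq_dx.
have Vx := UV Ux; have E := dxM (smoothq_dx sF) (smoothq_cst V qi) Vx.
rewrite -(dxdyC oV sF Vx) (dx_ext oU hF Ux) E dx_cst.
by move: (dx (dx F) x) (dx F x) => p q; ncring.
Qed.

Lemma holB F G : hol_within F -> hol_within G -> hol_within (fun x => F x - G x).
Proof.
move=> [sF hF] [sG hG]; split=> [|x Ux]; first exact (smoothqB oV sF sG).
have Vx := UV Ux; rewrite (dxB sF sG Vx) (dyB sF sG Vx) hF // hG //.
by rewrite mulrBl.
Qed.

Lemma hol_cmul (a : quat R) F : hol_within F -> hol_within (fun x => a * F x).
Proof.
move=> [sF hF]; have sa := smoothq_cst V a.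
split=> [|x Ux]; first exact (smoothqM oV sa sF).
have Vx := UV Ux; rewrite (dxM sa sF Vx) (dyM sa sF Vx) dx_cst dy_cst.
by rewrite (hF x Ux); ncring.
Qed.

Lemma hol_cpart F : hol_within F -> hol_within (fun x => cpart (F x)).
Proof.
move=> [sF hF]; split=> [|x Ux]; first exact: smoothq_cpart.
have [-> ->] := d_cpart sF (UV Ux).
by rewrite hF // (cpart_mulr _ (cx_qi R)).
Qed.

(** The right factor must commute with i for the complex structure to pass
    through it. *)
Lemma holM F G : hol_within F -> hol_within G -> (forall x, is_cx (G x)) ->
  hol_within (fun x => F x * G x).
Proof.
move=> [sF hF] [sG hG] cG; split=> [|x Ux]; first exact (smoothqM oV sF sG).
have Vx := UV Ux; rewrite (dxM sF sG Vx) (dyM sF sG Vx) hF // hG //.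
by rewrite mulrDl -!mulrA (cG x).
Qed.

End HolomorphicCalculus.

(** * Conformal immersions of plane domains *)

Section LocalSurface.
Variable R : realType.
Local Notation plane := (R * R)%type.
Implicit Types (x y : plane).

(** For a map F into the unit imaginary quaternions this is the part of dF
    that vanishes when F is holomorphic into the 2-sphere: *dF = F dF. *)
Definition dbar (F : plane -> quat R) x : quat R := dy F x - F x * dx F x.

(** A surface as the local analysis sees it, without charts and with smooth normals
    as data. *)
Record conformal_patch (V : set plane) (f N Rn : plane -> quat R) : Prop :=
  ConformalPatch {
    patch_open : open V;
    patch_f : smoothq V f;
    patch_N : smoothq V N;
    patch_R : smoothq V Rn;
    patch_NN : forall x, V x -> N x * N x = -1;
    patch_RR : forall x, V x -> Rn x * Rn x = -1;
    patch_dN : forall x, V x -> dy f x = N x * dx f x;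
    patch_dR : forall x, V x -> dy f x = - (dx f x * Rn x);
    patch_imm : forall x, V x -> dx f x != 0 }.

Lemma smoothq_dbar V F : open V -> smoothq V F -> smoothq V (dbar F).
Proof.
move=> oV sF.
exact (smoothqB oV (smoothq_dy sF) (smoothqM oV sF (smoothq_dx sF))).
Qed.

Lemma d_sqN1 V F x : open V -> smoothq V F ->
  (forall z, V z -> F z * F z = -1) -> V x ->
  dx F x * F x + F x * dx F x = 0 /\ dy F x * F x + F x * dy F x = 0.
Proof.
move=> oV sF FF Vx; have E1 := dxM sF sF Vx; have E2 := dyM sF sF Vx.
have E3 := dx_ext oV FF Vx; have E4 := dy_ext oV FF Vx.
by split; [rewrite -E1 E3 dx_cst | rewrite -E2 E4 dy_cst].
Qed.

Lemma d_eigen V (Rn h : plane -> quat R) x : open V -> smoothq V Rn -> smoothq V h ->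
  (forall z, V z -> Rn z * h z = - (h z * qi)) -> V x ->
  dx Rn x * h x + Rn x * dx h x = - (dx h x * qi) /\
  dy Rn x * h x + Rn x * dy h x = - (dy h x * qi).
Proof.
move=> oV sR sh Rh Vx; have c := @smoothq_cst R V.
have si := smoothqM oV sh (c qi).
have E1 := dx_ext oV Rh Vx; have E2 := dy_ext oV Rh Vx.
have {}E1 := etrans (esym (dxM sR sh Vx)) (etrans E1 (dxN si Vx)).
have {}E2 := etrans (esym (dyM sR sh Vx)) (etrans E2 (dyN si Vx)).
have F1 : dx (fun z => h z * qi) x = dx h x * qi.
  by rewrite (dxM sh (c qi) Vx) dx_cst; ncring.
have F2 : dy (fun z => h z * qi) x = dy h x * qi.
  by rewrite (dyM sh (c qi) Vx) dy_cst; ncring.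
split; first exact (etrans E1 (congr1 -%R F1)).
exact (etrans E2 (congr1 -%R F2)).
Qed.

(** For a section h of the eigenline bundle R h = - h i, its dbar is again a section
    exactly when dbar R vanishes on h. This is how the holomorphic structure of the
    eigenline bundle sees R. *)
Lemma eigen_section_dbar V (Rn h : plane -> quat R) x : open V -> smoothq V Rn ->
  smoothq V h -> (forall z, V z -> Rn z * Rn z = -1) ->
  (forall z, V z -> Rn z * h z = - (h z * qi)) -> V x ->
  Rn x * (dy h x - dx h x * qi) + (dy h x - dx h x * qi) * qi = - (dbar Rn x * h x).
Proof.
move=> oV sR sh RR Rh Vx; have [E1 E2] := d_eigen oV sR sh Rh Vx.
have [dR _] := d_sqN1 oV sR RR Vx.
exact (eigenline_dbar dR (Rh x Vx) E1 E2).
Qed.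

Section Patch.
Variables (V : set plane) (f N Rn : plane -> quat R).
Hypothesis P : conformal_patch V f N Rn.
Let oV := patch_open P.
Let sf := patch_f P.
Let sN := patch_N P.
Let sR := patch_R P.
Let sfx := smoothq_dx sf.

(** The derivatives of f_y = N f_x = - f_x R. *)
Lemma patch_second_order x : V x ->
  [/\ dy (dx f) x = dx N x * dx f x + N x * dx (dx f) x,
      dy (dx f) x = - (dx (dx f) x * Rn x + dx f x * dx Rn x),
      dy (dy f) x = dy N x * dx f x + N x * dy (dx f) x &
      dy (dy f) x = - (dy (dx f) x * Rn x + dx f x * dy Rn x)].
Proof.
move=> Vx; have s := smoothqM oV sfx sR.
have C := dxdyC oV sf Vx.
have X1 := dx_ext oV (patch_dN P) Vx; have X2 := dx_ext oV (patch_dR P) Vx.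
have Y1 := dy_ext oV (patch_dN P) Vx; have Y2 := dy_ext oV (patch_dR P) Vx.
rewrite (dxM sN sfx Vx) C in X1; rewrite (dxN s Vx) (dxM sfx sR Vx) C in X2.
rewrite (dyM sN sfx Vx) in Y1; rewrite (dyN s Vx) (dyM sfx sR Vx) in Y2.
exact (And4 X1 X2 Y1 Y2).
Qed.

End Patch.
End LocalSurface.

(** * The twistor lift *)

Section TwistorLift.
Variable R : realType.
Local Notation plane := (R * R)%type.
Variables (V : set plane) (f N Rn : plane -> quat R).
Hypothesis P : conformal_patch V f N Rn.
Hypothesis Rni : forall x, V x -> qcoord 1 (Rn x) != 1.

Local Notation oV := (patch_open P).
Local Notation sf := (patch_f P).
Local Notation sR := (patch_R P).

Definition lift_denominator x : quat R := cpart (1 + Rn x * qi).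

(** The eigenvector of R v = - v i whose first complex coordinate is 1; it
    exists because R is not i. *)
Definition lift_eigenvector x : quat R :=
  (1 + Rn x * qi) * (lift_denominator x)^-1.

Local Notation h := lift_eigenvector.

Lemma lift_denominator_neq0 x : V x -> lift_denominator x != 0.
Proof.
move=> Vx; apply/eqP => /(congr1 (qcoord 0)).
rewrite /lift_denominator cpartE !qsimp => E.
by have := Rni Vx; rewrite eq_sym -subr_eq0; apply/negP; rewrite negbK; apply/eqP; lra.
Qed.

Lemma smoothq_lift : smoothq V h.
Proof.
have c := @smoothq_cst R V.
have s := smoothqD oV (c 1) (smoothqM oV sR (c qi)).
exact (smoothqM oV s (smoothqV oV lift_denominator_neq0 (smoothq_cpart oV s))).
Qed.

Lemma cpart_lift x : V x -> cpart (h x) = 1.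
Proof.
move=> Vx; rewrite /lift_eigenvector cpart_mulr; last by apply: cxV; exact: cpart_cx.
by rewrite -/(lift_denominator x) mulrV // qunitE lift_denominator_neq0.
Qed.

Lemma lift_neq0 x : V x -> h x != 0.
Proof.
move=> /cpart_lift E; apply/eqP => h0; move/eqP: E.
by rewrite h0 cpart0 eq_sym oner_eq0.
Qed.

Lemma lift_eigen x : V x -> Rn x * h x = - (h x * qi).
Proof.
move=> Vx; rewrite /lift_eigenvector.
have cz : is_cx (lift_denominator x)^-1 by apply: cxV; exact: cpart_cx.
move: (lift_denominator x)^-1 cz => w cz.
have RR := move_left_opp (patch_RR P Vx); have ii := move_left_opp (qi_sq R).
move: (Rn x) RR => r RR; have ciw := move_left cz.
apply: (eq_from_diff (d := (r * r + 1) * qi * w + (1 + r * qi) * (w * qi - qi * w)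
   + r * (qi * qi + 1) * w)); first by ncring.
by rewrite RR ii ciw !zeros.
Qed.

Lemma d_cpart_lift x : V x -> cpart (dx h x) = 0 /\ cpart (dy h x) = 0.
Proof.
move=> Vx; have [E1 E2] := d_cpart oV smoothq_lift Vx.
have F1 := dx_ext (F := fun z => cpart (h z)) (G := fun=> 1) oV cpart_lift Vx.
have F2 := dy_ext (F := fun z => cpart (h z)) (G := fun=> 1) oV cpart_lift Vx.
split; first exact (etrans (esym E1) (etrans F1 (dx_cst 1 x))).
exact (etrans (esym E2) (etrans F2 (dy_cst 1 x))).
Qed.

Lemma d_lift_eigen x : V x ->
  dx Rn x * h x + Rn x * dx h x = - (dx h x * qi) /\
  dy Rn x * h x + Rn x * dy h x = - (dy h x * qi).
Proof.
by move=> Vx; exact (d_eigen oV sR smoothq_lift lift_eigen Vx).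
Qed.

(** The eigenline is one-dimensional over C and the complex part of h is constant;
    so a derivative that stays in the eigenline vanishes. *)
Lemma lift_eigenvector_hol x : V x -> dbar Rn x = 0 -> dy h x = dx h x * qi.
Proof.
move=> Vx B0; have E := eigen_section_dbar oV sR smoothq_lift (patch_RR P)
  lift_eigen Vx.
have [c1 c2] := d_cpart_lift Vx.
apply: subr0_eq; have K : Rn x * (dy h x - dx h x * qi) = - ((dy h x - dx h x * qi) * qi).
  by apply: subr0_eq; rewrite opprK E B0 mul0r oppr0.
rewrite (eigenline_cpart (cpart_lift Vx) (lift_eigen Vx) K).
by rewrite cpartB (cpart_mulr _ (cx_qi R)) c1 c2 mul0r subrr mulr0.
Qed.

Definition lift_numerator x : quat R := f x * h x.
Local Notation X := lift_numerator.

Lemma smoothq_numerator : smoothq V X.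
Proof. exact (smoothqM oV sf smoothq_lift). Qed.

(** The line of (f h, h) is the eigenline bundle; f h is holomorphic because
    f_y h = - f_x R h = f_x h i. *)
Lemma numerator_hol x : V x -> dbar Rn x = 0 -> dy X x = dx X x * qi.
Proof.
move=> Vx B0; have sh := smoothq_lift.
rewrite (dxM sf sh Vx) (dyM sf sh Vx) (lift_eigenvector_hol Vx B0).
have E1 := move_left_opp (patch_dR P Vx); have E2 := move_left_opp (lift_eigen Vx).
apply: (eq_from_diff (d := (dy f x + dx f x * Rn x) * h x
   - dx f x * (Rn x * h x + h x * qi))); first by ncring.
by rewrite E1 E2 !zeros.
Qed.

(** With L the ratio, the derivatives of the numerator X = f h are
    X' = Y + f h' and X'' = Y L + f h''. *)
Definition lift_Y x : quat R := dx f x * h x.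
Definition lift_T x : quat R :=
  dx (dx f) x * h x + (dx f x * dx h x + dx f x * dx h x).
Definition lift_ratio x : quat R := (lift_Y x)^-1 * lift_T x.
Local Notation Y := lift_Y.
Local Notation T := lift_T.
Local Notation L := lift_ratio.

Lemma Y_neq0 x : V x -> Y x != 0.
Proof. by move=> Vx; apply: qmul_neq0; [exact: patch_imm P x Vx | exact: lift_neq0]. Qed.

Lemma smoothq_Y : smoothq V Y.
Proof. exact (smoothqM oV (smoothq_dx sf) smoothq_lift). Qed.

Lemma smoothq_T : smoothq V T.
Proof.
have sfx := smoothq_dx sf; have s := smoothqM oV sfx (smoothq_dx smoothq_lift).
exact (smoothqD oV (smoothqM oV (smoothq_dx sfx) smoothq_lift) (smoothqD oV s s)).
Qed.

Lemma smoothq_ratio : smoothq V L.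
Proof. exact (smoothqM oV (smoothqV oV Y_neq0 smoothq_Y) smoothq_T). Qed.

Lemma T_ratio x : V x -> T x = Y x * L x.
Proof. by move=> Vx; rewrite /lift_ratio mulVKr // qunitE Y_neq0. Qed.

Lemma dx_numerator x : V x -> dx X x = Y x + f x * dx h x.
Proof. by move=> Vx; rewrite (dxM sf smoothq_lift Vx). Qed.

Lemma dxx_numerator x : V x -> dx (dx X) x = T x + f x * dx (dx h) x.
Proof.
move=> Vx; have sh := smoothq_lift; have shx := smoothq_dx sh.
rewrite (dx_ext oV dx_numerator Vx) (dxD smoothq_Y (smoothqM oV sf shx) Vx).
rewrite (dxM (smoothq_dx sf) sh Vx) (dxM sf shx Vx) /lift_T.
by move: (dx (dx f) x) (dx f x) (h x) (dx h x) (f x) (dx (dx h) x) => *; ncring.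
Qed.

(** Where R is holomorphic, the failure of L to be complex is dbar N, up to
    conjugation. *)
Lemma ratio_deviation x : V x -> dbar Rn x = 0 ->
  L x + qi * L x * qi + (L x + qi * L x * qi) = - ((Y x)^-1 * (dbar N x * Y x)).
Proof.
move=> Vx B0; have [e1 e2 e3 e4] := patch_second_order P Vx.
have [E1 _] := d_lift_eigen Vx.
have [dR _] := d_sqN1 oV sR (patch_RR P) Vx.
have NR : N x * dx f x = - (dx f x * Rn x) by rewrite -(patch_dN P Vx) (patch_dR P Vx).
have K := twistor_dbar_identity (patch_NN P Vx) (patch_RR P Vx) NR dR e1 e2 e3 e4 B0
  (lift_eigen Vx) E1.
rewrite -/(T x) -/(Y x) -[_ - _]/(dbar N x) in K.
have NY : N x * Y x = Y x * qi.
  rewrite /lift_Y mulrA NR mulNr -(mulrA _ (Rn x)) (lift_eigen Vx) mulrN opprK.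
  exact: mulrA.
have E : T x + N x * T x * qi = Y x * (L x + qi * L x * qi).
  by rewrite (T_ratio Vx) mulrA NY; ncring.
have YV q : Y x * ((Y x)^-1 * q) = q by apply: mulVKr; exact: Y_neq0 Vx.
apply: (qmulI (Y_neq0 Vx)); apply: (etrans (mulrDr _ _ _)).
by rewrite mulrN YV -K E.
Qed.

End TwistorLift.

(** * Vanishing of dbar N across the frontier of its support *)

Section Frontier.
Variable R : realType.
Implicit Types (p q : quat R).

(** The map s |-> R s + s i takes values in the complementary eigenspace, where
    R w = w i; hence it cannot hit a nonzero element of h C. *)
Lemma eigen_resonance (Rn h s l : quat R) : Rn * Rn = -1 -> h != 0 ->
  Rn * h = - (h * qi) -> is_cx l -> Rn * s + s * qi = h * l ->
  Rn * s = - (s * qi).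
Proof.
move=> RR h0 Rh cl E.
have E1 : h * l * qi + h * l * qi = 0.
  have e1 := move_left_opp RR; have e2 := move_left_opp (qi_sq R).
  have e3 := move_left_opp Rh; have e4 := move_left E; have e5 := move_left cl.
  apply: (eq_from_diff (d := (Rn * h + h * qi) * l + (h * (l * qi - qi * l))
    + Rn * (Rn * s + s * qi - h * l) - (Rn * Rn + 1) * s
    - (Rn * s + s * qi - h * l) * qi + s * (qi * qi + 1))); first by ncring.
  by rewrite e1 e2 e3 e4 e5 !zeros.
have hl0 : h * l * qi = 0.
  by apply: addrr_inj; rewrite E1 addr0.
have qi0 : qi != 0 :> quat R.
  by apply: (sqN1_neq0 (qi_sq R)).
have {}hl0 : h * l = 0.
  by case: (qmul_eq0 hl0) => // /eqP; rewrite (negbTE qi0).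
by apply: subr0_eq; rewrite opprK E hl0.
Qed.

Lemma cx_of_deviation q : q + qi * q * qi = 0 -> is_cx q.
Proof.
move=> E; have e := move_left_opp (qi_sq R); apply: (eq_from_diff
  (d := (q + qi * q * qi) * qi - qi * q * (qi * qi + 1))); first by ncring.
by rewrite E e !zeros.
Qed.

(** The second hypothesis compares two expressions of the y-derivative of
    T = Y L; for complex L the terms with the derivative of Y cancel. *)
Lemma resonance_equation (a h k m l l1 l2 r y1 : quat R) : is_cx l ->
  (y1 * qi + a * (r * k + k * qi)) * l + a * h * l2 =
  (y1 * l + a * h * l1) * qi + a * (r * m + m * qi) ->
  a * (r * (m - k * l) + (m - k * l) * qi) = a * (h * (l2 - l1 * qi)).
Proof.
move=> cl E; have e1 := move_left cl; have e2 := move_left E.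
apply: (eq_from_diff (d := - ((y1 * qi + a * (r * k + k * qi)) * l + a * h * l2 -
  ((y1 * l + a * h * l1) * qi + a * (r * m + m * qi)))
  - (y1 + a * k) * (l * qi - qi * l))); first by ncring.
by rewrite e1 e2 !zeros.
Qed.

Lemma is_cxB p q : is_cx p -> is_cx q -> is_cx (p - q).
Proof. by rewrite /is_cx mulrBl mulrBr => -> ->. Qed.

Local Notation plane := (R * R)%type.
Variables (V : set plane) (f N Rn : plane -> quat R).
Hypothesis P : conformal_patch V f N Rn.
Hypothesis Rni : forall x, V x -> qcoord 1 (Rn x) != 1.
Hypothesis AB : forall x, V x -> dbar N x = 0 \/ dbar Rn x = 0.

Local Notation oV := (patch_open P).
Local Notation sf := (patch_f P).
Local Notation sN := (patch_N P).
Local Notation sR := (patch_R P).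
Local Notation h := (lift_eigenvector Rn).
Local Notation X := (lift_numerator f Rn).
Local Notation Y := (lift_Y f Rn).
Local Notation T := (lift_T f Rn).
Local Notation L := (lift_ratio f Rn).

(** Here dbar N is nonzero, hence R is holomorphic and the twistor lift is a
    holomorphic curve. *)
Definition left_active : set plane := [set x | V x /\ dbar N x != 0].
Local Notation U := left_active.

Lemma left_active_sub : U `<=` V. Proof. by move=> x []. Qed.

Lemma open_left_active : open U.
Proof.
rewrite openE => x [Vx n0]; rewrite /interior /=.
have c := smoothq_continuous (smoothq_dbar oV sN) Vx.
have nz : \forall z \near x, dbar N z != 0 by exact: cvgr_neq0 c n0.
have nV : nbhs x V by apply: open_nbhs_nbhs; split; [exact: oV | exact: Vx].
by near=> z; split; near: z; [exact: nV | exact: nz].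
Unshelve. all: by end_near. Qed.

Lemma right_hol x : U x -> dbar Rn x = 0.
Proof.
by move=> [Vx n0]; case: (AB Vx) => // E; move: n0; rewrite E eqxx.
Qed.

Let sh := smoothq_lift P Rni.
Let sX := smoothq_numerator P Rni.

Lemma hol_h : hol_within U V h.
Proof.
split; first exact sh.
by move=> x Ux; exact (lift_eigenvector_hol P Rni (left_active_sub Ux) (right_hol Ux)).
Qed.

Lemma hol_X : hol_within U V X.
Proof.
split; first exact sX.
by move=> x Ux; exact (numerator_hol P Rni (left_active_sub Ux) (right_hol Ux)).
Qed.

(** For holomorphic A and B the only source of non-holomorphy in A - f B is f. *)
Lemma moving_dbar (A B S : plane -> quat R) x : hol_within U V A ->
  hol_within U V B -> (forall z, V z -> S z = A z - f z * B z) -> U x ->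
  dy S x = dx S x * qi + dx f x * (Rn x * B x + B x * qi).
Proof.
move=> [sA hA] [sB hB] E Ux; have Vx := left_active_sub Ux.
have sfB := smoothqM oV sf sB.
rewrite (dx_ext oV E Vx) (dy_ext oV E Vx) (dxB sA sfB Vx) (dyB sA sfB Vx).
rewrite (dxM sf sB Vx) (dyM sf sB Vx) (hA x Ux) (hB x Ux) (patch_dR P Vx).
by move: (dx A x) (dx f x) (B x) (dx B x) (Rn x) (f x) => *; ncring.
Qed.

Lemma cpart_dxx_lift x : V x -> cpart (dx (dx h) x) = 0.
Proof.
move=> Vx; have [E1 _] := d_cpart oV (smoothq_dx sh) Vx.
have F z : V z -> cpart (dx h z) = 0 by move=> Vz; have [] := d_cpart_lift P Rni Vz.
by rewrite -E1 (dx_ext oV F Vx) dx_cst.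
Qed.

(** Twice the component of L in j C, which has to vanish for L to be complex. *)
Definition deviation x : quat R := L x + qi * L x * qi.

Lemma smoothq_deviation : smoothq V deviation.
Proof.
have c := @smoothq_cst R V; have sL := smoothq_ratio P Rni.
exact (smoothqD oV sL (smoothqM oV (smoothqM oV (c qi) sL) (c qi))).
Qed.

Lemma d_deviation x : V x ->
  dx deviation x = dx L x + qi * dx L x * qi /\
  dy deviation x = dy L x + qi * dy L x * qi.
Proof.
move=> Vx; have c := @smoothq_cst R V; have sL := smoothq_ratio P Rni.
have s1 := smoothqM oV (c qi) sL; have s2 := smoothqM oV s1 (c qi).
rewrite (dxD sL s2 Vx) (dyD sL s2 Vx) (dxM s1 (c qi) Vx) (dyM s1 (c qi) Vx).
rewrite (dxM (c qi) sL Vx) (dyM (c qi) sL Vx) !dx_cst !dy_cst.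
by move: (dx L x) (dy L x) (L x) => *; split; ncring.
Qed.

Lemma deviation_double x : U x ->
  deviation x + deviation x = - ((Y x)^-1 * (dbar N x * Y x)).
Proof.
by move=> Ux; exact (ratio_deviation P Rni (left_active_sub Ux) (right_hol Ux)).
Qed.

Definition inactive : set plane := V `\` closure U.

Lemma inactive_dbar x : inactive x -> dbar N x = 0.
Proof.
move=> [Vx ncl]; apply/eqP; apply: contrapT => /negP n0; apply: ncl.
by apply: subset_closure; split.
Qed.

Lemma open_inactive : open inactive.
Proof.
by apply: openI; [exact: oV | apply: closed_openC; exact: closed_closure].
Qed.

(** The deviation is proportional to dbar N on the active side, and dbar N is
    identically zero on the other; by continuity this also gives the first
    derivatives on the frontier. *)
Lemma frontier_deviation x : V x -> closure U x -> closure inactive x ->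
  [/\ deviation x = 0, dx deviation x = 0 & dy deviation x = 0].
Proof.
move=> Vx clU clZ; have sD := smoothq_deviation.
have sDD := smoothqD oV sD sD.
have sY := smoothq_Y P Rni.
have sK := smoothqN oV (smoothqM oV (smoothqV oV (Y_neq0 P Rni) sY)
  (smoothqM oV (smoothq_dbar oV sN) sY)).
pose DD z := deviation z + deviation z.
pose K z := - ((Y z)^-1 * (dbar N z * Y z)).
have DK z : U z -> DD z = K z by exact: deviation_double.
have K0 z : inactive z -> K z = 0.
  by move=> /inactive_dbar E; rewrite /K E mul0r mulr0 oppr0.
have oU := open_left_active; have oZ := open_inactive.
have s0 := smoothq_cst V (0 : quat R).
have E0 : DD x = 0.
  apply: (etrans (eq_on_closure sDD sK DK Vx clU)).
  exact (eq_on_closure sK s0 K0 Vx clZ).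
have Ex : dx DD x = 0.
  apply: (etrans (eq_on_closure (smoothq_dx sDD) (smoothq_dx sK)
    (fun z Uz => dx_ext oU DK Uz) Vx clU)).
  apply: (etrans (eq_on_closure (smoothq_dx sK) (smoothq_dx s0)
    (fun z Zz => dx_ext oZ K0 Zz) Vx clZ)).
  exact: dx_cst.
have Ey : dy DD x = 0.
  apply: (etrans (eq_on_closure (smoothq_dy sDD) (smoothq_dy sK)
    (fun z Uz => dy_ext oU DK Uz) Vx clU)).
  apply: (etrans (eq_on_closure (smoothq_dy sK) (smoothq_dy s0)
    (fun z Zz => dy_ext oZ K0 Zz) Vx clZ)).
  exact: dy_cst.
rewrite /DD (dxD sD sD Vx) in Ex; rewrite /DD (dyD sD sD Vx) in Ey.
by split; apply: addrr_inj; rewrite ?addr0; [exact: E0 | exact: Ex | exact: Ey].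
Qed.

(** At the frontier L and its first derivatives are complex. The y-derivative of
    T = Y L then says that s = h'' - h' L satisfies R s + s i = h l with l complex.
    So s lies in the eigenline, and it is zero because its complex part is. *)
Lemma frontier_osculation x : V x -> closure U x -> closure inactive x ->
  [/\ is_cx (L x), dx (dx h) x = dx h x * L x & dx (dx X) x = dx X x * L x].
Proof.
move=> Vx clU clZ; have [d0 d1 d2] := frontier_deviation Vx clU clZ.
have [e1 e2] := d_deviation Vx; rewrite e1 in d1; rewrite e2 in d2.
have cL := cx_of_deviation d0; have cLx := cx_of_deviation d1.
have cLy := cx_of_deviation d2.
have sL := smoothq_ratio P Rni; have sY := smoothq_Y P Rni.
have sT := smoothq_T P Rni; have sfx := smoothq_dx sf; have c := @smoothq_cst R V.
have shx := smoothq_dx sh; have shxx := smoothq_dx shx.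
have oU := open_left_active; have UV := left_active_sub.
have sRi B (sB : smoothq V B) : smoothq V (fun z => dx f z * (Rn z * B z + B z * qi)).
  exact (smoothqM oV sfx (smoothqD oV (smoothqM oV sR sB) (smoothqM oV sB (c qi)))).
have hX1 := hol_dx oU oV UV hol_X; have hX2 := hol_dx oU oV UV hX1.
have hh1 := hol_dx oU oV UV hol_h; have hh2 := hol_dx oU oV UV hh1.
have EY z : V z -> Y z = dx X z - f z * dx h z.
  by move=> Vz; rewrite (dx_numerator P Rni Vz) addrK.
have ET z : V z -> T z = dx (dx X) z - f z * dx (dx h) z.
  by move=> Vz; rewrite (dxx_numerator P Rni Vz) addrK.
have A1 : dy Y x = dx Y x * qi + dx f x * (Rn x * dx h x + dx h x * qi).
  exact (eq_on_closure (smoothq_dy sY)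
    (smoothqD oV (smoothqM oV (smoothq_dx sY) (c qi)) (sRi _ shx))
    (fun z => @moving_dbar _ _ _ z hX1 hh1 EY) Vx clU).
have A2 : dy T x = dx T x * qi + dx f x * (Rn x * dx (dx h) x + dx (dx h) x * qi).
  exact (eq_on_closure (smoothq_dy sT)
    (smoothqD oV (smoothqM oV (smoothq_dx sT) (c qi)) (sRi _ shxx))
    (fun z => @moving_dbar _ _ _ z hX2 hh2 ET) Vx clU).
have TL := T_ratio P Rni.
rewrite (dx_ext oV TL Vx) (dy_ext oV TL Vx) (dxM sY sL Vx) (dyM sY sL Vx) A1 in A2.
pose s := dx (dx h) x - dx h x * L x.
pose l := dy L x - dx L x * qi.
have cl : is_cx l by apply: is_cxB => //; apply: cxM => //; exact: cx_qi.
have fx0 := patch_imm P Vx.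
have RE : Rn x * s + s * qi = h x * l.
  exact (qmulI fx0 (resonance_equation cL A2)).
have Rs := eigen_resonance (patch_RR P Vx) (lift_neq0 Rni Vx)
  (lift_eigen P Vx) cl RE.
have s0 : s = 0.
  rewrite (eigenline_cpart (cpart_lift Rni Vx) (lift_eigen P Vx) Rs).
  have [ch _] := d_cpart_lift P Rni Vx.
  by rewrite /s cpartB (cpart_mulr _ cL) (cpart_dxx_lift Vx) ch mul0r subrr mulr0.
have Eh : dx (dx h) x = dx h x * L x by apply: subr0_eq; exact: s0.
split; [exact: cL | exact: Eh |].
rewrite (dxx_numerator P Rni Vx) (dx_numerator P Rni Vx) Eh (TL x Vx).
by rewrite mulrDl mulrA.
Qed.

(** Write h = 1 + j b. In the affine chart C^3 of CP^3 the lift is the curve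
    (X, b), and these two functions collect the 2x2 minors of its first two
    derivatives: they vanish where it osculates a projective line. *)
Definition minor_h x : quat R :=
  dx X x * cpart (- qj * dx (dx h) x) - dx (dx X) x * cpart (- qj * dx h x).
Definition minor_X x : quat R :=
  cpart (dx X x) * cpart (- qj * dx (dx X) x) -
  cpart (- qj * dx X x) * cpart (dx (dx X) x).

Lemma hol_minors : hol_within U V minor_h /\ hol_within U V minor_X.
Proof.
have oU := open_left_active; have UV := left_active_sub.
have hX1 := hol_dx oU oV UV hol_X; have hX2 := hol_dx oU oV UV hX1.
have hh1 := hol_dx oU oV UV hol_h; have hh2 := hol_dx oU oV UV hh1.
have J F : hol_within U V F -> hol_within U V (fun z => cpart (- qj * F z)).
  by move=> hF; exact (hol_cpart oV UV (hol_cmul oV UV (- qj) hF)).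
split.
  apply: (holB oV UV); apply: (holM oV UV); try exact: J; try exact: hX1;
    try exact: hX2; move=> z; exact: cpart_cx.
have cX1 := hol_cpart oV UV hX1; have cX2 := hol_cpart oV UV hX2.
apply: (holB oV UV); apply: (holM oV UV); try exact: J; try exact: cX1;
  try exact: cX2; move=> z; exact: cpart_cx.
Qed.

Lemma frontier_minors x : V x -> closure U x -> closure inactive x ->
  minor_h x = 0 /\ minor_X x = 0.
Proof.
move=> Vx clU clZ; have [cL Eh EX] := frontier_osculation Vx clU clZ.
by rewrite /minor_h /minor_X Eh EX; exact: minors_of_complex_ratio.
Qed.

(** Osculation forces L to be complex, against a nonzero dbar N. *)
Lemma active_minors x : U x -> minor_h x = 0 -> minor_X x = 0 -> False.
Proof.
move=> Ux; have [Vx /eqP n0] := Ux; rewrite /minor_h /minor_X.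
rewrite (dxx_numerator P Rni Vx) (dx_numerator P Rni Vx) (T_ratio P Rni Vx).
move=> m1 m2; have [ch _] := d_cpart_lift P Rni Vx.
have cL := minors_vanish (Y_neq0 P Rni Vx) ch (cpart_dxx_lift Vx) m1 m2.
have D := deviation_double Ux; have ii := move_left_opp (qi_sq R).
have cxL : is_cx (L x) by rewrite -cL; exact: cpart_cx.
have d0 : deviation x = 0.
  have e := move_left cxL; apply: (eq_from_diff (d := L x * (qi * qi + 1)
     - (L x * qi - qi * L x) * qi)); first by rewrite /deviation; ncring.
  by rewrite ii e !zeros.
have Y0 := Y_neq0 P Rni Vx.
rewrite d0 addr0 in D; apply: n0.
have D1 : dbar N x * Y x = 0.
  have D2 : (Y x)^-1 * (dbar N x * Y x) = 0 by rewrite -[LHS]opprK -D oppr0.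
  have := congr1 (fun q => Y x * q) D2; rewrite mulVKr ?qunitE // mulr0.
  exact.
by case: (qmul_eq0 D1) => // /eqP; rewrite (negbTE Y0).
Qed.

(** On the active set both minors are holomorphic, and they vanish on its frontier.
    Extended by zero they vanish near y, hence everywhere by unique continuation,
    so that there are no active points. *)
Lemma dbar_propagates y (r : R) : 0 < r -> (forall x, `|x - y| <= r -> V x) ->
  (\forall x \near y, dbar N x = 0) ->
  forall x, `|x - y| <= r -> sqdist y x < r * r -> dbar N x = 0.
Proof.
move=> r0 QV A0 x xQ xr; apply/eqP; apply: contrapT => /negP n0.
have Ux : U x by split; [exact: QV | exact: n0].
have clUx : closure U x by exact: subset_closure.
have [[s1 h1] [s2 h2]] := hol_minors.
have near_ncl : \forall z \near y, ~ closure U z.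
  have /nbhs_interior A1 : nbhs y [set z | dbar N z = 0] by exact: A0.
  apply: filterS A1 => z Az clz; have [w [[_ nw] /= Ew]] := clz _ Az.
  by move: nw; rewrite Ew eqxx.
have ext F : smoothq V F -> (forall z, U z -> dy F z = dx F z * qi) ->
    (forall z, V z -> closure U z -> closure inactive z -> F z = 0) -> F x = 0.
  move=> sF hF F0; have hE := extension_by_zero oV sF hF F0.
  have nz : \forall z \near y, (if pselect (closure U z) then F z else 0) = 0.
    by apply: filterS near_ncl => z ncl; case: pselect.
  have := unique_continuation_square r0 QV hE nz xQ xr.
  by case: pselect => // /(_ clUx).
apply: (active_minors Ux).
  by apply: ext s1 h1 _ => z Vz cU cZ; have [] := frontier_minors Vz cU cZ.
by apply: ext s2 h2 _ => z Vz cU cZ; have [] := frontier_minors Vz cU cZ.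
Qed.

End Frontier.

(** * Local propagation without restriction on R *)

Section RotatedNormal.
Variable R : realType.
Implicit Types (a r k : quat R).

Lemma rotated_sq r k : r * r = -1 -> k * k = -1 -> - (k * r * k) * - (k * r * k) = -1.
Proof.
move=> rr kk; have e1 := move_left_opp rr; have e2 := move_left_opp kk.
apply: (eq_from_diff (d := k * r * (k * k + 1) * r * k - k * (r * r + 1) * k +
  (k * k + 1))); first by ncring.
by rewrite e1 e2 !zeros.
Qed.

Lemma rotated_right_normal a r k : k * k = -1 ->
  - (a * r) * k = - (a * k * - (k * r * k)).
Proof.
move=> kk; have e := move_left_opp kk.
apply: (eq_from_diff (d := - (a * (k * k + 1) * r * k))); first by ncring.
by rewrite e !zeros.
Qed.

Lemma rotated_dbar r r1 r2 k : k * k = -1 ->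
  - (k * r2 * k) - - (k * r * k) * - (k * r1 * k) = - (k * (r2 - r * r1) * k).
Proof.
move=> kk; have e := move_left_opp kk.
apply: (eq_from_diff (d := - (k * r * (k * k + 1) * r1 * k))); first by ncring.
by rewrite e !zeros.
Qed.

End RotatedNormal.

Section Propagation.
Variable R : realType.
Local Notation plane := (R * R)%type.
Variables (V : set plane) (f N Rn : plane -> quat R).
Hypothesis P : conformal_patch V f N Rn.

Local Notation oV := (patch_open P).
Local Notation sf := (patch_f P).
Local Notation sN := (patch_N P).
Local Notation sR := (patch_R P).

(** Right multiplication by j keeps N and turns R = i into R = - i; this reaches
    the points that the lift with complex part 1 leaves out. *)
Definition rotate_right x : quat R := f x * qj.
Definition rotate_normal x : quat R := - (qj * Rn x * qj).

Lemma d_rotate_right x : V x ->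
  dx rotate_right x = dx f x * qj /\ dy rotate_right x = dy f x * qj.
Proof.
move=> Vx; have c := @smoothq_cst R V qj.
by split; [rewrite (dxM sf c Vx) dx_cst | rewrite (dyM sf c Vx) dy_cst]; ncring.
Qed.

Lemma smoothq_rotate_normal : smoothq V rotate_normal.
Proof.
have c := @smoothq_cst R V qj.
exact (smoothqN oV (smoothqM oV (smoothqM oV c sR) c)).
Qed.

Lemma conformal_patch_rotate : conformal_patch V rotate_right N rotate_normal.
Proof.
have c := @smoothq_cst R V qj; split.
- exact oV.
- exact (smoothqM oV sf c).
- exact sN.
- exact smoothq_rotate_normal.
- exact (patch_NN P).
- by move=> x Vx; exact (rotated_sq (patch_RR P Vx) (qj_sq R)).
- move=> x Vx; have [-> ->] := d_rotate_right Vx; rewrite (patch_dN P Vx).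
  exact: esym (mulrA _ _ _).
- move=> x Vx; have [-> ->] := d_rotate_right Vx; rewrite (patch_dR P Vx).
  exact (rotated_right_normal _ _ (qj_sq R)).
- move=> x Vx; have [-> _] := d_rotate_right Vx.
  by apply: qmul_neq0; [exact (patch_imm P Vx) | exact (sqN1_neq0 (qj_sq R))].
Qed.

Lemma dbar_rotate x : V x -> dbar rotate_normal x = - (qj * dbar Rn x * qj).
Proof.
move=> Vx; have c := @smoothq_cst R V qj.
have s1 := smoothqM oV c sR; have s2 := smoothqM oV s1 c.
rewrite /dbar (dxN s2 Vx) (dyN s2 Vx) (dxM s1 c Vx) (dyM s1 c Vx).
rewrite (dxM c sR Vx) (dyM c sR Vx) dx_cst dy_cst !mulr0 !mul0r !add0r !addr0.
exact (rotated_dbar _ _ _ (qj_sq R)).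
Qed.

Lemma qcoord_rotate x : qcoord 1 (rotate_normal x) = - qcoord 1 (Rn x).
Proof. by rewrite /rotate_normal !qsimp; ring. Qed.

End Propagation.

Section Neighbourhood.
Variable R : realType.
Local Notation plane := (R * R)%type.

Lemma conformal_patch_sub (V V' : set plane) (f N Rn : plane -> quat R) :
  open V' -> V' `<=` V -> conformal_patch V f N Rn -> conformal_patch V' f N Rn.
Proof.
move=> oV' sV [_ sf sN sR NN RR dN dR f0].
by split; [exact oV' | exact: smoothq_sub sV sf | exact: smoothq_sub sV sN
  | exact: smoothq_sub sV sR | move=> x /sV; auto..].
Qed.

Lemma dbar_propagation_generic (V : set plane) (f N Rn : plane -> quat R) x0 :
  conformal_patch V f N Rn -> (forall x, V x -> dbar N x = 0 \/ dbar Rn x = 0) ->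
  V x0 -> qcoord 1 (Rn x0) != 1 ->
  exists2 d : R, 0 < d & forall y, `|y - x0| < d -> (\forall z \near y, dbar N z = 0) ->
    forall x, `|x - x0| < d -> dbar N x = 0.
Proof.
move=> P AB Vx0 R0; have oV := patch_open P; have sR := patch_R P.
pose V' := [set x | V x /\ qcoord 1 (Rn x) != 1].
have oV' : open V'.
  rewrite openE => x [Vx n1]; rewrite /interior /=.
  have cR : qcoord 1 (Rn z) @[z --> x] --> qcoord 1 (Rn x).
    exact: (cvg_comp Rn (qcoord 1) (smoothq_continuous sR Vx) (@continuous_qcoord R 1 _)).
  have n0 : qcoord 1 (Rn x) - 1 != 0 by rewrite subr_eq0.
  have nz : \forall z \near x, qcoord 1 (Rn z) - 1 != 0.
    have c1 : qcoord 1 (Rn z) - 1 @[z --> x] --> qcoord 1 (Rn x) - 1.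
      by apply: cvgB; [exact: cR | exact: cvg_cst].
    exact: cvgr_neq0 c1 n0.
  have nV : nbhs x V by apply: open_nbhs_nbhs; split; [exact: oV | exact: Vx].
  by near=> z; split; [near: z; exact: nV | rewrite -subr_eq0; near: z; exact: nz].
have V'V : V' `<=` V by move=> x [].
have P' := conformal_patch_sub oV' V'V P.
have Rni x : V' x -> qcoord 1 (Rn x) != 1 by case.
have AB' x : V' x -> dbar N x = 0 \/ dbar Rn x = 0 by move=> [Vx _]; exact: AB.
have V'x0 : V' x0 by [].
have [e e0 He] := open_ball_sub oV' V'x0.
pose r := e / 2; have r0 : 0 < r by rewrite divr_gt0.
have er : e = r + r by rewrite /r -splitr.
(* A square of half-width r about any point within r/4 of x0 stays inside V', and
   its inscribed disc contains all points within r/4 of x0. *)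
exists (r / 4); first by rewrite divr_gt0.
move=> y yx A0 x xx.
have xy : `|x - y| < r / 2.
  rewrite (_ : x - y = (x - x0) - (y - x0)); last by rewrite opprB addrA subrK.
  apply: le_lt_trans (ler_normB _ _) _.
  by have -> : r / 2 = r / 4 + r / 4 by [field]; exact: ltrD.
have QV z : `|z - y| <= r -> V' z.
  move=> zy; apply: He; rewrite (_ : z - x0 = (z - y) + (y - x0)); last by rewrite addrA subrK.
  apply: le_lt_trans (ler_normD _ _) _; rewrite er ler_ltD //.
  by apply: lt_trans yx _; rewrite ltr_pdivrMr // ltr_pMr // ltr1n.
apply: (dbar_propagates P' Rni AB' r0 QV A0).
  by apply/ltW/(lt_trans xy); rewrite ltr_pdivrMr // ltr_pMr // ltr1n.
apply: lt_le_trans (sqdist_lt xy) _.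
have : 0 < r * r by rewrite mulr_gt0.
by move: (r) => t; lra.
Unshelve. all: by end_near. Qed.

Lemma dbar_propagation (V : set plane) (f N Rn : plane -> quat R) x0 :
  conformal_patch V f N Rn -> (forall x, V x -> dbar N x = 0 \/ dbar Rn x = 0) ->
  V x0 ->
  exists2 d : R, 0 < d & forall y, `|y - x0| < d -> (\forall z \near y, dbar N z = 0) ->
    forall x, `|x - x0| < d -> dbar N x = 0.
Proof.
move=> P AB Vx0.
have [R1|] := eqVneq (qcoord 1 (Rn x0)) 1; last exact: dbar_propagation_generic P AB Vx0.
apply: (dbar_propagation_generic (conformal_patch_rotate P) _ Vx0).
  move=> x Vx; have [->|B0] := AB x Vx; [by left | right].
  by rewrite (dbar_rotate P Vx) B0 !zeros.
by rewrite qcoord_rotate R1 lt_eqF // ltrN10.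
Qed.

End Neighbourhood.

(** * Charts *)

Section Charts.
Variable R : realType.
Local Notation plane := (R * R)%type.

Definition to_complex (x : plane) : R[i]^o := x.1 +i* x.2.
Definition of_complex (z : R[i]^o) : plane := (complex.Re z, complex.Im z).

Lemma of_complexK : cancel of_complex to_complex.
Proof. by case. Qed.

Lemma to_complexK : cancel to_complex of_complex.
Proof. by case. Qed.

Lemma complex_norm (a b : R) : `|a +i* b : R[i]^o| = (Num.sqrt (a ^+ 2 + b ^+ 2))%:C.
Proof. by rewrite normc_def. Qed.

Lemma norm_complex_le (a b : R) :
  `|a| <= Num.sqrt (a ^+ 2 + b ^+ 2) /\ `|b| <= Num.sqrt (a ^+ 2 + b ^+ 2).
Proof.
by split; rewrite -sqrtr_sqr ler_sqrt ?addr_ge0 ?sqr_ge0 // (lerDl, lerDr) sqr_ge0.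
Qed.

Lemma norm_complex_ge (a b : R) : Num.sqrt (a ^+ 2 + b ^+ 2) <= `|a| + `|b|.
Proof.
rewrite -(ler_pXn2r (n := 2)) ?nnegrE ?sqrtr_ge0 ?addr_ge0 //.
rewrite sqr_sqrtr ?addr_ge0 ?sqr_ge0 // sqrrD !real_normK ?num_real //.
by rewrite lerD2r lerDl mulrn_wge0 // mulr_ge0.
Qed.

Lemma continuous_of_complex : continuous of_complex.
Proof.
move=> z A /(nbhs_ballP (of_complex z)) [e /= e0 He]; apply/nbhs_ballP.
have eC : 0 < e%:C :> R[i] by rewrite ltcR.
exists e%:C => // w; rewrite -ball_normE /= => H; apply: He; move: H.
case: z w => [a b] [c d].
rewrite -[(a +i* b) - (c +i* d)]/((a - c) +i* (b - d)) complex_norm ltcR => H.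
have [h1 h2] := norm_complex_le (a - c) (b - d).
rewrite -ball_normE /= normr_plane /= gt_max (le_lt_trans h1 H).
exact: le_lt_trans h2 H.
Qed.

Lemma continuous_to_complex : continuous to_complex.
Proof.
move=> x A /(nbhs_ballP (to_complex x)) [e /= e0 He]; apply/nbhs_ballP.
have [eR e0'] : e = (complex.Re e)%:C /\ 0 < complex.Re e.
  by case: e e0 {He} => a b; rewrite ltcE /= => /andP[/eqP -> ->].
exists (complex.Re e / 2); first by rewrite /= divr_gt0.
move=> y; rewrite -ball_normE /= normr_plane gt_max => /andP[h1 h2].
apply: He; rewrite -ball_normE /=.
rewrite -[to_complex x - to_complex y]/((x.1 - y.1) +i* (x.2 - y.2)).
rewrite complex_norm eR ltcR; apply: le_lt_trans (norm_complex_ge _ _) _.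
by rewrite [ltRHS]splitr; exact: ltrD.
Qed.

Variable M : riemann_surface R.
Implicit Types (c : chart R M) (p : M).

Lemma coordE c p : coord c p = of_complex (chart_map c p).
Proof. by []. Qed.

Lemma chart_inv_coord c p : chart_dom c p ->
  chart_inv c (to_complex (coord c p)) = p.
Proof. by move=> cp; rewrite coordE of_complexK chart_mapK. Qed.

Lemma in_chart_coord (T : Type) c (F : M -> T) p : chart_dom c p ->
  in_chart c F (coord c p) = F p.
Proof. by move=> cp; rewrite /in_chart -/(to_complex _) chart_inv_coord. Qed.

Lemma coord_continuous_at c p : chart_dom c p -> {for p, continuous (coord c)}.
Proof.
move=> cp; apply: (@continuous_comp _ _ _ (chart_map c) of_complex).
  exact: chart_map_cont.
exact: continuous_of_complex.
Qed.

Lemma inverse_continuous_at c p : chart_dom c p ->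
  {for coord c p, continuous (fun x => chart_inv c (to_complex x))}.
Proof.
move=> cp; apply: (@continuous_comp _ _ _ to_complex (chart_inv c)).
  exact: continuous_to_complex.
by rewrite coordE of_complexK; apply: chart_inv_cont; exists p.
Qed.

Definition chart_range c (U : set M) : set plane := coord c @` (chart_dom c `&` U).

Lemma open_chart_range c (U : set M) : open U -> open (chart_range c U).
Proof.
move=> oU; rewrite openE => _ [p [cp Up] <-]; rewrite /interior /=.
have nU : nbhs (coord c p) [set x | U (chart_inv c (to_complex x))].
  apply: (inverse_continuous_at cp); rewrite /= chart_inv_coord //.
  by apply: open_nbhs_nbhs; split.
have nD : nbhs (coord c p) [set x | (chart_map c @` chart_dom c) (to_complex x)].
  apply: (@continuous_to_complex (coord c p)); rewrite coordE of_complexK.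
  by apply: open_nbhs_nbhs; split; [exact: chart_img_open | exists p].
near=> x.
have [q cq qx] : (chart_map c @` chart_dom c) (to_complex x) by near: x; exact: nD.
have Ux : U (chart_inv c (to_complex x)) by near: x; exact: nU.
exists q; last by rewrite coordE qx to_complexK.
by split=> //; move: Ux; rewrite -qx chart_mapK.
Unshelve. all: by end_near. Qed.

Lemma chart_range_coord c (U : set M) p : chart_dom c p -> U p ->
  chart_range c U (coord c p).
Proof. by move=> cp Up; exists p. Qed.

Lemma smooth_chart c (U : set M) (F : M -> quat R) : atlas c ->
  smooth_on U F -> smoothq (chart_range c U) (in_chart c F).
Proof. by move=> ac sF; exact: sF. Qed.

Section Immersed.
Variables (f N Rn : M -> quat R).
Hypotheses (fi : immersion f) (fN : normal_vectors f N Rn).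

(** The normals are quotients of the partial derivatives of f, hence smooth. *)
Lemma chart_conformal c (U : set M) : open U -> atlas c ->
  conformal_patch (chart_range c U) (in_chart c f) (in_chart c N) (in_chart c Rn).
Proof.
move=> oU ac; have oV := @open_chart_range c U oU.
have [sf imm] := fi; have [sq nv] := fN.
have sfV : smoothq (chart_range c U) (in_chart c f).
  have := smooth_chart ac sf; apply: smoothq_sub => _ [p [cp _] <-].
  exact: chart_range_coord.
have EN x : chart_range c U x -> dy (in_chart c f) x = in_chart c N x * dx (in_chart c f) x.
  move=> [p [cp _] <-]; have [E _] := nv c p (1, 0) ac cp.
  by move: E; rewrite /star_d /dd /Jtan /= oppr0 in_chart_coord // dxE dyE.
have ER x : chart_range c U x -> dy (in_chart c f) x = - (dx (in_chart c f) x * in_chart c Rn x).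
  move=> [p [cp _] <-]; have [_ E] := nv c p (1, 0) ac cp.
  by move: E; rewrite /star_d /dd /Jtan /= oppr0 in_chart_coord // dxE dyE.
have f0 x : chart_range c U x -> dx (in_chart c f) x != 0.
  move=> [p [cp _] <-]; apply/eqP => E.
  have : ((1, 0) : plane) = 0 by apply: (imm c p _ ac cp); move: E; rewrite dxE.
  by case=> /eqP; rewrite oner_eq0.
have sfx := smoothq_dx sfV; have sfy := smoothq_dy sfV.
have sfV' := smoothqV oV f0 sfx.
split.
- exact oV.
- exact sfV.
- apply: (smoothq_ext oV _ (smoothqM oV sfy sfV')) => x Vx.
  by rewrite (EN x Vx) mulrK // qunitE f0.
- apply: (smoothq_ext oV _ (smoothqN oV (smoothqM oV sfV' sfy))) => x Vx.
  by rewrite (ER x Vx) mulrN opprK mulKr // qunitE f0.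
- by move=> _ [p [cp _] <-]; rewrite in_chart_coord //; have [] := sq p.
- by move=> _ [p [cp _] <-]; rewrite in_chart_coord //; have [] := sq p.
- exact EN.
- exact ER.
- exact f0.
Qed.

End Immersed.
End Charts.

(** * Transition maps *)

Section Transitions.
Variable R : realType.
Local Notation plane := (R * R)%type.

Lemma to_complex_line (z u : R[i]^o) (t : R) :
  to_complex (t *: of_complex u + of_complex z) = t%:C * u + z.
Proof.
case: z u => [a b] [c d]; rewrite /to_complex /of_complex /=; apply/eqP.
rewrite eq_complex /=; by rewrite !mul0r subr0 ?addr0 ?add0r !eqxx.
Qed.

Lemma of_complexZ (t : R) (w : R[i]^o) : of_complex (t%:C * w) = t *: of_complex w.
Proof.
case: w => a b; rewrite [RHS]surjective_pairing /of_complex /=.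
by rewrite !mul0r subr0 ?addr0 ?add0r.
Qed.

Lemma of_complexB (z w : R[i]^o) : of_complex (z - w) = of_complex z - of_complex w.
Proof. by case: z w => [a b] [c d]. Qed.

Lemma cvg_complex_line (u : R[i]^o) : u != 0 ->
  (t%:C * u : R[i]^o) @[t --> (0 : R)^'] `=>` (0 : R[i]^o)^'.
Proof.
move=> u0 A /= A0.
have c1 : t *: of_complex u @[t --> (0 : R)] --> (0 : R) *: of_complex u.
  by apply: cvgZ; [exact: cvg_id | exact: cvg_cst].
have c0 := cvg_comp (fun t : R => t *: of_complex u) (@to_complex R) c1
  (@continuous_to_complex R _).
have E t : to_complex (t *: of_complex u) = t%:C * u.
  case: (u) => a b; apply/eqP; rewrite /to_complex /of_complex /=.
  by rewrite eq_complex /= !mul0r subr0 addr0 !eqxx.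
have n : \forall t \near (0 : R), t%:C * u != 0 -> A (t%:C * u).
  have A1 : nbhs (to_complex ((0 : R) *: of_complex u)) [set w | w != 0 -> A w].
    by rewrite scale0r; exact: A0.
  have n1 : \forall t \near (0 : R), to_complex (t *: of_complex u) != 0 ->
      A (to_complex (t *: of_complex u)) by exact: (c0 _ A1).
  by apply: filterS n1 => t H; rewrite -E; exact: H.
rewrite /= /nbhs /=; apply: filterS n => t H t0.
apply: H; rewrite mulf_neq0 //; move: t0; apply: contra_neq => /eqP.
by rewrite eq_complex /= => /andP[/eqP].
Qed.

(** A complex derivative is a real derivative along every direction u, namely
    multiplication by d: restrict the difference quotient to the line of u. *)
Lemma is_derive_complex (tau : R[i]^o -> R[i]^o) (z u d : R[i]^o) : u != 0 ->
  (w^-1 *: (tau (w *: 1 + z) - tau z) @[w --> (0 : R[i]^o)^'] --> d) ->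
  is_derive (of_complex z) (of_complex u)
    (fun x : plane => of_complex (tau (to_complex x))) (of_complex (d * u)).
Proof.
move=> u0 H.
suff C : h^-1 *: (of_complex (tau (to_complex (h *: of_complex u + of_complex z))) -
     of_complex (tau (to_complex (of_complex z)))) @[h --> (0 : R)^'] -->
     of_complex (d * u).
  by split; [apply/cvg_ex; eexists; exact: C | exact: cvg_lim C].
pose G (t : R) : R[i]^o := (t%:C * u)^-1 *: (tau ((t%:C * u) *: 1 + z) - tau z).
have H1 : G t @[t --> (0 : R)^'] --> d.
  exact: (cvg_comp _ _ (cvg_complex_line u0) H).
have H2 : G t * u @[t --> (0 : R)^'] --> d * u.
  by apply: cvgM; [exact: H1 | exact: cvg_cst].
have H3 := cvg_comp _ (@of_complex R) H2 (@continuous_of_complex R _).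
eapply cvg_trans; last exact: H3.
apply: near_eq_cvg; near=> h.
have h0 : h != 0 by near: h; exact: nbhs_dnbhs_neq.
rewrite /= /G to_complex_line of_complexK -of_complexB -of_complexZ.
congr of_complex.
have hC0 : h%:C != 0 :> R[i].
  by move: h0; apply: contra_neq => /eqP; rewrite eq_complex /= => /andP[/eqP].
change ((h%:C * u)^-1 * (tau (h%:C * u * 1 + z) - tau z) * u =
  (h^-1)%:C * (tau (h%:C * u + z) - tau z) :> R[i]).
rewrite mulr1 fmorphV; move: (tau _ - tau z : R[i]) => w.
by field; rewrite hC0 u0.
Unshelve. all: by end_near. Qed.

Variable M : riemann_surface R.
Implicit Types (c e : chart R M) (p : M).

Definition transition c e (x : plane) : plane := coord e (chart_inv c (to_complex x)).

(** Cauchy-Riemann equations of the transition map. *)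
Lemma transition_derivative c e p : atlas c -> atlas e ->
  chart_dom c p -> chart_dom e p ->
  exists a b : R,
    is_derive (coord c p) (1, 0) (transition c e) (a, b) /\
    is_derive (coord c p) (0, 1) (transition c e) (- b, a).
Proof.
move=> ac ae cp ep.
have /(atlas_holomorphic ac ae) D : (chart_map c @` (chart_dom c `&` chart_dom e)) (chart_map c p).
  by exists p.
have [d Hd] := (cvg_ex _).1 D.
exists (complex.Re d), (complex.Im d).
have n1 : (1 : R[i]^o) != 0 by exact: oner_neq0.
have ni : ('i%C : R[i]^o) != 0 by rewrite eq_complex /= oner_eq0 andbF.
pose tau (w : R[i]^o) : R[i]^o := chart_map e (chart_inv c w).
have D1 := @is_derive_complex tau (chart_map c p) 1 d n1 Hd.
have D2 := @is_derive_complex tau (chart_map c p) 'i%C d ni Hd.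
rewrite mulr1 in D1.
have E2 : of_complex (d * 'i%C) = (- complex.Im d, complex.Re d).
  by case: (d) => a b; rewrite /of_complex /=; congr (_, _); ring.
rewrite E2 in D2.
by split; [exact: D1 | exact: D2].
Qed.

Lemma is_derive_at_line (V W : normedModType R) (F : V -> W) (x v : V) (d : W) :
  is_derive (0 : R) (1 : R) (fun t => F (x + t *: v)) d -> is_derive x v F d.
Proof.
have E : (fun h => h^-1 *: (((fun s => F (x + s *: v)) \o shift (0 : R)) (h *: 1)
     - F (x + 0 *: v))) = (fun h => h^-1 *: ((F \o shift x) (h *: v) - F x)).
  apply: funext => h /=; rewrite scale0r addr0 addr0 [h *: 1]mulr1.
  by rewrite [x + _]addrC.
by case; rewrite /derivable /derive E => dF <-; split.
Qed.

Lemma is_derive_chain (V : set plane) (F : plane -> quat R) (phi : plane -> plane)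
    (x v w : plane) : open V -> smoothq V F -> V (phi x) ->
  is_derive x v phi w ->
  is_derive x v (F \o phi) (w.1 *: dx F (phi x) + w.2 *: dy F (phi x)).
Proof.
move=> oV sF Vx D.
have [_ Ew] := derive_partials oV sF Vx w.
have D0 : is_derive (0 : R) (1 : R) (fun t => phi (x + t *: v)) w.
  by apply: is_derive_line; rewrite scale0r addr0.
apply: is_derive_at_line.
pose g (t : R) : plane := phi (x + t *: v).
have g0 : g 0 = phi x by rewrite /g scale0r addr0.
have df : differentiable g (0 : R) by apply/derivable1_diffP; case: D0.
have dF : differentiable F (g 0).
  by rewrite g0; exact (smoothq_differentiable oV sF Vx).
have dc := differentiable_comp df dF.
have E : 'D_1 (F \o g) (0 : R) = 'D_w F (g 0).
  have [_ D0E] := D0.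
  have E1 : 'D_1 (F \o g) (0 : R) = 'd (F \o g) (0 : R) 1 by exact: deriveE.
  have E2 : 'd (F \o g) (0 : R) 1 = 'd F (g 0) ('d g (0 : R) 1).
    by rewrite (diff_comp df dF).
  have E3 : 'D_1 g (0 : R) = 'd g (0 : R) 1 by exact: deriveE.
  have E4 : 'D_w F (g 0) = 'd F (g 0) w by exact: deriveE.
  rewrite E1 E2 E4; exact (congr1 ('d F (g 0)) (etrans (esym E3) D0E)).
split; first exact: diff_derivable dc.
by apply: (etrans E); rewrite g0; exact: Ew.
Qed.

End Transitions.

(** * The global alternative *)

Section Globalisation.
Variables (R : realType) (M : riemann_surface R).
Local Notation plane := (R * R)%type.
Implicit Types (c e : chart R M) (p q : M).

Definition hol_at c (F : M -> quat R) p : Prop := dbar (in_chart c F) (coord c p) = 0.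

Lemma near_chart c p : chart_dom c p -> \forall q \near p, chart_dom c q.
Proof. by move=> cp; apply: open_nbhs_nbhs; split => //; exact: chart_dom_open. Qed.

Lemma in_chart_transition c e (F : M -> quat R) p : chart_dom c p -> chart_dom e p ->
  \forall x \near coord c p, in_chart c F x = (in_chart e F \o transition c e) x.
Proof.
move=> cp ep; have n : nbhs (coord c p) [set x | chart_dom e (chart_inv c (to_complex x))].
  by apply: (inverse_continuous_at cp); rewrite /= chart_inv_coord //; exact: near_chart.
by apply: filterS n => x ex; rewrite /= /transition in_chart_coord.
Qed.

(** By the Cauchy-Riemann equations the new partial derivatives are a rotation and
    scaling of the old ones, and dbar F = 0 is invariant under it as F^2 = -1. *)
Lemma hol_at_change c e (F : M -> quat R) p : atlas c -> atlas e ->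
  smoothq (chart_range e setT) (in_chart e F) -> F p * F p = -1 ->
  chart_dom c p -> chart_dom e p -> hol_at e F p -> hol_at c F p.
Proof.
move=> ac ae sF FF cp ep; have oV := @open_chart_range _ _ e setT openT.
have near_F := in_chart_transition F cp ep.
have [a [b [D1 D2]]] := transition_derivative ac ae cp ep.
have Et : transition c e (coord c p) = coord e p by rewrite /transition chart_inv_coord.
have Vt : chart_range e setT (transition c e (coord c p)).
  by rewrite Et; exact: chart_range_coord.
have [_ C1] := is_derive_chain oV sF Vt D1; have [_ C2] := is_derive_chain oV sF Vt D2.
have X1 : dx (in_chart c F) (coord c p) = a *: dx (in_chart e F) (coord e p) +
    b *: dy (in_chart e F) (coord e p).
  by rewrite dxE (near_eq_derive _ near_F) C1 Et.
have X2 : dy (in_chart c F) (coord c p) = - b *: dx (in_chart e F) (coord e p) +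
    a *: dy (in_chart e F) (coord e p).
  by rewrite dyE (near_eq_derive _ near_F) C2 Et.
rewrite /hol_at /dbar X1 X2 (in_chart_coord F ep) (in_chart_coord F cp) => E.
have {E} -> : dy (in_chart e F) (coord e p) = F p * dx (in_chart e F) (coord e p).
  exact: subr0_eq.
move: (dx (in_chart e F) (coord e p)) => X.
rewrite mulrDr -!scalerAr mulrA FF mulN1r scalerN scaleNr.
by apply/eqP; rewrite subr_eq0 addrC.
Qed.

Variables (f N Rn : M -> quat R).
Hypotheses (fi : immersion f) (fN : normal_vectors f N Rn).

Let patch c (ac : atlas c) := @chart_conformal R M f N Rn fi fN c setT openT ac.

Lemma left_change c e p : atlas c -> atlas e -> chart_dom c p -> chart_dom e p ->
  hol_at e N p -> hol_at c N p.
Proof.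
move=> ac ae; apply: (hol_at_change ac ae); first exact: patch_N (patch ae).
by have [sq _] := fN; have [] := sq p.
Qed.

Definition left_hol p : Prop := forall c, atlas c -> chart_dom c p -> hol_at c N p.
Definition right_hol_at p : Prop := forall c, atlas c -> chart_dom c p -> hol_at c Rn p.

Definition left_interior : set M := [set p | \forall q \near p, left_hol q].

Lemma open_left_interior : open left_interior.
Proof. by rewrite openE => p; exact: nbhs_interior. Qed.

Hypothesis AB : forall c p, atlas c -> chart_dom c p -> hol_at c N p \/ hol_at c Rn p.

Lemma near_coord_of_near c q (S : set M) : chart_dom c q -> (\forall p \near q, S p) ->
  \forall x \near coord c q, exists p, [/\ chart_dom c p, S p & coord c p = x].
Proof.
move=> cq nS; have oV := @open_chart_range _ _ c setT openT.
have nV : nbhs (coord c q) (chart_range c setT).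
  by apply: open_nbhs_nbhs; split; [exact: oV | exact: chart_range_coord].
have nI : nbhs (coord c q) [set x | S (chart_inv c (to_complex x))].
  by apply: (inverse_continuous_at cq); rewrite /= chart_inv_coord.
near=> x; have [p [cp _] px] : chart_range c setT x by near: x; exact: nV.
exists p; split=> //; rewrite -(chart_inv_coord cp) px; near: x; exact: nI.
Unshelve. all: by end_near. Qed.

Lemma near_of_near_coord c q (T : set plane) : chart_dom c q ->
  (\forall x \near coord c q, T x) ->
  \forall p \near q, chart_dom c p /\ T (coord c p).
Proof.
move=> cq nT; have n : \forall p \near q, T (coord c p) by exact: coord_continuous_at cq _ nT.
have nc := near_chart cq.
by near=> p; split; near: p; [exact: nc | exact: n].
Unshelve. all: by end_near. Qed.

(** This is where the local propagation enters: a limit point has a neighbourhood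
    of uniform size in which dbar N spreads its zeros. *)
Lemma closed_left_interior : closed left_interior.
Proof.
move=> p clp; have [c ac cp] := atlas_cover p.
have P := patch ac; have Vp : chart_range c setT (coord c p) by exact: chart_range_coord.
have ABc x : chart_range c setT x ->
    dbar (in_chart c N) x = 0 \/ dbar (in_chart c Rn) x = 0.
  by move=> [q [cq _] <-]; exact: AB.
have [d d0 Hd] := dbar_propagation P ABc Vp.
have nd : \forall x \near coord c p, `|x - coord c p| < d.
  apply/nbhs_ballP; exists d => // x; rewrite -ball_normE /= distrC; exact.
have nB := near_of_near_coord cp nd.
have [q [Zq [cq dq]]] := clp _ nB.
have ny : \forall x \near coord c q, dbar (in_chart c N) x = 0.
  apply: filterS (near_coord_of_near cq Zq) => x [r [cr Hr <-]].
  exact: Hr c ac cr.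
have all0 := Hd _ dq ny.
apply: filterS nB => r [cr dr] e ae er.
exact: left_change ae ac er cr (all0 _ dr).
Qed.

(** By connectedness the interior of the zero set of dbar N is everything or empty;
    in the second case dbar R vanishes on a dense set. *)
Lemma hol_dichotomy : (forall p, left_hol p) \/ (forall p, right_hol_at p).
Proof.
have [Z1|Z0] := pselect (left_interior !=set0); [left | right].
  have E : left_interior = [set: M].
    apply: (surface_connected Z1).
      by exists left_interior; [exact: open_left_interior | rewrite setTI].
    by exists left_interior; [exact: closed_left_interior | rewrite setTI].
  by move=> p; have : left_interior p by [rewrite E]; exact: nbhs_singleton.
move=> p c ac cp; apply/eqP; apply: contrapT => /negP n0; apply: Z0; exists p.
have P := patch ac; have oV := patch_open P.
have Vp : chart_range c setT (coord c p) by exact: chart_range_coord.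
have cd := smoothq_continuous (smoothq_dbar oV (patch_R P)) Vp.
have nz : \forall x \near coord c p, dbar (in_chart c Rn) x != 0.
  exact: cvgr_neq0 cd n0.
apply: filterS (near_of_near_coord cp nz) => q [cq /eqP nq] e ae eq.
apply: (left_change ae ac eq cq).
by have [|E] := AB ac cq.
Qed.

End Globalisation.

(** * Eigenlines of R *)

Section PairMaps.
Variable R : realType.
Local Notation plane := (R * R)%type.
Implicit Types (V : set plane) (F G : plane -> quat R).

Lemma is_derive_pair F G (x v : plane) dF dG : is_derive x v F dF ->
  is_derive x v G dG -> is_derive x v (fun y => (F y, G y)) (dF, dG).
Proof.
move=> [dvF <-] [dvG <-].
suff D : h^-1 *: ((F (h *: v + x), G (h *: v + x)) - (F x, G x)) @[h --> (0 : R)^']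
    --> ('D_v F x, 'D_v G x).
  by split; [apply/cvg_ex; eexists; exact: D | exact: cvg_lim D].
exact: (@cvg_pair _ _ _ _ (nbhs ('D_v F x)) (nbhs ('D_v G x)) _ _ _ _ _ dvF dvG).
Qed.

Lemma Ck_pair k V F G : open V -> Ck_on k V F -> Ck_on k V G ->
  Ck_on k V (fun x => (F x, G x)).
Proof.
move=> oV; elim: k F G => [|k IH] F G [cF dF] [cG dG].
all: have cFG x : V x -> {for x, continuous (fun x => (F x, G x))}
  by move=> Vx; exact: (@cvg_pair _ _ _ _ (nbhs (F x)) (nbhs (G x)) _ _ _ _ _
    (cF x Vx) (cG x Vx)).
all: split=> //.
case: dF => dF [d1 d2]; case: dG => dG [d3 d4].
have D v x : derivable F x v -> derivable G x v ->
    is_derive x v (fun x => (F x, G x)) ('D_v F x, 'D_v G x).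
  by move=> /derivableP ? /derivableP ?; exact: is_derive_pair.
split.
  move=> x Vx; have [e1 e2] := dF x Vx; have [e3 e4] := dG x Vx.
  by split; [have [] := D _ _ e1 e3 | have [] := D _ _ e2 e4].
split; [apply: (Ck_ext oV _ (IH _ _ d1 d3))|apply: (Ck_ext oV _ (IH _ _ d2 d4))];
  move=> x Vx; have [e1 e2] := dF x Vx; have [e3 e4] := dG x Vx.
  by have [_ E] := D _ _ e1 e3; exact: esym E.
by have [_ E] := D _ _ e2 e4; exact: esym E.
Qed.

Lemma smoothq_fst V (F : plane -> quat2 R) : open V -> smooth_plane_on V F ->
  smoothq V (fun x => (F x).1).
Proof.
move=> oV sF k; apply: (@Ck_linear _ _ _ (fst : {linear quat2 R -> quat R})) => //.
by move=> p; exact: cvg_fst.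
Qed.

Lemma smoothq_snd V (F : plane -> quat2 R) : open V -> smooth_plane_on V F ->
  smoothq V (fun x => (F x).2).
Proof.
move=> oV sF k; apply: (@Ck_linear _ _ _ (snd : {linear quat2 R -> quat R})) => //.
by move=> p; exact: cvg_snd.
Qed.

End PairMaps.

Section EigenlineBundle.
Variables (R : realType).
Implicit Types (Rn h w i j : quat R).

Lemma eigen_scale Rn h z : is_cx z -> Rn * h = - (h * qi) ->
  Rn * (h * z) = - (h * z * qi).
Proof. by move=> cz Rh; rewrite mulrA Rh mulNr -!mulrA cz. Qed.

Lemma eigen_of_seed Rn u : Rn * Rn = -1 ->
  Rn * (u + Rn * u * qi) = - ((u + Rn * u * qi) * qi).
Proof.
move=> RR; have e1 := move_left_opp RR; have e2 := move_left_opp (qi_sq R).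
apply: (eq_from_diff (d := (Rn * Rn + 1) * u * qi + Rn * u * (qi * qi + 1))).
  by move: (@qi R) => i; ncring.
by rewrite e1 e2 !zeros.
Qed.

Lemma eigen_swap Rn h i j : Rn * Rn = -1 -> i * i = -1 -> j * i = - (i * j) ->
  Rn * ((h - Rn * h * i) * - j) = - ((h - Rn * h * i) * - j * i).
Proof.
move=> RR ii ji; have e1 := move_left_opp RR; have e2 := move_left_opp ii.
have e3 := move_left_opp ji.
apply: (eq_from_diff (d := - h * (j * i + i * j) + (Rn * Rn + 1) * h * i * j
  - Rn * h * (i * i + 1) * j + Rn * h * i * (j * i + i * j))); first by ncring.
by rewrite e1 e2 e3 !zeros.
Qed.

(** The eigenprojections of v |-> R v i, an involution; right multiplication by j
    exchanges its eigenspaces. *)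
Lemma eigen_split Rn h : Rn * Rn = -1 -> exists h1 h2,
  [/\ Rn * h1 = - (h1 * qi), Rn * h2 = - (h2 * qi) & h = h1 + h2 * qj].
Proof.
move=> RR; pose p := h + Rn * h * qi; pose q := h - Rn * h * qi.
have Rp : Rn * p = - (p * qi) := eigen_of_seed h RR.
have Rq : Rn * (q * - qj) = - (q * - qj * qi) := eigen_swap h RR (qi_sq R) (qj_qi R).
exists (2^-1 *: p), (2^-1 *: (q * - qj)); split.
- by rewrite -scalerAr Rp scalerN scalerAl.
- by rewrite -scalerAr Rq scalerN scalerAl.
rewrite -scalerAl -scalerDr -mulrA mulNr qj_sq opprK mulr1.
rewrite /p /q addrACA addrN addr0.
by apply: quatP; rewrite !qsimp; field.
Qed.

(** The projection to the eigenline is nonzero, and by continuity its value at a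
    fixed u spans the eigenlines of all nearby R. *)
Lemma eigen_seed Rn : Rn * Rn = -1 -> exists u,
  u + Rn * u * qi != 0.
Proof.
move=> RR; have [n1|] := eqVneq (1 + Rn * 1 * qi) 0; last by exists 1.
exists qj; apply/eqP => n2.
have E : Rn = qi.
  have e2 := move_left_opp (qi_sq R).
  apply: (eq_from_diff (d := - (1 + Rn * 1 * qi) * qi + Rn * (qi * qi + 1))).
    by move: (@qi R) => i; ncring.
  by rewrite n1 e2 !zeros.
move: n2; rewrite E => /(congr1 (qcoord 2)); rewrite !qsimp.
by lra.
Qed.

End EigenlineBundle.

(** * Twistor projections of holomorphic curves *)

Lemma star_minus_right_i (R : realType) (a b : quat R) (v : R * R) :
  (Jtan v).1 *: a + (Jtan v).2 *: b - (v.1 *: a + v.2 *: b) * qi =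
  v.1 *: (b - a * qi) - v.2 *: ((b - a * qi) * qi).
Proof. by apply: quatP; rewrite /Jtan !qsimp /=; ring. Qed.

Lemma eigen_real_combination (R : realType) (r w : quat R) (s t : R) :
  r * w = - (w * qi) ->
  r * (s *: w - t *: (w * qi)) = - ((s *: w - t *: (w * qi)) * qi).
Proof.
move=> E; rewrite mulrBr -!scalerAr mulrA E mulNr mulrBl !scalerN opprB opprK.
by rewrite -!scalerAl addrC.
Qed.

Section TwistorProjection.
Variables (R : realType) (M : riemann_surface R).
Local Notation plane := (R * R)%type.
Implicit Types (c e : chart R M) (p q : M).
Variables (f N Rn : M -> quat R).
Hypotheses (fi : immersion f) (fN : normal_vectors f N Rn).

Let patch c U (oU : open U) (ac : atlas c) := @chart_conformal R M f N Rn fi fN c U oU ac.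
Let RR p : Rn p * Rn p = -1. Proof. by have [sq _] := fN; have [] := sq p. Qed.

(** J is right multiplication by i on E and by - R on the fibre, so a vector
    (f, 1) h of E has R h = - h i. *)
Lemma twistor_section (E : M -> set (quat2 R)) q v :
  twistor_projection E (line_bundle f) (line_complex_structure f Rn) ->
  E q 0 -> E q v -> v.1 = f q * v.2 /\ Rn q * v.2 = - (v.2 * qi).
Proof.
move=> tw E0 Ev; have [EL _ _ Ji _] := tw q.
have : line_bundle f q v.
  rewrite EL; exists v => //; exists 0 => //.
  by rewrite (_ : rscale 0 qj = 0) ?addr0 // /rscale !mul0r.
case=> h _ Evh.
have J := Ji v Ev; split.
  by rewrite -Evh /rscale /= mul1r.
have /= := congr1 snd J; rewrite mul1r mulNr => <-.
exact: esym (opprK _).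
Qed.

Lemma in_chart_pair c (F : M -> quat2 R) : in_chart c F =
  (fun x => (in_chart c (fun p => (F p).1) x, in_chart c (fun p => (F p).2) x)).
Proof. by apply: funext => x; rewrite /in_chart; case: (F _). Qed.

Lemma dd_pair c (U : set M) (F : M -> quat2 R) p v : open U -> atlas c ->
  smooth_on U F -> chart_dom c p -> U p ->
  dd c F p v = (dd c (fun q => (F q).1) p v, dd c (fun q => (F q).2) p v).
Proof.
move=> oU ac sF cp Up; have oV := @open_chart_range _ _ c U oU.
have s1 := smoothq_fst oV (sF c ac); have s2 := smoothq_snd oV (sF c ac).
have Vp := chart_range_coord cp Up.
have [_ E1] := derive_partials oV s1 Vp v; have [_ E2] := derive_partials oV s2 Vp v.
have D1 := derive_partials oV s1 Vp v; have D2 := derive_partials oV s2 Vp v.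
rewrite /dd in_chart_pair; have [_ ->] := is_derive_pair D1 D2.
by rewrite E1 E2.
Qed.

(** The holomorphic curve is a smooth family of eigenlines of R, and its spanning
    section h has dbar h in the eigenline; by [eigen_section_dbar], dbar R kills h. *)
Lemma right_hol_of_twistor (E : M -> set (quat2 R)) : holomorphic_curve E ->
  twistor_projection E (line_bundle f) (line_complex_structure f Rn) ->
  forall p, right_hol_at Rn p.
Proof.
move=> [subE holE] tw p c ac cp.
have [U [psi [oU Up spsi HU]]] := subE p.
have E0 q : U q -> E q 0.
  move=> Uq; have [_ ->] := HU q Uq; exists 0 => //.
  rewrite /rscale [RHS]surjective_pairing /=.
  have -> : quat_of_complex (0 : R[i]) = 0 by apply: quatP; rewrite !qsimp.
  by rewrite !mulr0.
have Epsi q : U q -> E q (psi q).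
  move=> Uq; have [_ ->] := HU q Uq; exists 1 => //.
  rewrite /rscale [RHS]surjective_pairing /=.
  have -> : quat_of_complex (1 : R[i]) = 1 by apply: quatP; rewrite !qsimp.
  by rewrite !mulr1.
have Hpsi q : U q -> (psi q).1 = f q * (psi q).2 /\ Rn q * (psi q).2 = - ((psi q).2 * qi).
  by move=> Uq; exact: twistor_section tw (E0 q Uq) (Epsi q Uq).
have oV := @open_chart_range _ _ c U oU.
have P := patch oU ac.
have Vp := chart_range_coord cp Up.
have sh := smoothq_snd oV (spsi c ac).
pose h (x : plane) := (in_chart c psi x).2.
have Rh x : chart_range c U x -> in_chart c Rn x * h x = - (h x * qi).
  by move=> [q [cq Uq] <-]; rewrite /h !in_chart_coord //; have [] := Hpsi q Uq.
have K := eigen_section_dbar oV (patch_R P) sh (patch_RR P) Rh Vp.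
have spsii : smooth_on U (fun q => rscale (psi q) qi).
  move=> e ae k; have oVe := @open_chart_range _ _ e U oU.
  have s1 := smoothq_fst oVe (spsi e ae); have s2 := smoothq_snd oVe (spsi e ae).
  have ci := @smoothq_cst R (chart_range e U) qi.
  exact: (Ck_pair oVe (smoothqM oVe s1 ci k) (smoothqM oVe s2 ci k)).
have Hw := holE U psi oU spsi Epsi c p (1, 0) ac cp Up.
have [_ Rw] := twistor_section tw (E0 p Up) Hw.
have Ew : (star_d c psi p (1, 0) - dd c (fun q => rscale (psi q) qi) p (1, 0)).2 =
    dy h (coord c p) - dx h (coord c p) * qi.
  rewrite /star_d (dd_pair (Jtan (1, 0)) oU ac spsi cp Up) /=.
  rewrite (dd_pair (1, 0) oU ac spsii cp Up) /=.
  have ci := @smoothq_cst R (chart_range c U) qi.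
  have E1 : dd c (fun q => (psi q).2) p (Jtan (1, 0)) = dy h (coord c p).
    by rewrite dyE /dd /Jtan /= oppr0.
  have E2 : dd c (fun q => (psi q).2 * qi) p (1, 0) = dx h (coord c p) * qi.
    have -> : dd c (fun q => (psi q).2 * qi) p (1, 0) =
      dx (fun x => h x * qi) (coord c p) by rewrite dxE.
    by rewrite (dxM sh ci Vp) dx_cst mulr0 addr0.
  by rewrite E1 E2.
rewrite Ew in Rw; rewrite (in_chart_coord Rn cp) Rw addNr in K.
have h0 : h (coord c p) != 0.
  rewrite /h in_chart_coord //; have [psi0 _] := HU p Up; apply: contra_neq psi0 => h0.
  have [E1 _] := Hpsi p Up; rewrite h0 mulr0 in E1.
  by rewrite [LHS]surjective_pairing E1 h0.
have D0 : dbar (in_chart c Rn) (coord c p) * h (coord c p) = 0.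
  by apply/eqP; rewrite -oppr_eq0; apply/eqP; exact: esym K.
by case: (qmul_eq0 D0) => // /eqP; rewrite (negbTE h0).
Qed.

(** The only candidate for the holomorphic curve over the line bundle of f. *)
Definition eigen_bundle p : set (quat2 R) :=
  [set rscale (f p, 1) h | h in [set h | Rn p * h = - (h * qi)]].

Lemma eigen_bundleP p (v : quat2 R) : eigen_bundle p v <->
  v.1 = f p * v.2 /\ Rn p * v.2 = - (v.2 * qi).
Proof.
split=> [[h /= Rh <-]|[E1 E2]]; first by rewrite /= mul1r.
by exists v.2 => //; rewrite /rscale /= mul1r -E1 -surjective_pairing.
Qed.

Lemma continuous_normal p : {for p, continuous Rn}.
Proof.
have [c ac cp] := atlas_cover p.
have P := patch openT ac.
have Vp : chart_range c setT (coord c p) by exact: chart_range_coord.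
have cR := smoothq_continuous (patch_R P) Vp.
have cc := cvg_comp (coord c) (in_chart c Rn) (coord_continuous_at cp) cR.
change (Rn q @[q --> p] --> Rn p); rewrite -(in_chart_coord Rn cp).
have n : \forall q \near p, (in_chart c Rn \o coord c) q = Rn q.
  by apply: filterS (near_chart cp) => q cq; rewrite /= in_chart_coord.
exact: (cvg_trans (near_eq_cvg n) cc).
Qed.

Lemma eigen_bundle_subbundle : complex_line_subbundle eigen_bundle.
Proof.
move=> p; have [u u0] := eigen_seed (RR p).
pose h q := u + Rn q * u * qi.
pose U := [set q | h q != 0].
have ch q : {for q, continuous h}.
  apply: cvgD; first exact: cvg_cst.
  by apply: cvg_qmul; [apply: cvg_qmul; [exact: continuous_normal | exact: cvg_cst]
    | exact: cvg_cst].
have oU : open U.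
  by rewrite openE => q hq; rewrite /interior /=; exact: cvgr_neq0 (ch q) hq.
exists U, (fun q => (f q * h q, h q)); split => //.
  move=> c ac k; have P := patch oU ac; have oV := patch_open P.
  have cst a := @smoothq_cst R (chart_range c U) a.
  have sh := smoothqD oV (cst u) (smoothqM oV (smoothqM oV (patch_R P) (cst u)) (cst qi)).
  exact: (Ck_pair oV (smoothqM oV (patch_f P) sh k) (sh k)).
move=> q hq; have Rh := eigen_of_seed u (RR q); split.
  by apply: contra_neq hq => /(congr1 snd).
apply/seteqP; split=> [v /eigen_bundleP [E1 E2]|_ [z _ <-]].
  have cz := eigenline hq Rh E2.
  have Ev : v.2 = h q * ((h q)^-1 * v.2) by rewrite mulVKr ?qunitE.
  exists (qcoord 0 ((h q)^-1 * v.2) +i* qcoord 1 ((h q)^-1 * v.2)) => //.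
  rewrite /rscale /= -(is_cxE cz) -mulrA -Ev -E1.
  exact: esym (surjective_pairing _).
apply/eigen_bundleP; rewrite /rscale /= mulrA; split=> //.
exact: eigen_scale (cx_quat_of_complex z) Rh.
Qed.

(** For a section (f h, h), both conditions on * d - d i concern h: the first
    component is f times the second, as * df = - df R and R h = - h i. *)
Lemma eigen_bundle_holomorphic : (forall p, right_hol_at Rn p) ->
  holomorphic_curve eigen_bundle.
Proof.
move=> hol; split; first exact: eigen_bundle_subbundle.
move=> U phi oU sphi Ephi c p v ac cp Up.
have P := patch oU ac; have oV := patch_open P.
have Vp := chart_range_coord cp Up.
have s1 := smoothq_fst oV (sphi c ac); have s2 := smoothq_snd oV (sphi c ac).
pose h (x : plane) := (in_chart c phi x).2.
have Rh x : chart_range c U x -> in_chart c Rn x * h x = - (h x * qi).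
  move=> [q [cq Uq] <-]; rewrite /h !in_chart_coord //.
  by have /eigen_bundleP[] := Ephi q Uq.
have F1 x : chart_range c U x -> (in_chart c phi x).1 = in_chart c f x * h x.
  move=> [q [cq Uq] <-]; rewrite /h !in_chart_coord //.
  by have /eigen_bundleP[] := Ephi q Uq.
have K := eigen_section_dbar oV (patch_R P) s2 (patch_RR P) Rh Vp.
have B0 : dbar (in_chart c Rn) (coord c p) = 0 := hol p c ac cp.
rewrite B0 mul0r oppr0 (in_chart_coord Rn cp) in K.
set W := dy _ _ - _ in K.
have sphii : smooth_on U (fun q => rscale (phi q) qi).
  move=> e ae k; have oVe := @open_chart_range _ _ e U oU.
  have t1 := smoothq_fst oVe (sphi e ae); have t2 := smoothq_snd oVe (sphi e ae).
  have ci := @smoothq_cst R (chart_range e U) qi.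
  exact: (Ck_pair oVe (smoothqM oVe t1 ci k) (smoothqM oVe t2 ci k)).
rewrite /star_d (dd_pair _ oU ac sphi cp Up) (dd_pair _ oU ac sphii cp Up) /=.
have Dh u := derive_partials oV s2 Vp u.
have Df u := derive_partials oV (patch_f P) Vp u.
have Di u := is_derive_cst (qi : quat R) (coord c p) u.
have Ef u : dd c f p u =
    u.1 *: dx (in_chart c f) (coord c p) + u.2 *: dy (in_chart c f) (coord c p).
  by have [] := Df u.
have Eh u : dd c (fun q => (phi q).2) p u = u.1 *: dx h (coord c p) + u.2 *: dy h (coord c p).
  by have [] := Dh u.
have Ehi u : dd c (fun q => (phi q).2 * qi) p u = dd c (fun q => (phi q).2) p u * qi.
  have [_ E] := is_derive_qmul (Dh u) (Di u).
  by rewrite Eh; apply: (etrans E); rewrite mulr0 addr0.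
have near_F1 : \forall x \near coord c p, in_chart c f x * h x = (in_chart c phi x).1.
  by apply: (near_open oV _ Vp) => x /F1.
have Ep u : dd c (fun q => (phi q).1) p u =
    dd c f p u * (phi p).2 + f p * dd c (fun q => (phi q).2) p u.
  have [_ E] := is_derive_qmul (Df u) (Dh u).
  have E2 := near_eq_derive u near_F1.
  rewrite Ef Eh; apply: (etrans (esym E2)); apply: (etrans E).
  by rewrite /h !in_chart_coord.
have Epi u : dd c (fun q => (phi q).1 * qi) p u = dd c (fun q => (phi q).1) p u * qi.
  have [_ E] := is_derive_qmul (derive_partials oV s1 Vp u) (Di u).
  have [_ E1] := derive_partials oV s1 Vp u.
  apply: (etrans E); rewrite mulr0 addr0; congr (_ * qi); exact: esym E1.
have /eigen_bundleP [_ Rphi] := Ephi p Up.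
have [_ nv] := fN; have [_ Jf] := nv c p v ac cp.
apply/eigen_bundleP; rewrite /= Ehi Epi; split.
  rewrite !Ep -/(star_d c f p v) Jf; have e := move_left_opp Rphi.
  apply: (eq_from_diff (d := - (dd c f p v * (Rn p * (phi p).2 + (phi p).2 * qi)))).
    move: (dd c (fun q => (phi q).2) p (Jtan v)) (dd c (fun q => (phi q).2) p v).
    move: (dd c f p v) (phi p).2 (Rn p) (f p) (@qi R) => *; ncring.
  by rewrite e !zeros.
have RW : Rn p * W = - (W * qi) by apply: subr0_eq; rewrite opprK K.
have -> : dd c (fun q => (phi q).2) p (Jtan v) - dd c (fun q => (phi q).2) p v * qi =
    v.1 *: W - v.2 *: (W * qi).
  by rewrite !Eh /W; exact: star_minus_right_i.
exact: eigen_real_combination RW.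
Qed.

Lemma eigen_bundle_twistor :
  twistor_projection eigen_bundle (line_bundle f) (line_complex_structure f Rn).
Proof.
move=> p; split.
- apply/seteqP; split=> [_ [h _ <-]|_ [e1 [h1 _ <-] [e2 [h2 _ <-] <-]]].
    have [h1 [h2 [R1 R2 ->]]] := eigen_split h (RR p).
    exists (rscale (f p, 1) h1); first by exists h1.
    exists (rscale (f p, 1) h2); first by exists h2.
    by rewrite /rscale /= mulrDr !mul1r mulrA.
  by exists (h1 + h2 * qj) => //; rewrite /rscale /= mulrDr !mul1r mulrA.
- by move=> v _; exists (- Rn p * v.2).
- move=> v w g h [a _ <-] [b _ <-]; rewrite /line_complex_structure /rscale /=.
  rewrite [RHS]surjective_pairing /= !mul1r.
  by move: (f p) (Rn p) => F r; congr (_, _); ncring.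
- move=> _ [h /= Rh <-]; rewrite /line_complex_structure /rscale /=.
  by rewrite !mul1r mulNr Rh opprK mulrA.
- move=> _ [h /= Rh <-]; rewrite /line_complex_structure /rscale /=.
  rewrite !mul1r mulNr mulrA Rh mulNr opprK.
  have E : h * qi * qj = h * qj * - qi.
    by rewrite mulrN -!mulrA qj_qi mulrN opprK.
  by rewrite E; congr (_, _); rewrite !mulrA.
Qed.

End TwistorProjection.

Section TwistorCharacterisation.
Variables (R : realType) (M : riemann_surface R).

Lemma twistor_projection_iff (f : M -> quat R) : immersion f ->
  is_twistor_projection_of_holomorphic_curve f <->
  exists N Rn, normal_vectors f N Rn /\ forall p, right_hol_at Rn p.
Proof.
move=> fi; split=> [[N [Rn [nv [E [hE tw]]]]]|[N [Rn [nv hol]]]]; exists N, Rn; split=> //.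
  exact (right_hol_of_twistor fi nv hE tw).
exists (eigen_bundle f Rn); split; first exact (eigen_bundle_holomorphic fi nv hol).
exact (eigen_bundle_twistor nv).
Qed.

Lemma dd_qconj (c : chart R M) (f : M -> quat R) p v : atlas c -> chart_dom c p ->
  smooth_on setT f -> dd c (fun q => qconj (f q)) p v = qconj (dd c f p v).
Proof.
move=> ac cp sf; have oV := @open_chart_range _ _ c setT openT.
have D := derive_partials oV (sf c ac) (chart_range_coord cp I) v.
have [_ E] := @is_derive_linear R _ _ _ (@qconj R : {linear quat R -> quat R}) (in_chart c f)
  _ _ _ (@continuous_qconj R) D.
by apply: (etrans E); have [_ E2] := D; congr qconj; exact: esym E2.
Qed.

Lemma qconjK : involutive (@qconj R).
Proof. by move=> q; apply: quatP; rewrite !qsimp; ring. Qed.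

Lemma qconjM (p q : quat R) : qconj (p * q) = qconj q * qconj p.
Proof. by apply: quatP; rewrite !qsimp; ring. Qed.

Lemma smooth_on_qconj (f : M -> quat R) : smooth_on setT f ->
  smooth_on setT (fun q => qconj (f q)).
Proof.
move=> sf c ac k; have oV := @open_chart_range _ _ c setT openT.
exact: (Ck_linear (L := (@qconj R : {linear quat R -> quat R})) oV (@continuous_qconj R)
  (sf c ac k)).
Qed.

Lemma immersion_qconj (f : M -> quat R) : immersion f ->
  immersion (fun q => qconj (f q)).
Proof.
move=> [sf imm]; split; first exact: smooth_on_qconj.
move=> c p v ac cp; rewrite dd_qconj // => E; apply: (imm c p v ac cp).
rewrite -[LHS]qconjK E; apply: quatP; rewrite !qsimp; ring.
Qed.

(** Conjugation reverses products and negates square roots of -1. *)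
Lemma normal_vectors_qconj (f N Rn : M -> quat R) : smooth_on setT f ->
  normal_vectors f N Rn -> normal_vectors (fun q => qconj (f q)) Rn N.
Proof.
move=> sf [sq nv]; split; first by move=> p; have [? ?] := sq p.
move=> c p v ac cp; have [E1 E2] := nv c p v ac cp; have [NN RR] := sq p.
rewrite /star_d !dd_qconj // -/(star_d c f p v); split.
  by rewrite E2 raddfN /= qconjM (sqN1_conj RR) mulNr opprK.
by rewrite E1 qconjM (sqN1_conj NN) mulrN.
Qed.

Lemma conj_twistor_projection_iff (f : M -> quat R) : immersion f ->
  is_twistor_projection_of_holomorphic_curve (fun p => qconj (f p)) <->
  exists N Rn, normal_vectors f N Rn /\ forall p, left_hol N p.
Proof.
move=> fi; have [sf _] := fi; apply: (iff_trans (twistor_projection_iff (immersion_qconj fi))).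
split=> [[Rn [N [nv hol]]]|[N [Rn [nv hol]]]].
  exists N, Rn; split=> //.
  have := normal_vectors_qconj (smooth_on_qconj sf) nv.
  by rewrite (_ : (fun q => qconj (qconj (f q))) = f) //; apply: funext => q; exact: qconjK.
by exists Rn, N; split=> //; exact: normal_vectors_qconj.
Qed.

End TwistorCharacterisation.

(** * Circles in the normal plane *)

Section NormalPlane.
Variable R : realType.
Implicit Types (u t n h k m N S : quat R) (a b c : R).

(** N_x and N_y are tangent to the sphere of square roots of -1 at N, that is, they
    anticommute with N. *)
Lemma anticommuting_dbar N N1 N2 : N * N = -1 -> N1 * N + N * N1 = 0 ->
  N2 * N + N * N2 = 0 -> N * (N2 - N * N1) = - ((N2 - N * N1) * N).
Proof.
move=> NN d1 d2; apply: (eq_from_diff (d := (N2 * N + N * N2) - N * (N1 * N + N * N1))).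
  by ncring.
by rewrite d1 d2 !zeros.
Qed.

Lemma half_angle a b c : 0 <= c -> a ^+ 2 + b ^+ 2 = c ^+ 2 ->
  exists v1 v2 : R, [/\ v1 ^+ 2 + v2 ^+ 2 = c, v1 ^+ 2 - v2 ^+ 2 = a & 2 * (v1 * v2) = b].
Proof.
move=> c0 E; have ac : `|a| <= c.
  by rewrite -(ler_pXn2r (n := 2)) ?nnegrE // real_normK ?num_real // -E lerDl sqr_ge0.
have /andP[ca1 ca2] : - c <= a <= c by rewrite -ler_norml.
have p1 : 0 <= (c + a) / 2 by lra.
have p2 : 0 <= (c - a) / 2 by lra.
have s1 := sqr_sqrtr p1; have s2 := sqr_sqrtr p2.
have s12 : 2 * (Num.sqrt ((c + a) / 2) * Num.sqrt ((c - a) / 2)) = `|b|.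
  rewrite -sqrtrM // (_ : (c + a) / 2 * _ = (b / 2) ^+ 2); last first.
    by rewrite expr_div_n (_ : b ^+ 2 = c ^+ 2 - a ^+ 2); [field | rewrite -E; ring].
  by rewrite sqrtr_sqr normrM (ger0_norm (x := 2^-1)) ?invr_ge0 // mulrCA mulfV ?mulr1 // pnatr_eq0.
have [b0|b0] := leP 0 b.
  exists (Num.sqrt ((c + a) / 2)), (Num.sqrt ((c - a) / 2)); rewrite s1 s2 s12 ger0_norm //.
  by split=> //; field.
exists (Num.sqrt ((c + a) / 2)), (- Num.sqrt ((c - a) / 2)); rewrite sqrrN s1 s2 mulrN mulrN s12.
by rewrite ltr0_norm // opprK; split=> //; field.
Qed.

Lemma intertwinerD N S h n : N * h = h * S -> N * n = n * S ->
  N * (h + n) = (h + n) * S.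
Proof. by move=> Nh Nn; rewrite mulrDr mulrDl Nh Nn. Qed.

Lemma intertwinerZ N S a h : N * h = h * S -> N * (a *: h) = a *: h * S.
Proof. by move=> Nh; rewrite -scalerAr -scalerAl Nh. Qed.

(** Two intertwiners of N and S differ by right multiplication with something that
    commutes with S; so they form a complex line, with N in the role of i. *)
Lemma intertwiner_span N S h n : S * S = -1 -> h != 0 ->
  N * h = h * S -> N * n = n * S -> exists a b, n = a *: h + b *: (N * h).
Proof.
move=> SS h0 Nh Nn; have [a [b E]] : exists a b, h^-1 * n = a *: 1 + b *: S.
  apply: centraliser_span => //; apply: (qmulI h0).
  by rewrite !mulrA -Nh mulrV ?qunitE // mul1r -Nn -!mulrA mulVKr ?qunitE.
exists a, b; rewrite Nh; transitivity (h * (h^-1 * n)); first by rewrite mulVKr ?qunitE.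
by rewrite E mulrDr -!scalerAr mulr1.
Qed.

Lemma qdot_mull_orthogonal N h : N * N = -1 -> qdot h (N * h) = 0.
Proof.
move=> NN; have : qdot (N * h) (N * (N * h)) = qdot h (N * h).
  by rewrite qdotMl (sqN1_unit NN) mul1r.
by rewrite mulrA NN mulN1r qdotNr qdotC; lra.
Qed.

Lemma qdot_rotation a b h N : N * N = -1 ->
  qdot (a *: h + b *: (N * h)) (a *: h + b *: (N * h)) = (a ^+ 2 + b ^+ 2) * qdot h h.
Proof.
move=> NN; rewrite !(qdotDl, qdotDr, qdotZl, qdotZr) (qdotC (N * h) h).
by rewrite (qdot_mull_orthogonal h NN) qdotMl (sqN1_unit NN); ring.
Qed.

(** Both N . and . S are isometries. *)
Lemma intertwiners_orthogonal N S t n : N * N = -1 -> S * S = -1 ->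
  N * t = - (t * S) -> N * n = n * S -> qdot t n = 0.
Proof.
move=> NN SS Nt Nn; have : qdot (N * t) (N * n) = qdot t n.
  by rewrite qdotMl (sqN1_unit NN) mul1r.
by rewrite Nt Nn qdotNl qdotMr (sqN1_unit SS) mul1r; lra.
Qed.

(** The projection to the plane of n with N n = n S along its orthogonal complement,
    the plane of t with N t = - t S. For the left and right normals of a conformal
    immersion these are the normal and the tangent plane. *)
Definition normal_part N S u : quat R := 2^-1 *: (u - N * u * S).

Lemma normal_part_double N S u : normal_part N S u + normal_part N S u = u - N * u * S.
Proof. by rewrite -mulr2n -scaler_nat scalerA mulfV ?scale1r // pnatr_eq0. Qed.

Lemma normal_partD N S u v : normal_part N S (u + v) = normal_part N S u + normal_part N S v.
Proof. by apply: addrr_inj; rewrite addrACA !normal_part_double; ncring. Qed.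

Lemma normal_partN N S u : normal_part N S (- u) = - normal_part N S u.
Proof. by rewrite /normal_part mulrN mulNr -opprD scalerN. Qed.

Lemma normal_partZ N S a u : normal_part N S (a *: u) = a *: normal_part N S u.
Proof. by rewrite /normal_part -scalerAr -scalerAl -scalerBr !scalerA mulrC. Qed.

Lemma normal_part_normal N S u : N * N = -1 -> S * S = -1 ->
  N * normal_part N S u = normal_part N S u * S.
Proof.
move=> NN SS; apply: addrr_inj; rewrite -mulrDr -mulrDl normal_part_double.
have e1 := move_left_opp NN; have e2 := move_left_opp SS.
apply: (eq_from_diff (d := N * u * (S * S + 1) - (N * N + 1) * u * S)); first by ncring.
by rewrite e1 e2 !zeros.
Qed.

Lemma normal_part_tangent N S u : N * N = -1 -> S * S = -1 ->
  N * (u - normal_part N S u) = - ((u - normal_part N S u) * S).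
Proof.
move=> NN SS; apply: addrr_inj; rewrite -opprD -mulrDr -mulrDl addrACA -opprD normal_part_double.
have e1 := move_left_opp NN; have e2 := move_left_opp SS.
apply: (eq_from_diff (d := N * u * (S * S + 1) + (N * N + 1) * u * S)); first by ncring.
by rewrite e1 e2 !zeros.
Qed.

Lemma normal_part_id N S n : S * S = -1 -> N * n = n * S -> normal_part N S n = n.
Proof.
move=> SS Nn; apply: addrr_inj; rewrite normal_part_double Nn -mulrA SS; ncring.
Qed.

Lemma normal_part_mull N S u : N * N = -1 ->
  normal_part N S (N * u) = N * normal_part N S u.
Proof.
by move=> NN; apply: addrr_inj; rewrite -mulrDr !normal_part_double; ncring.
Qed.

Lemma normal_part_mulr N S u : S * S = -1 ->
  normal_part N S (u * S) = normal_part N S u * S.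
Proof.
by move=> SS; apply: addrr_inj; rewrite -mulrDl !normal_part_double; ncring.
Qed.

(** Six angles with rational sine and cosine suffice: equal distances to the centre
    at these force the radii h and k to be orthogonal and of equal length. *)
Lemma circle_conjugate_radii (s r : R) d h k : s != 0 ->
  (forall v1 v2 : R, v1 ^+ 2 + v2 ^+ 2 = 1 ->
    let w := d + s *: ((v1 ^+ 2 - v2 ^+ 2) *: h + (2 * (v1 * v2)) *: k) in
    qdot w w = r) ->
  qdot h k = 0 /\ qdot h h = qdot k k.
Proof.
move=> s0 H.
have X (v1 v2 : R) : v1 ^+ 2 + v2 ^+ 2 = 1 ->
   qdot d d + (v1 ^+ 2 - v2 ^+ 2) * (s * qdot d h) * 2 + (2 * (v1 * v2)) * (s * qdot d k) * 2
   + (v1 ^+ 2 - v2 ^+ 2) ^+ 2 * (s ^+ 2 * qdot h h) + (2 * (v1 * v2)) ^+ 2 * (s ^+ 2 * qdot k k)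
   + 2 * (v1 ^+ 2 - v2 ^+ 2) * (2 * (v1 * v2)) * (s ^+ 2 * qdot h k) = r.
  move=> /H /= <-; rewrite !(qdotDl, qdotDr, qdotZl, qdotZr).
  by rewrite (qdotC h d) (qdotC k d) (qdotC k h); ring.
have s20 : s ^+ 2 != 0 by rewrite sqrf_eq0.
have := X 1 0; have := X 0 1; have := X (3 / 5) (4 / 5); have := X (3 / 5) (- (4 / 5)).
have := X (4 / 5) (3 / 5); have := X (4 / 5) (- (3 / 5)).
move: (qdot d d) (s * qdot d h) (s * qdot d k) => dd dh dk {X H} X1 X2 X3 X4 X5 X6.
have {}X1 := X1 ltac:(by field); have {}X2 := X2 ltac:(by field).
have {}X3 := X3 ltac:(by field); have {}X4 := X4 ltac:(by field).
have {}X5 := X5 ltac:(by field); have {}X6 := X6 ltac:(by field).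
have hk : s ^+ 2 * qdot h k = 0 by lra.
have hh : s ^+ 2 * qdot h h = s ^+ 2 * qdot k k by lra.
split; last exact: mulfI hh.
by move/eqP: hk; rewrite mulf_eq0 (negbTE s20) => /eqP.
Qed.

(** N acts as a rotation by a right angle on the plane of intertwiners. *)
Lemma conjugate_radii_rotation N S h k : N * N = -1 -> S * S = -1 ->
  N * h = h * S -> N * k = k * S -> qdot h k = 0 -> qdot h h = qdot k k ->
  k = N * h \/ k = - (N * h).
Proof.
move=> NN SS Nh Nk hk hh; have [h0|h0] := eqVneq h 0.
  left; rewrite h0 mulr0; apply/eqP; rewrite -qdot_eq0 -hh h0.
  by rewrite qdot_eq0.
have [a [b E]] := intertwiner_span SS h0 Nh Nk.
have q0 : qdot h h != 0 by rewrite qdot_eq0.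
have a0 : a = 0.
  move/eqP: hk; rewrite E qdotDr !qdotZr (qdot_mull_orthogonal h NN) mulr0 addr0.
  by rewrite mulf_eq0 (negbTE q0) orbF => /eqP.
have : b ^+ 2 = 1.
  apply: (mulIf q0); rewrite mul1r {2}hh E a0 scale0r add0r qdotZl qdotZr qdotMl.
  by rewrite (sqN1_unit NN); ring.
rewrite E a0 scale0r add0r => /eqP; rewrite sqrf_eq1 => /orP[]/eqP ->.
  by left; rewrite scale1r.
by right; rewrite scaleN1r.
Qed.

End NormalPlane.

(** * The curvature ellipse *)

Section Superconformal.
Variable R : realType.
Local Notation plane := (R * R)%type.

Lemma second_derivative (V : set plane) (F : plane -> quat R) x v : open V -> smoothq V F -> V x ->
  'D_v ('D_v F) x = v.1 ^+ 2 *: dx (dx F) x + (2 * (v.1 * v.2)) *: dy (dx F) x +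
    v.2 ^+ 2 *: dy (dy F) x.
Proof.
move=> oV sF Vx.
have near_DF : \forall y \near x, 'D_v F y = (v.1 \*: dx F \+ v.2 \*: dy F) y.
  by apply: (near_open oV _ Vx) => y Vy; have [_ E] := derive_partials oV sF Vy v.
have D1 := derive_partials oV (smoothq_dx sF) Vx v.
have D2 := derive_partials oV (smoothq_dy sF) Vx v.
have [_ E] := is_deriveD (is_deriveZ v.1 D1) (is_deriveZ v.2 D2).
apply: etrans (near_eq_derive v near_DF) _; apply: etrans E _.
rewrite (dxdyC oV sF Vx).
move: (dx (dx F) x) (dy (dx F) x) (dy (dy F) x) => a b c.
by apply: quatP; rewrite !qsimp; ring.
Qed.

Section Geometry.
Variables (M : riemann_surface R) (f N Rn : M -> quat R).
Hypotheses (fi : immersion f) (fN : normal_vectors f N Rn).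
Variables (c : chart R M) (p : M).
Hypotheses (ac : atlas c) (cp : chart_dom c p).

Let P := @chart_conformal R M f N Rn fi fN c setT openT ac.
Let oV := patch_open P.
Let Vp : chart_range c setT (coord c p) := chart_range_coord cp I.
Let f1 := dx (in_chart c f) (coord c p).

Lemma normal_sq : N p * N p = -1 /\ Rn p * Rn p = -1.
Proof. by have [sq _] := fN; exact: sq. Qed.

Let NN := proj1 normal_sq.
Let RR := proj2 normal_sq.

Lemma dx_tangent : N p * f1 = - (f1 * Rn p).
Proof.
by have := patch_dN P Vp; rewrite (patch_dR P Vp) !in_chart_coord // => ->.
Qed.

Lemma dx_neq0 : f1 != 0.
Proof. exact (patch_imm P Vp). Qed.

Lemma dd_frame v : dd c f p v = v.1 *: f1 + v.2 *: (N p * f1).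
Proof.
have [_ E] := derive_partials oV (patch_f P) Vp v.
apply: etrans E _; congr (_ + _ *: _).
by rewrite (patch_dN P Vp) in_chart_coord.
Qed.

(** The tangent plane is spanned by f_x and N f_x = - f_x R. *)
Lemma tangentP t : N p * t = - (t * Rn p) <-> exists v, t = dd c f p v.
Proof.
split=> [Nt|[v ->]].
  have SS : - Rn p * - Rn p = -1 by rewrite mulrNN.
  have Nf : N p * f1 = f1 * - Rn p by rewrite mulrN dx_tangent.
  have {}Nt : N p * t = t * - Rn p by rewrite mulrN.
  have [a [b E]] := intertwiner_span SS dx_neq0 Nf Nt.
  by exists (a, b); rewrite dd_frame.
rewrite dd_frame mulrDr mulrDl -!scalerAr -!scalerAl opprD -!scalerN.
congr (_ *: _ + _ *: _); first exact: dx_tangent.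
by rewrite {1}dx_tangent mulrN mulrA.
Qed.

Lemma normal_spaceP n : normal_space c f p n <-> N p * n = n * Rn p.
Proof.
split=> [nn|Nn v]; last first.
  by apply: (intertwiners_orthogonal NN RR) => //; apply/tangentP; exists v.
have Nt := normal_part_tangent n NN RR; have Nn := normal_part_normal n NN RR.
have [v Ev] := (tangentP _).1 Nt.
have : qdot (n - normal_part (N p) (Rn p) n) (n - normal_part (N p) (Rn p) n) = 0.
  rewrite [LHS]qdotDr qdotNr (intertwiners_orthogonal NN RR Nt Nn) Ev.
  by rewrite (nn v) oppr0 addr0.
by move=> /eqP; rewrite qdot_eq0 subr_eq0 => /eqP ->.
Qed.

Lemma normal_componentE u : normal_component c f p u = normal_part (N p) (Rn p) u.
Proof.
rewrite /normal_component; case: xgetP => [n _ [/normal_spaceP Nn [v Ev]]|H].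
  have Nt : N p * (u - n) = - ((u - n) * Rn p) by apply/tangentP; exists v.
  have Nt' := normal_part_tangent u NN RR; have Nn' := normal_part_normal u NN RR.
  set w := normal_part (N p) (Rn p) u in Nt' Nn' *.
  have T : N p * (w - n) = - ((w - n) * Rn p).
    have -> : w - n = (u - n) - (u - w) by ncring.
    by rewrite [LHS]mulrBr Nt Nt' [in RHS]mulrBl opprD.
  have T' : N p * (w - n) = (w - n) * Rn p by rewrite mulrBr Nn Nn' mulrBl.
  have : qdot (w - n) (w - n) = 0 by exact: intertwiners_orthogonal T T'.
  by move=> /eqP; rewrite qdot_eq0 subr_eq0 => /eqP ->.
exfalso; apply: (H (normal_part (N p) (Rn p) u)); split.
  by apply/normal_spaceP; exact: normal_part_normal.
by apply/tangentP; exact: normal_part_tangent.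
Qed.

Let II11 := normal_part (N p) (Rn p) (dx (dx (in_chart c f)) (coord c p)).
Let II12 := normal_part (N p) (Rn p) (dy (dx (in_chart c f)) (coord c p)).
Let II22 := normal_part (N p) (Rn p) (dy (dy (in_chart c f)) (coord c p)).
Let mean : quat R := 2^-1 *: (II11 + II22).
Let h : quat R := 2^-1 *: (II11 - II22).
Let k := II12.

Lemma second_fundamental_formE v : second_fundamental_form c f p v v =
  (v.1 ^+ 2 + v.2 ^+ 2) *: mean + ((v.1 ^+ 2 - v.2 ^+ 2) *: h + (2 * (v.1 * v.2)) *: k).
Proof.
rewrite /second_fundamental_form normal_componentE (second_derivative v oV (patch_f P) Vp).
rewrite !normal_partD !normal_partZ -/II11 -/II12 -/II22 /mean /h /k.
move: (II11) (II12) (II22) => a b d; by apply: quatP; rewrite !qsimp; field.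
Qed.

Lemma unit_vectorE v : qnorm (dd c f p v) = 1 <-> (v.1 ^+ 2 + v.2 ^+ 2) * qdot f1 f1 = 1.
Proof.
have -> : (v.1 ^+ 2 + v.2 ^+ 2) * qdot f1 f1 = qdot (dd c f p v) (dd c f p v).
  by rewrite dd_frame qdot_rotation.
rewrite /qnorm; split=> [E|->]; last exact: sqrtr1.
by rewrite -[LHS]sqr_sqrtr ?qdot_ge0 // E expr1n.
Qed.

Lemma mean_normal : N p * mean = mean * Rn p.
Proof.
rewrite -scalerAr -scalerAl mulrDr mulrDl; congr (_ *: (_ + _)); exact: normal_part_normal.
Qed.

Lemma h_normal : N p * h = h * Rn p.
Proof.
rewrite -scalerAr -scalerAl mulrBr mulrBl; congr (_ *: (_ - _)); exact: normal_part_normal.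
Qed.

Lemma k_normal : N p * k = k * Rn p.
Proof. exact: normal_part_normal. Qed.

Lemma h_double : h + h = II11 - II22.
Proof. by rewrite -mulr2n -scaler_nat scalerA mulfV ?scale1r // pnatr_eq0. Qed.

(** The normal vector dbar N f_x equals - 2 (h + N k), by the second-order identity. *)
Lemma left_dbar_normal : k = N p * h <-> hol_at c N p.
Proof.
have [f12N _ f22N _] := patch_second_order P Vp.
have [dN1 dN2] := d_sqN1 oV (patch_N P) (patch_NN P) Vp.
rewrite !(in_chart_coord _ cp) -/f1 in f12N f22N dN1 dN2.
have := left_dbar_second_order NN f12N f22N.
rewrite /hol_at /dbar (in_chart_coord N cp).
have AN := anticommuting_dbar NN dN1 dN2.
set A := _ - N p * _ in AN * => E.
have Anormal : N p * (A * f1) = A * f1 * Rn p.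
  by rewrite mulrA AN mulNr -!mulrA dx_tangent mulrN opprK.
have {}E : A * f1 = - ((h + N p * k) + (h + N p * k)).
  rewrite -(normal_part_id RR Anormal) E !normal_partD !normal_partN !normal_partD.
  rewrite (normal_part_mull _ _ NN) -/II11 -/II12 -/II22 -/k.
  transitivity (- (II11 - II22) - (N p * k + N p * k)); first by ncring.
  by rewrite -h_double; ncring.
split=> [Nh|A0].
  have {}E : A * f1 = 0 by rewrite E Nh mulrA NN; ncring.
  by case: (qmul_eq0 E) => // f10; have := dx_neq0; rewrite f10 eqxx.
rewrite A0 mul0r in E.
have {}E : h + N p * k = 0 by apply: addrr_inj; rewrite addr0 -[LHS]opprK -E oppr0.
apply: (eq_from_diff (d := (N p * N p + 1) * k - N p * (h + N p * k))); first by ncring.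
by rewrite E (move_left_opp NN) !zeros.
Qed.

(** The normal vector f_x dbar R equals 2 (h - N k), by the second-order identity. *)
Lemma right_dbar_normal : k = - (N p * h) <-> hol_at c Rn p.
Proof.
have [_ f12R _ f22R] := patch_second_order P Vp.
have [dR1 dR2] := d_sqN1 oV (patch_R P) (patch_RR P) Vp.
rewrite !(in_chart_coord _ cp) -/f1 in f12R f22R dR1 dR2.
have := right_dbar_second_order RR dR1 f12R f22R.
rewrite /hol_at /dbar (in_chart_coord Rn cp).
have BR := anticommuting_dbar RR dR1 dR2.
set B := _ - Rn p * _ in BR * => E.
have Bnormal : N p * (f1 * B) = f1 * B * Rn p.
  by rewrite mulrA dx_tangent mulNr -(mulrA f1 (Rn p)) BR mulrN opprK mulrA.
have {}E : f1 * B = (h - N p * k) + (h - N p * k).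
  rewrite -(normal_part_id RR Bnormal) E !normal_partD !normal_partN !normal_partD.
  rewrite (normal_part_mulr _ _ RR) -/II11 -/II12 -/II22 -/k -k_normal.
  transitivity ((II11 - II22) - (N p * k + N p * k)); first by ncring.
  by rewrite -h_double; ncring.
split=> [Nh|B0].
  have {}E : f1 * B = 0.
    have e1 := move_left_opp NN; rewrite E Nh.
    apply: (eq_from_diff (d := (N p * N p + 1) * h + (N p * N p + 1) * h)).
      by ncring.
    by rewrite e1 !zeros.
  by case: (qmul_eq0 E) => // f10; have := dx_neq0; rewrite f10 eqxx.
rewrite B0 mulr0 in E.
have {}E : h - N p * k = 0 by apply: addrr_inj; rewrite addr0.
apply: (eq_from_diff (d := (N p * N p + 1) * k + N p * (h - N p * k))); first by ncring.
by rewrite E (move_left_opp NN) !zeros.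
Qed.

(** The ellipse is m + cos h + sin k, up to scale, with the doubled angle; being a
    circle means k = N h or k = - N h. *)
Lemma circular_ellipse_iff :
  (exists m r, [/\ normal_space c f p m, 0 <= r &
    curvature_ellipse c f p = [set n | normal_space c f p n /\ qnorm (n - m) = r]]) <->
  hol_at c N p \/ hol_at c Rn p.
Proof.
have q0 : 0 < qdot f1 f1 by rewrite lt_def qdot_eq0 dx_neq0 qdot_ge0.
set rho := qdot f1 f1 in q0 *; set s := rho^-1.
have s0 : 0 < s by rewrite invr_gt0.
split=> [[m [r [_ _ E]]]|H].
  have [v1 v2|hk hh] := @circle_conjugate_radii R s (r ^+ 2) (s *: mean - m) h k (lt0r_neq0 s0).
    (* A tangent vector of Euclidean length t in the chart has unit length. *)
    move=> v12 w; pose t := Num.sqrt s.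
    have tt : t ^+ 2 = s by rewrite sqr_sqrtr // ltW.
    have : curvature_ellipse c f p
        (second_fundamental_form c f p (t * v1, t * v2) (t * v1, t * v2)).
      exists (t * v1, t * v2) => //=; apply/unit_vectorE => /=.
      by rewrite !exprMn tt -mulrDr v12 mulr1 mulVf // gt_eqF.
    rewrite E => -[_ <-]; rewrite sqr_sqrtr ?qdot_ge0 //.
    have -> : second_fundamental_form c f p (t * v1, t * v2) (t * v1, t * v2) - m = w.
      rewrite second_fundamental_formE /= /w !exprMn tt -mulrDr v12 mulr1.
      have -> : t * v1 * (t * v2) = s * (v1 * v2) by rewrite -tt; ring.
      move: (mean) (h) (k) => a b d; by apply: quatP; rewrite !qsimp; ring.
    by [].
  have [Nh|Nh] := conjugate_radii_rotation NN RR h_normal k_normal hk hh.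
    by left; apply/left_dbar_normal.
  by right; apply/right_dbar_normal.
have [e ee kE] : exists2 e : R, e ^+ 2 = 1 & k = e *: (N p * h).
  case: H => [/left_dbar_normal|/right_dbar_normal] ->; [exists 1 | exists (-1)].
  - by rewrite expr1n.
  - by rewrite scale1r.
  - by rewrite sqrrN expr1n.
  - by rewrite scaleN1r.
have normE a b := qdot_rotation a b h NN.
have rad (q : quat R) : qnorm q = s * qnorm h <-> qdot q q = s ^+ 2 * qdot h h.
  rewrite /qnorm; split=> [|->].
    by move=> /(congr1 (fun z => z ^+ 2)); rewrite exprMn !sqr_sqrtr // qdot_ge0.
  by rewrite sqrtrM ?sqr_ge0 // sqrtr_sqr gtr0_norm.
have mean_n : normal_space c f p (s *: mean).
  by apply/normal_spaceP; exact: intertwinerZ mean_normal.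
exists (s *: mean), (s * qnorm h); split=> //.
  by rewrite mulr_ge0 ?sqrtr_ge0 // ltW.
have shift v : (v.1 ^+ 2 + v.2 ^+ 2) = s -> second_fundamental_form c f p v v =
   s *: mean + ((v.1 ^+ 2 - v.2 ^+ 2) *: h + (e * (2 * (v.1 * v.2))) *: (N p * h)).
  by move=> vs; rewrite second_fundamental_formE vs kE scalerA [_ * e]mulrC.
have unitE v : qnorm (dd c f p v) = 1 <-> (v.1 ^+ 2 + v.2 ^+ 2) = s.
  apply: iff_trans (unit_vectorE v) _; rewrite -/rho; split=> [E|->].
    by rewrite -[LHS]mulr1 -(mulfV (lt0r_neq0 q0)) mulrA E mul1r.
  by rewrite mulVf // lt0r_neq0.
apply/seteqP; split=> [_ [v /= /unitE vs <-]|n [/= /normal_spaceP Nn /rad nr]].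
  split.
    apply/normal_spaceP; rewrite second_fundamental_formE.
    apply: intertwinerD (intertwinerZ _ mean_normal) _.
    exact: intertwinerD (intertwinerZ _ h_normal) (intertwinerZ _ k_normal).
  rewrite (shift v vs) addrC addKr; apply/rad; rewrite normE; congr (_ * _).
  by rewrite -vs exprMn ee; ring.
(* If h = 0 the ellipse is a point, and any unit tangent vector is sent to it. *)
have [a [b [ab nE]]] : exists a b : R, a ^+ 2 + b ^+ 2 = s ^+ 2 /\
    n - s *: mean = a *: h + b *: (N p * h).
  have [h0|h0] := eqVneq h 0.
    exists s, 0; split; first by rewrite expr0n addr0.
    have /eqP h00 : qdot h h == 0 by rewrite qdot_eq0 h0.
    move: nr; rewrite h00 mulr0 => /eqP; rewrite qdot_eq0 => /eqP ->.
    by rewrite h0 mulr0 !scaler0 addr0.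
  have Nd : N p * (n - s *: mean) = (n - s *: mean) * Rn p.
    by rewrite mulrBr mulrBl Nn (intertwinerZ _ mean_normal).
  have [a [b E]] := intertwiner_span RR h0 h_normal Nd; exists a, b; split=> //.
  move: nr; rewrite E normE => /mulIf; apply.
  by rewrite qdot_eq0.
(* II(v, v) turns twice as fast as v. *)
have [||v1 [v2 [v12 va vb]]] := half_angle (c := s) (a := a) (b := e * b).
- exact: ltW.
- by rewrite exprMn ee mul1r.
exists (v1, v2); first exact/unitE.
rewrite shift //= va vb mulrA -expr2 ee mul1r -nE addrC; exact: subrK.
Qed.

End Geometry.

Lemma superconformal_iff (M : riemann_surface R) (f N Rn : M -> quat R) :
  immersion f -> normal_vectors f N Rn ->
  superconformal f <->
  forall (c : chart R M) p, atlas c -> chart_dom c p -> hol_at c N p \/ hol_at c Rn p.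
Proof.
move=> fi fN; split=> H c p ac cp.
  exact: (circular_ellipse_iff fi fN ac cp).1 (H c p ac cp).
exact: (circular_ellipse_iff fi fN ac cp).2 (H c p ac cp).
Qed.

End Superconformal.

(** * The theorem *)

Theorem theorem5 (R : realType) (M : riemann_surface R) (f : M -> quat R)
    (hf : conformal_immersion f) :
  superconformal f <->
  (is_twistor_projection_of_holomorphic_curve f \/
   is_twistor_projection_of_holomorphic_curve (fun p => qconj (f p))).
Proof.
have [fi [N [Rn fN]]] := hf; split=> [sc|].
  have AB := (superconformal_iff fi fN).1 sc.
  have [L|L] := hol_dichotomy fi fN AB.
    by right; apply/(conj_twistor_projection_iff fi); exists N, Rn.
  by left; apply/(twistor_projection_iff fi); exists N, Rn.
case=> [/(twistor_projection_iff fi)|/(conj_twistor_projection_iff fi)] [N' [Rn' [fN' hol]]].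
  by apply/(superconformal_iff fi fN') => c p ac cp; right; exact: hol.
by apply/(superconformal_iff fi fN') => c p ac cp; left; exact: hol.
Qed.
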